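(* There is a polynomial-time online algorithm for Online Stochastic Matching with Timeouts whose expected total profit is, on every instance, at least $0.245$ times the expected profit of an optimal online algorithm.
   Context: Online Stochastic Matching with Timeouts. The input consists of: - a complete bipartite graph $G=(A\cup B,A\times B)$, where $A$ is a set of items and $B$ a set of buyer types; - for each edge $ab$, a probability $p_{ab}\in(0,1]$ and a profit $w_{ab}\ge 0$; - for each buyer type $b$, a positive integer timeout $t_b$ (items have unbounded timeouts); - a number $n$ of rounds, and a probability distribution on $B$ in which every probability is an integer multiple of $1/n$. The process runs for $n$ rounds. In each round a buyer's type $b$ is sampled independently from the distribution, with repetitions allowed. The online algorithm then chooses at most $t_b$ items that are still unmatched and probes the corresponding edges one at a time, in an order it chooses. - Each probed edge $ab$ exists independently with probability $p_{ab}$. - If a probed edge exists, the item $a$ is matched to this buyer, profit $w_{ab}$ is gained, and this buyer stops probing. - Otherwise the algorithm continues with the next chosen item. Each item can be matched at most once. The goal is to maximize the expected total profit, and this is compared to an optimal online algorithm. *)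

(* Defs.v *)
From mathcomp Require Import all_boot all_order all_algebra.
Set Implicit Arguments. Unset Strict Implicit. Unset Printing Implicit Defensive.
Import Order.TTheory GRing.Theory Num.Theory.
Local Open Scope ring_scope.

(* Instances (rational data, so that they can be given as input to a   *)
(* machine).                                                           *)
Record instance := Instance {
  nA : nat;
  nB : nat;
  prob : 'I_nA -> 'I_nB -> rat;
  wt : 'I_nA -> 'I_nB -> rat;
  tout : 'I_nB -> nat;
  nr : nat;                              (* number of rounds n *)
  cnt : 'I_nB -> nat                     (* Pr[type b] = cnt b / n *)
}.

Definition valid_instance (I : instance) : Prop :=
  [/\ forall (a : 'I_(nA I)) (b : 'I_(nB I)), 0 < prob a b <= 1,
      forall (a : 'I_(nA I)) (b : 'I_(nB I)), 0 <= wt a b,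
      forall b : 'I_(nB I), (0 < tout b)%N,
      (0 < nr I)%N &
      (\sum_(b < nB I) cnt b)%N = nr I].

Section Process.
Variable I : instance.
Local Notation item := 'I_(nA I).
Local Notation buyer := 'I_(nB I).

(* a round of history: buyer type, executed probe list, matched item (if any) *)
Definition round := (buyer * seq item * option item)%type.
Definition history := seq round.

Definition matched (h : history) : seq item :=
  flatten [seq (if r.2 is Some a then [:: a] else [::]) | r <- h].

(* The probe list actually executed when the algorithm proposes [s]:
   only unmatched, pairwise distinct items, at most t_b of them. *)
Definition exec_list (h : history) (b : buyer) (s : seq item) : seq item :=
  take (tout b) (undup [seq a <- s | a \notin matched h]).

Fixpoint probe_val (b : buyer) (s : seq item) (F : option item -> rat) : rat :=
  match s with
  | [::] => F None
  | a :: s' => prob a b * F (Some a) + (1 - prob a b) * probe_val b s' F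
  end.

(* A (randomized) online algorithm in behavioural form: given the whole
   observed history and the current buyer type, a finitely supported
   distribution over probe lists. *)
Definition rpolicy := history -> buyer -> seq (rat * seq item).

Definition valid_rpolicy (pol : rpolicy) : Prop :=
  forall h b, all (fun d => 0 <= d.1) (pol h b) /\ \sum_(d <- pol h b) d.1 = 1.

Fixpoint value_from (pol : rpolicy) (k : nat) (h : history) : rat :=
  match k with
  | 0 => 0
  | k'.+1 =>
      \sum_(b < nB I) ((cnt b)%:R / (nr I)%:R) *
        \sum_(d <- pol h b) d.1 *
          (let s := exec_list h b d.2 in
           probe_val b s (fun o =>
             (if o is Some a then wt a b else 0) + value_from pol k' (rcons h (b, s, o))))
  end.

Definition value (pol : rpolicy) : rat := value_from pol (nr I) [::].

End Process.

Inductive sym := B0 | B1 | Sep | Blank.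
Definition sym_eqb (x y : sym) : bool :=
  match x, y with
  | B0, B0 | B1, B1 | Sep, Sep | Blank, Blank => true | _, _ => false end.

Inductive dir := Lm | Rm | Sm.
Definition dir_int (d : dir) : int := match d with Lm => -1 | Rm => 1 | Sm => 0 end.

(* states 'I_(nq+2); start state ord0, halting state ord_max *)
Record TM := MkTM {
  nq : nat;
  delta : 'I_nq.+2 -> sym -> 'I_nq.+2 * sym * dir
}.

Definition config (M : TM) := ('I_(nq M).+2 * int * (int -> sym))%type.

Definition init_config (M : TM) (inp : seq sym) : config M :=
  (ord0, 0%:Z, fun z : int => if z is Posz m then nth Blank inp m else Blank).

Definition step (M : TM) (c : config M) : config M :=
  let: (q, hd, tp) := c in
  if q == ord_max then c else
  let: (q', s', d) := delta q (tp hd) in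
  (q', hd + dir_int d, fun z => if z == hd then s' else tp z).

Definition run (M : TM) (T : nat) (inp : seq sym) : config M :=
  iter T (step (M := M)) (init_config M inp).

Definition halts_within (M : TM) (T : nat) (inp : seq sym) : Prop :=
  (run M T inp).1.1 = ord_max.

Fixpoint take_nonblank (s : seq sym) : seq sym :=
  match s with
  | [::] => [::]
  | Blank :: _ => [::]
  | x :: s' => x :: take_nonblank s'
  end.

Definition tm_output (M : TM) (T : nat) (inp : seq sym) : seq sym :=
  let: (_, _, tp) := run M T inp in
  take_nonblank [seq tp (Posz i) | i <- iota 0 (T + size inp)].

Fixpoint bin_aux (fuel n : nat) : seq sym :=
  match fuel with
  | 0 => [::]
  | f.+1 => if n == 0%N then [::] else (if odd n then B1 else B0) :: bin_aux f n./2
  end.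
Definition enc_nat (n : nat) : seq sym := bin_aux n n ++ [:: Sep].
Definition enc_int (z : int) : seq sym :=
  (if z < 0 then B1 else B0) :: enc_nat `|z|%N.
Definition enc_rat (q : rat) : seq sym := enc_int (numq q) ++ enc_int (denq q).
Definition enc_bits (r : seq bool) : seq sym :=
  [seq (if x then B1 else B0) | x <- r] ++ [:: Sep].

Definition enc_instance (I : instance) : seq sym :=
  enc_nat (nA I) ++ enc_nat (nB I) ++ enc_nat (nr I) ++
  flatten [seq enc_rat (prob a b) ++ enc_rat (wt a b)
          | a <- enum 'I_(nA I), b <- enum 'I_(nB I)] ++
  flatten [seq enc_nat (tout b) ++ enc_nat (cnt b) | b <- enum 'I_(nB I)].

Definition enc_round (I : instance) (r : round I) : seq sym :=
  let: (b, s, o) := r in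
  enc_nat b ++ enc_nat (size s) ++ flatten (map (fun a : 'I_(nA I) => enc_nat a) s) ++
  enc_nat (if o is Some a then (a : nat).+1 else 0%N).

Definition enc_history (I : instance) (h : history I) : seq sym :=
  enc_nat (size h) ++ flatten [seq enc_round r | r <- h].

Fixpoint dec_nats (s : seq sym) (acc pw : nat) : seq nat :=
  match s with
  | [::] => [::]
  | Sep :: s' => acc :: dec_nats s' 0 1
  | B1 :: s' => dec_nats s' (acc + pw) (pw * 2)
  | B0 :: s' => dec_nats s' acc (pw * 2)
  | Blank :: s' => dec_nats s' acc pw
  end.

(* Machine input in a round: instance, history so far, current buyer type,
   and the algorithm's (whole) random string. *)
Definition tm_input (I : instance) (h : history I) (b : 'I_(nB I))
    (R : seq bool) : seq sym :=
  enc_instance I ++ enc_history h ++ enc_nat b ++ enc_bits R.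

Definition pbound (c k : nat) (I : instance) (m : nat) : nat :=
  (c * (m + nr I + 1) ^ k)%N.

Definition nrand (c k : nat) (I : instance) : nat :=
  pbound c k I (size (enc_instance I)).

Definition poly_time (M : TM) (c k : nat) : Prop :=
  forall (I : instance) (h : history I) (b : 'I_(nB I)) (R : seq bool),
    halts_within M (pbound c k I (size (tm_input h b R))) (tm_input h b R).

Definition tm_policy (M : TM) (c k : nat) (I : instance) (R : seq bool) : rpolicy I :=
  fun h b =>
    let inp := tm_input h b R in
    [:: (1, pmap (@insub nat (fun x => (x < nA I)%N) 'I_(nA I))
                 (dec_nats (tm_output M (pbound c k I (size inp)) inp) 0 1))].

Definition tm_value (M : TM) (c k : nat) (I : instance) : rat :=
  let L := nrand c k I in
  (2%:R ^+ L)^-1 * \sum_(R : L.-tuple bool) value (@tm_policy M c k I R).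

(* Main.v *)
Require Import Defs.
From mathcomp Require Import all_boot all_order all_algebra.
From mathcomp Require Import zify ring lra.
Import Order.TTheory GRing.Theory Num.Theory.

(** The algorithm keeps a price [nu a] for every item, equal to 0 after the last round and computed
    backwards in time. In a round, the items are scanned in a fixed order for each buyer type [b]
    with a running price [Gamma], initially 0; item [a] receives the gain
    [g = max 0 (p (w - nu a) - Gamma (p + 1/t))], which is added to [Gamma], and [nu a] grows by the
    average of [g] over the buyer types. An arriving buyer probes the items with positive gain, the
    last scanned first. By backward induction the expected profit of this policy is at least the
    sum of the prices of the unmatched items. Conversely [p (w - nu a) <= g + Gamma (p + 1/t)] for
    every item, so a probe list, which uses at most one match and [t] probes, earns at most
    [3 Gamma] more than the prices it destroys; hence an optimal algorithm earns at most four times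
    the sum of the initial prices, and the ratio is 1/4.

    The machine recomputes these prices from the instance and the length of the history. All prices
    share one denominator, so that only additions, subtractions and multiplications of naturals
    occur. The random string is never looked at, but its length makes the size [N] of the input
    exceed any chosen polynomial in the size of the instance and in the number of rounds; hence every
    loop of the program can be run exactly [N] times, and the running time is polynomial by the mere
    shape of the program. *)

Set Implicit Arguments. Unset Strict Implicit. Unset Printing Implicit Defensive.

(** * Stack machines on a single tape *)

(** A buyer has two scarce resources, one match and [t] probes. A probe of item [a] uses [p] of the
    first in expectation and [1/t] of the second, whence the weight [p + 1/t] with one price [Gamma]
    for both. The order matters: when the last scanned item is probed first, a success forfeits only
    items scanned earlier, whose gains add up to the [Gamma] that was charged. The constant 4 is one
    unit for the item prices and one each for the gains, the match and the probes. Prices depend on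
    the number of remaining rounds and never on which items are gone, so there are few of them.

    The obstacle on the machine side is the size of the numbers. The gain is affine in the prices,
    so passing to a new common denominator costs, per edge and round, a number of bits fixed by the
    instance; products of prices would not allow this. All numbers stay below [2 ^ N], so a loop of
    [N] passes always exhausts the bits of a number. *)

Definition cell := option bool.

Definition sym_of_cell (x : cell) : sym :=
  match x with None => Sep | Some true => B1 | Some false => B0 end.

Inductive instr :=
  | IGo of nat
  | IPush of nat & cell & nat
  | IPop of nat & nat & nat & nat & nat.

Definition stack_index (i : instr) : nat :=
  match i with IGo _ => 0 | IPush i _ _ => i | IPop i _ _ _ _ => i end.

Definition pop_target (qe q0 q1 qs : nat) (x : sym) : nat :=
  match x with Blank => qe | B0 => q0 | B1 => q1 | Sep => qs end.

Definition top_sym (s : seq cell) : sym :=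
  if s is x :: _ then sym_of_cell x else Blank.

Definition flat_state := (nat * seq (seq cell))%type.

(** The default instruction jumps to itself, so a counter beyond the code is a fixed point; [enter]
    turns such a counter into halting. *)
Definition fetch (code : seq instr) (q : nat) : instr := nth (IGo q) code q.

Definition flat_step (code : seq instr) (c : flat_state) : flat_state :=
  let: (q, ss) := c in
  match fetch code q with
  | IGo q' => (q', ss)
  | IPush i x q' => (q', set_nth [::] ss i (x :: nth [::] ss i))
  | IPop i qe q0 q1 qs =>
      (pop_target qe q0 q1 qs (top_sym (nth [::] ss i)),
       set_nth [::] ss i (behead (nth [::] ss i)))
  end.

Definition instr_ok (K P : nat) (i : instr) : bool :=
  match i with
  | IGo q => q <= P
  | IPush i _ q => (i < K) && (q <= P)
  | IPop i qe q0 q1 qs => [&& i < K, qe <= P, q0 <= P, q1 <= P & qs <= P]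
  end.

Definition code_ok (K : nat) (code : seq instr) : bool :=
  all (instr_ok K (size code)) code.

(** * Tape moves that carry out one stack instruction *)

Inductive phase := Skip | Ins | Far | Swp | Ret.

(* Program counter, phase, number of blanks still to be met, carried symbol. *)
Definition mstate := (nat * phase * nat * sym)%type.

Definition is_blank (x : sym) : bool := if x is Blank then true else false.

Section Micro.
Variables (K : nat) (code : seq instr).

Definition enter (q : nat) : option mstate :=
  if q < size code then Some (q, Skip, stack_index (fetch code q), Blank) else None.

(** One step of the right shift: write the carried symbol and pick up the one under the head. The
    last separator is not rewritten; the blank just right of the stacks takes its role. *)
Definition ins_step (q : nat) (x : sym) (q' r : nat) (s : sym) : option mstate * sym * dir :=
  (if is_blank s then
     if r <= 1 then Some (q', Ret, K.+1, Blank) else Some (q, Ins, r.-1, Blank)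
   else Some (q, Ins, r, s), x, Rm).

(** [Skip] walks to the top of the wanted stack and [Ins] shifts the tape right from there. For a
    pop, [Far] walks to the last separator and [Swp] shifts everything left on the way back, so the
    popped symbol is known only at the end, as the last one carried. [Ret] finds cell 0 by counting
    separators and the blank in cell -1. *)
Definition mdelta (m : mstate) (s : sym) : option mstate * sym * dir :=
  let: (q, ph, r, c) := m in
  match ph with
  | Skip =>
      if 0 < r then (Some (q, Skip, r - is_blank s, Blank), s, Rm) else
      match fetch code q with
      | IGo q' => (enter q', s, Sm)
      | IPush i x q' => ins_step q (sym_of_cell x) q' (K - i) s
      | IPop i qe _ _ _ =>
          if is_blank s then (Some (qe, Ret, i.+2, Blank), s, Sm)
          else (Some (q, Far, K - i, Blank), s, Rm)
      end
  | Ins => if fetch code q is IPush i x q' then ins_step q c q' r s else (None, s, Sm)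
  | Far =>
      if is_blank s then
        if r <= 1 then (Some (q, Swp, K - stack_index (fetch code q), Blank), s, Sm)
        else (Some (q, Far, r.-1, Blank), s, Rm)
      else (Some (q, Far, r, Blank), s, Rm)
  | Swp =>
      if is_blank s then
        if 0 < r then (Some (q, Swp, r.-1, Blank), c, Lm)
        else if fetch code q is IPop i qe q0 q1 qs then
          (Some (pop_target qe q0 q1 qs c, Ret, i.+1, Blank), s, Sm)
        else (None, s, Sm)
      else (Some (q, Swp, r, s), c, Lm)
  | Ret =>
      if is_blank s then
        if r <= 1 then (enter q, s, Rm) else (Some (q, Ret, r.-1, Blank), s, Lm)
      else (Some (q, Ret, r, Blank), s, Lm)
  end.

Definition mstate_ok (m : mstate) : bool :=
  let: (q, ph, r, c) := m in (q <= size code) && (r <= K.+2).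

Definition ostate_ok (o : option mstate) : bool :=
  if o is Some m then mstate_ok m else true.

Lemma fetch_ok q : code_ok K code -> 0 < K -> q <= size code ->
  instr_ok K (size code) (fetch code q).
Proof.
move=> /(all_nthP (IGo q)) ok K0 qP; rewrite /fetch; case: (ltnP q (size code)) => h.
  exact: ok.
by rewrite nth_default.
Qed.

(** With program counter and blank counter bounded, finitely many control states occur, as a Turing
    machine requires. *)
Lemma mdelta_ok m s : code_ok K code -> 0 < K -> mstate_ok m ->
  ostate_ok (mdelta m s).1.1.
Proof.
move=> okc K0; case: m => [[[q ph] r] c] /andP[qP rK].
have F := fetch_ok okc K0 qP.
have E q' : ostate_ok (enter q').
  rewrite /enter; case: ltnP => // h /=.
  move: (fetch_ok okc K0 (ltnW h)); case: (fetch code q') => [?|i ? ?|i ? ? ? ?] /=; lia.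
have I x q' r' s' : q' <= size code -> r' <= K.+2 ->
    ostate_ok (ins_step q x q' r' s').1.1.
  by move=> ? ?; rewrite /ins_step; case: is_blank => /=; [case: leqP|]; rewrite /=; lia.
case: ph => /=.
- case: posnP => r0 /=; last by case: is_blank => /=; lia.
  move: F; case: (fetch code q) => [q'|i x q'|i qe q0 q1 qs] /= F.
  + exact: E.
  + by apply: (I Blank); lia.
  + by case: is_blank => /=; lia.
- move: F; case: (fetch code q) => [q'|i x q'|i qe q0 q1 qs] //= F.
  by apply: (I Blank); lia.
- by case: is_blank => /=; [case: leqP => /=|]; lia.
- case: is_blank => /=; last by lia.
  case: posnP => r0 /=; last by lia.
  move: F; case: (fetch code q) => [q'|i x q'|i qe q0 q1 qs] //= F.
  by case: c => /=; lia.
- case: is_blank => /=; last by lia.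
  by case: leqP => h /=; [exact: E|lia].
Qed.

Definition zconf := (option mstate * seq sym * seq sym)%type.

(** Makes one more blank explicit when a move to the right leaves the recorded part of the tape. *)
Definition nonil (r : seq sym) : seq sym := if r is [::] then [:: Blank] else r.

(* The left part always ends with the cell of index [-1]. *)
Definition zstep (m : mstate) (l r : seq sym) : option zconf :=
  let: (o, s, d) := mdelta m (head Blank r) in
  match d with
  | Sm => Some (o, l, s :: behead r)
  | Rm => Some (o, s :: l, nonil (behead r))
  | Lm => if l is x :: l' then Some (o, l', x :: s :: behead r) else None
  end.

Inductive zreach : nat -> zconf -> zconf -> Prop :=
  | zreach0 z : zreach 0 z z
  | zreachS n m l r z z' : zstep m l r = Some z -> zreach n z z' ->
      zreach n.+1 (Some m, l, r) z'.

Lemma zreach_trans n1 n2 z1 z2 z3 :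
  zreach n1 z1 z2 -> zreach n2 z2 z3 -> zreach (n1 + n2) z1 z3.
Proof.
move=> h; elim: h z3 => [//|n m l r z z' e _ IH] z3 h3.
by rewrite addSn; apply: zreachS e _; apply: IH.
Qed.

Lemma zreachS_inv n m l r z' : zreach n.+1 (Some m, l, r) z' ->
  exists2 z, zstep m l r = Some z & zreach n z z'.
Proof. by move=> h; inversion h; subst; exists z. Qed.

Definition nblank (u : seq sym) := count is_blank u.

Definition layout (ss : seq (seq cell)) : seq sym :=
  flatten [seq map sym_of_cell s ++ [:: Blank] | s <- ss].

Arguments layout : simpl never.

Lemma is_blank_cell x : is_blank (sym_of_cell x) = false.
Proof. by case: x => [[]|]. Qed.

Lemma layout_cons s ss :
  layout (s :: ss) = map sym_of_cell s ++ Blank :: layout ss.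
Proof. by rewrite /layout /= -catA. Qed.

Lemma layout_nil k : layout (nseq k [::]) = nseq k Blank.
Proof. by elim: k => // k IH; rewrite /= layout_cons IH. Qed.

Lemma layout_cat ss1 ss2 : layout (ss1 ++ ss2) = layout ss1 ++ layout ss2.
Proof. by rewrite /layout map_cat flatten_cat. Qed.

Lemma nblank_layout ss : nblank (layout ss) = size ss.
Proof.
elim: ss => [//|s ss IH]; rewrite layout_cons /nblank count_cat /=.
rewrite (_ : count is_blank (layout ss) = size ss) //.
by rewrite count_map (eq_count (a2 := pred0)) ?count_pred0 // => x /=; rewrite is_blank_cell.
Qed.

Lemma layout_rcons ss : 0 < size ss -> exists u, layout ss = u ++ [:: Blank].
Proof.
case/lastP: ss => [//|ss s] _; exists (layout ss ++ map sym_of_cell s).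
by rewrite -cats1 layout_cat layout_cons /layout /= -!catA.
Qed.

Lemma zskip q r l u x :
  nblank (rcons u Blank) = r ->
  zreach (size u).+1 (Some (q, Skip, r, Blank), l, rcons u Blank ++ x)
    (Some (q, Skip, 0, Blank), Blank :: rev u ++ l, nonil x).
Proof.
move=> <-; elim: u l => [|y u IH] l.
  by apply: zreachS; [rewrite /zstep /=; reflexivity|exact: zreach0].
have -> : rcons (y :: u) Blank ++ x = y :: rcons u Blank ++ x by [].
have -> : nblank (rcons (y :: u) Blank) = is_blank y + nblank (rcons u Blank) by [].
have h : 0 < nblank (rcons u Blank) by rewrite -cats1 /nblank count_cat /=; lia.
apply: zreachS.
  rewrite /zstep /mdelta /= ifT; last by lia.
  rewrite /= addKn.
  have -> : nonil (rcons u Blank ++ x) = rcons u Blank ++ x by case: (u).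
  reflexivity.
by rewrite rev_cons (cat_rcons y (rev u)); apply: IH.
Qed.

Lemma zins q i x0 q' x r l u rest :
  fetch code q = IPush i x0 q' -> nblank (rcons u Blank) = r ->
  zreach (size u).+1 (Some (q, Ins, r, x), l, rcons u Blank ++ rest)
    (Some (q', Ret, K.+1, Blank), rev (x :: u) ++ l, nonil rest).
Proof.
move=> fe <-; elim: u x l => [|y u IH] x l.
  by apply: zreachS; [rewrite /zstep /= fe /ins_step /=; reflexivity|exact: zreach0].
have -> : rcons (y :: u) Blank ++ rest = y :: rcons u Blank ++ rest by [].
have -> : nblank (rcons (y :: u) Blank) = is_blank y + nblank (rcons u Blank) by [].
have h : 0 < nblank (rcons u Blank) by rewrite -cats1 /nblank count_cat /=; lia.
apply: zreachS.
  rewrite /zstep /mdelta fe /ins_step /=.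
  have -> : (if is_blank y then
     if is_blank y + nblank (rcons u Blank) <= 1 then Some (q', Ret, K.+1, Blank)
     else Some (q, Ins, (is_blank y + nblank (rcons u Blank)).-1, Blank)
     else Some (q, Ins, is_blank y + nblank (rcons u Blank), y)) =
     Some (q, Ins, nblank (rcons u Blank), y).
    by case: y => //=; case: leqP => //; lia.
  have -> : nonil (rcons u Blank ++ rest) = rcons u Blank ++ rest by case: (u).
  reflexivity.
by rewrite rev_cons (cat_rcons x (rev _)); apply: IH.
Qed.

Lemma zskip_ins q i x q' l u rest :
  fetch code q = IPush i x q' -> nblank (rcons u Blank) = K - i ->
  zreach (size u).+1 (Some (q, Skip, 0, Blank), l, rcons u Blank ++ rest)
    (Some (q', Ret, K.+1, Blank), rev (sym_of_cell x :: u) ++ l, nonil rest).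
Proof.
move=> fe e; have := zins (sym_of_cell x) l rest fe e.
by case/zreachS_inv => z e1; apply: zreachS; rewrite -e1 /zstep /= fe.
Qed.

Lemma zret q r v y rest :
  nblank (rcons v y) = r ->
  zreach (size v).+2 (Some (q, Ret, r.+1, Blank), rev v ++ [:: Blank], y :: rest)
    (enter q, [:: Blank], v ++ y :: rest).
Proof.
move=> <-; elim/last_ind: v y rest => [|v x IH] y rest.
  case By: (is_blank y); (apply: zreachS;
    [by rewrite /zstep /= By /=; reflexivity|]);
  (apply: zreachS; [by rewrite /zstep /=; reflexivity|]); exact: zreach0.
have -> : nblank (rcons (rcons v x) y) = is_blank y + nblank (rcons v x).
  by rewrite /nblank -!cats1 !count_cat /=; lia.
rewrite size_rcons rev_rcons cat_rcons /=.
apply: zreachS; last by apply: IH.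
rewrite /zstep /=; case By: (is_blank y) => //=.
Qed.

Lemma zfar q r l u rest :
  nblank (rcons u Blank) = r ->
  zreach (size u).+1 (Some (q, Far, r, Blank), l, rcons u Blank ++ rest)
    (Some (q, Swp, K - stack_index (fetch code q), Blank), rev u ++ l, Blank :: rest).
Proof.
move=> <-; elim: u l => [|y u IH] l.
  by apply: zreachS; [rewrite /zstep /=; reflexivity|exact: zreach0].
have -> : rcons (y :: u) Blank ++ rest = y :: rcons u Blank ++ rest by [].
have -> : nblank (rcons (y :: u) Blank) = is_blank y + nblank (rcons u Blank) by [].
have h : 0 < nblank (rcons u Blank) by rewrite -cats1 /nblank count_cat /=; lia.
apply: zreachS.
  have -> : zstep (q, Far, is_blank y + nblank (rcons u Blank), Blank) l
      (y :: rcons u Blank ++ rest) = Some (Some (q, Far, nblank (rcons u Blank), Blank),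
      y :: l, rcons u Blank ++ rest).
    have e : nonil (rcons u Blank ++ rest) = rcons u Blank ++ rest by case: (u).
    rewrite /zstep /=; case: y => /=; rewrite ?e //; by case: leqP => h2 //; exfalso; lia.
  reflexivity.
by rewrite rev_cons (cat_rcons y (rev u)); apply: IH.
Qed.

(** The sweep runs leftwards, hence the induction from the right end of the word. When it stops, the
    carried symbol is the first letter of the word, and all other letters have moved one cell to the
    left. *)
Lemma zsweep q i qe q0 q1 qs c k u y l0 rest :
  fetch code q = IPop i qe q0 q1 qs -> nblank (rcons u y) = k ->
  zreach (size u).+2 (Some (q, Swp, k, c), rev u ++ Blank :: l0, y :: rest)
    (Some (pop_target qe q0 q1 qs (head Blank (rcons u y)), Ret, i.+1, Blank),
     l0, Blank :: behead (rcons u y) ++ c :: rest).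
Proof.
move=> fe <-; elim/last_ind: u y c rest => [|u x IH] y c rest.
  case By: (is_blank y); (apply: zreachS;
    [by rewrite /zstep /= By /=; reflexivity|]);
  (apply: zreachS; [by rewrite /zstep /= fe /=; reflexivity|]).
  - by case: y By => //= _; apply: zreach0.
  - exact: zreach0.
have -> : nblank (rcons (rcons u x) y) = is_blank y + nblank (rcons u x).
  by rewrite /nblank -!cats1 !count_cat /=; lia.
rewrite size_rcons rev_rcons /=.
apply: (@zreachS _ _ _ _ (Some (q, Swp, nblank (rcons u x), y), rev u ++ Blank :: l0, x :: c :: rest)).
  by rewrite /zstep /=; case: y.
have := IH x y (c :: rest).
have -> : head Blank (rcons (rcons u x) y) = head Blank (rcons u x) by case: (u).
have -> // : behead (rcons (rcons u x) y) ++ c :: rest = behead (rcons u x) ++ y :: c :: rest.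
by case: (u) => //= a u0; rewrite cat_rcons.
Qed.

(** The number [j] of explicit blanks on the right changes with pushes and pops, so the simulation
    lemmas leave it existential. *)
Definition home (q : nat) (ss : seq (seq cell)) (j : nat) : zconf :=
  (enter q, [:: Blank], layout ss ++ nseq j Blank).

Lemma zskip_layout q l pre x :
  zreach (size (layout pre)) (Some (q, Skip, size pre, Blank), l, layout pre ++ x)
    (Some (q, Skip, 0, Blank), rev (layout pre) ++ l, if pre is [::] then x else nonil x).
Proof.
case: pre => [|s pre]; first exact: zreach0.
have [//|u eu] := @layout_rcons (s :: pre).
rewrite -(nblank_layout (s :: pre)) eu rev_cat /= size_cat addn1 cats1.
exact: zskip.
Qed.

Lemma layout_consP s ss : exists u, layout (s :: ss) = rcons u Blank.
Proof. by have [//|u ->] := @layout_rcons (s :: ss); exists u; rewrite cats1. Qed.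

Lemma zpush q i x q' pre s post j :
  fetch code q = IPush i x q' -> q < size code -> i = size pre ->
  size (pre ++ s :: post) = K ->
  exists j' n, n <= 4 * size (layout (pre ++ s :: post)) + 8 /\
    zreach n (home q (pre ++ s :: post) j) (home q' (pre ++ (x :: s) :: post) j').
Proof.
move=> fe qP ei eK; rewrite /home [enter q]/enter qP fe /= ei !layout_cat -!(catA (layout pre)).
have [u eu] := layout_consP s post.
have nu : nblank (rcons u Blank) = K - i.
  by rewrite -eu nblank_layout -eK size_cat /= ei addKn.
exists j.-1; eexists; split; last first.
  apply: zreach_trans (zskip_layout _ _ _ _) _.
  have -> y : (if pre is [::] then layout (s :: post) ++ y else nonil (layout (s :: post) ++ y)) =
    layout (s :: post) ++ y by rewrite eu; case: (pre); case: (u).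
  rewrite eu; apply: zreach_trans (zskip_ins _ _ fe nu) _.
  rewrite (catA (rev (_ :: u))) -rev_cat.
  have -> : nonil (nseq j Blank) = Blank :: nseq j.-1 Blank by case: (j).
  have -> : (layout pre ++ layout ((x :: s) :: post)) ++ nseq j.-1 Blank =
     (layout pre ++ sym_of_cell x :: u) ++ Blank :: nseq j.-1 Blank.
    have -> : layout ((x :: s) :: post) = sym_of_cell x :: layout (s :: post).
      by rewrite !layout_cons.
    by rewrite eu /= -!catA /= cat_rcons.
  apply: zret; rewrite rcons_cat rcons_cons /nblank count_cat /= is_blank_cell.
  rewrite -/(nblank (layout pre)) -/(nblank (rcons u Blank)) nblank_layout nu.
  by rewrite -eK size_cat /= -ei; lia.
rewrite eu !size_cat /= size_rcons; lia.
Qed.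

Lemma zpop q i qe q0 q1 qs pre s post j :
  fetch code q = IPop i qe q0 q1 qs -> q < size code -> i = size pre ->
  size (pre ++ s :: post) = K ->
  exists j' n, n <= 4 * size (layout (pre ++ s :: post)) + 8 /\
    zreach n (home q (pre ++ s :: post) j)
      (home (pop_target qe q0 q1 qs (top_sym s)) (pre ++ behead s :: post) j').
Proof.
move=> fe qP ei eK; rewrite /home [enter q]/enter qP fe /= ei !layout_cat -!(catA (layout pre)).
(* The blank left of stack [i] ends stack [i - 1], or is cell -1 when [i = 0]; [v] is what lies
   further left. *)
have [v ev] : exists v, (Blank :: v = rev (layout pre) ++ [:: Blank]) /\
    (pre = [::] /\ v = [::] \/ exists2 w, v = rev w ++ [:: Blank] & layout pre = rcons w Blank).
  case: (pre) => [|s0 p0]; first by exists [::]; split => //; left.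
  have [w ew] := layout_consP s0 p0; exists (rev w ++ [:: Blank]); split; last by right; exists w.
  by rewrite ew rev_rcons.
case: s eK => [|x s] eK.
  exists j; eexists; split; last first.
    apply: zreach_trans (zskip_layout _ _ _ _) _.
    have -> y : (if pre is [::] then layout ([::] :: post) ++ y else nonil (layout ([::] :: post) ++ y)) =
      layout ([::] :: post) ++ y by case: (pre).
    rewrite layout_cons /=; apply: zreachS.
      by rewrite /zstep /= fe /=; reflexivity.
    rewrite -(catA (layout pre) (Blank :: _)) /=.
    apply: zret; rewrite /nblank -cats1 count_cat -/(nblank (layout pre)) nblank_layout /=; lia.
  rewrite !size_cat /=; lia.
have [u eu] := layout_consP s post.
have nu : nblank (rcons u Blank) = K - i.
  by rewrite -eu nblank_layout -eK size_cat /= ei addKn.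
have ex : layout ((x :: s) :: post) = sym_of_cell x :: rcons u Blank.
  by rewrite -eu !layout_cons.
exists j.+1; eexists; split; last first.
  apply: zreach_trans (zskip_layout _ _ _ _) _.
  have -> y : (if pre is [::] then layout ((x :: s) :: post) ++ y else nonil (layout ((x :: s) :: post) ++ y)) =
    layout ((x :: s) :: post) ++ y by rewrite ex; case: (pre).
  rewrite ex /=.
  apply: zreachS.
    rewrite /zstep /= fe is_blank_cell /=.
    have -> y : nonil (rcons u Blank ++ y) = rcons u Blank ++ y by case: (u).
    reflexivity.
  apply: zreach_trans (zfar _ _ _ nu) _.
  rewrite fe /=.
  have -> : rev u ++ sym_of_cell x :: rev (layout pre) ++ [:: Blank] =
     rev (sym_of_cell x :: u) ++ Blank :: v.
    by rewrite (ev.1) rev_cons cat_rcons.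
  apply: zreach_trans (zsweep _ _ _ fe _) _.
    by rewrite rcons_cons /nblank /= is_blank_cell.
  rewrite /= -/(top_sym (x :: s)).
  set t := pop_target _ _ _ _ _.
  have -> : (layout pre ++ layout (s :: post)) ++ nseq j.+1 Blank =
    layout pre ++ rcons u Blank ++ Blank :: nseq j Blank by rewrite eu -catA.
  set rr := rcons u Blank ++ _.
  have F : zreach (size (layout pre) + 1) (Some (t, Ret, i.+1, Blank), v, Blank :: rr)
      (enter t, [:: Blank], layout pre ++ rr).
    case: (ev.2) => [[epre evn]|[w -> ew]].
      rewrite ei epre evn /layout /=; apply: zreachS; last exact: zreach0.
      rewrite /zstep /=.
      by have -> : nonil rr = rr by rewrite /rr; case: (u).
    rewrite ew cat_rcons size_rcons addn1; apply: zret.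
    by rewrite -ew nblank_layout.
  exact: F.
rewrite ex !size_cat /= size_rcons; lia.
Qed.

Lemma zgo q q' ss j :
  fetch code q = IGo q' -> q < size code -> 0 < size ss ->
  exists j' n, n <= 4 * size (layout ss) + 8 /\ zreach n (home q ss j) (home q' ss j').
Proof.
move=> fe qP h; exists j, 1; split; first by lia.
rewrite /home {1}/enter qP fe /=; apply: zreachS; last exact: zreach0.
rewrite /zstep /= fe; case: ss h => [//|s ss] _.
by have [u ->] := layout_consP s ss; case: (u).
Qed.

Lemma size_layout_flat_step q ss : size ss = K -> code_ok K code -> 0 < K -> q < size code ->
  size (flat_step code (q, ss)).2 = K /\
  size (layout (flat_step code (q, ss)).2) <= (size (layout ss)).+1.
Proof.
move=> eK okc K0 qP; have := fetch_ok okc K0 (ltnW qP).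
rewrite /flat_step; case: (fetch code q) => [q'|i x q'|i qe q0 q1 qs] //=.
all: move=> h; have iK : i < size ss by lia.
all: rewrite size_set_nth (maxn_idPr iK) set_nthE iK; split => //.
all: rewrite -[X in (size (layout X)).+1](cat_take_drop i ss) (drop_nth [::] iK) !layout_cat !layout_cons !size_cat /=.
- by lia.
- by rewrite !size_map size_behead; lia.
Qed.

Lemma zflat_step q ss j : size ss = K -> code_ok K code -> 0 < K -> q < size code ->
  exists j' n, n <= 4 * size (layout ss) + 8 /\
    zreach n (home q ss j) (home (flat_step code (q, ss)).1 (flat_step code (q, ss)).2 j').
Proof.
move=> eK okc K0 qP; have := fetch_ok okc K0 (ltnW qP).
rewrite /flat_step; case fe: (fetch code q) => [q'|i x q'|i qe q0 q1 qs] //= h.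
- by apply: zgo; rewrite ?eK.
all: have iK : i < size ss by lia.
all: rewrite set_nthE iK; move: (cat_take_drop i ss); rewrite (drop_nth [::] iK) => ess.
all: move: (size_takel (ltnW iK)) => es.
- by have := @zpush _ _ _ _ (take i ss) (nth [::] ss i) (drop i.+1 ss) j fe qP (esym es); rewrite ess; apply.
- by have := @zpop _ _ _ _ _ _ (take i ss) (nth [::] ss i) (drop i.+1 ss) j fe qP (esym es); rewrite ess; apply.
Qed.

Definition flat_run n c := iter n (flat_step code) c.

(** One instruction adds at most one symbol, so the tape stays below [size (layout ss) + n]
    throughout, and each instruction costs a bounded number of traversals. *)
Lemma zflat_run n q ss j : size ss = K -> code_ok K code -> 0 < K ->
  (forall i, i < n -> (flat_run i (q, ss)).1 < size code) ->
  size (flat_run n (q, ss)).2 = K /\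
  size (layout (flat_run n (q, ss)).2) <= size (layout ss) + n /\
  exists j' m, m <= n * (4 * (size (layout ss) + n) + 8) /\
    zreach m (home q ss j) (home (flat_run n (q, ss)).1 (flat_run n (q, ss)).2 j').
Proof.
move=> eK okc K0; elim: n => [|n IH] h.
  by split=> //; split; [by rewrite addn0|]; exists j, 0; split => //; apply: zreach0.
have [i|e1 [e2 [j1 [m1 [b1 r1]]]]] := IH; first by move=> ?; apply: h; lia.
rewrite /flat_run iterS -/(flat_run n (q, ss)).
have qn := h n (leqnn _); move: e1 e2 r1 qn.
case: (flat_run n (q, ss)) => q1 ss1 /= e1 e2 r1 qn.
have [e3 e4] := size_layout_flat_step e1 okc K0 qn.
have [j2 [m2 [b2 r2]]] := zflat_step j1 e1 okc K0 qn.
split=> //; split; first by apply: leq_trans e4 _; rewrite addnS ltnS.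
exists j2, (m1 + m2); split; last exact: zreach_trans r1 r2.
rewrite mulSn addnC; apply: leq_add; first by apply: leq_trans b2 _; lia.
by apply: leq_trans b1 _; rewrite leq_mul2l; lia.
Qed.

End Micro.

(** * The Turing machine built from the tape moves *)

Section Machine.
Variables (K : nat) (code : seq instr).
Hypotheses (okc : code_ok K code) (K0 : 0 < K) (code0 : 0 < size code).

Definition phase_code (p : phase) : nat :=
  match p with Skip => 0 | Ins => 1 | Far => 2 | Swp => 3 | Ret => 4 end.
Definition phase_decode (n : nat) : phase :=
  match n with 0 => Skip | 1 => Ins | 2 => Far | 3 => Swp | _ => Ret end.
Definition sym_code (x : sym) : nat :=
  match x with B0 => 0 | B1 => 1 | Sep => 2 | Blank => 3 end.
Definition sym_decode (n : nat) : sym :=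
  match n with 0 => B0 | 1 => B1 | 2 => Sep | _ => Blank end.

Definition fstate : finType := ('I_(size code).+1 * 'I_5 * 'I_K.+3 * 'I_4)%type.

Definition fstate_of (m : mstate) : fstate :=
  let: (q, ph, r, c) := m in (inord q, inord (phase_code ph), inord r, inord (sym_code c)).
Definition mstate_of (s : fstate) : mstate :=
  let: (q, ph, r, c) := s in (q : nat, phase_decode ph, r : nat, sym_decode c).

Lemma fstate_ofK m : mstate_ok K code m -> mstate_of (fstate_of m) = m.
Proof.
case: m => [[[q ph] r] c] /andP[qP rK] /=.
rewrite !inordK //; [|by case: c|by case: ph].
by case: ph; case: c.
Qed.

Definition start_state : mstate := (0, Skip, stack_index (fetch code 0), Blank).

(** The shift by one frees index 0, which the model fixes as the start: it is a second name of
    [start_state]. The last index remains for halting. *)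
Definition tm_state (m : mstate) : 'I_(#|fstate|).+2 := inord (enum_rank (fstate_of m)).+1.
Definition tm_unstate (q : 'I_(#|fstate|).+2) : mstate :=
  if (q : nat) == 0 then start_state
  else mstate_of (nth (fstate_of start_state) (enum fstate) q.-1).

Lemma tm_state_val m : (tm_state m : nat) = (enum_rank (fstate_of m)).+1.
Proof. by rewrite /tm_state inordK // !ltnS ltnW // ltnS. Qed.

Lemma tm_stateK m : mstate_ok K code m -> tm_unstate (tm_state m) = m.
Proof.
move=> ok; rewrite /tm_unstate tm_state_val /= -[RHS](fstate_ofK ok).
by rewrite -[nth _ _ _](enum_val_nth (fstate_of start_state) (enum_rank (fstate_of m))) enum_rankK.
Qed.

Lemma tm_state_max m : tm_state m != ord_max.
Proof.
by rewrite -(inj_eq val_inj) /= tm_state_val eqSS neq_ltn ltn_ord.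
Qed.

Definition stack_tm : TM :=
  @MkTM #|fstate| (fun q s =>
    let: (o, s', d) := mdelta K code (tm_unstate q) s in
    (if o is Some m then tm_state m else ord_max, s', d)).

Definition state_rep (q : 'I_(nq stack_tm).+2) (o : option mstate) : Prop :=
  if o is Some m then
    [/\ mstate_ok K code m, q != ord_max & tm_unstate q = m]
  else q = ord_max.

(** The left part of the zipper reaches down to cell -1, so its length is the head position plus
    one; cells outside the zipper are blank by the default of [nth]. *)
Definition conf_rep (c : config stack_tm) (z : zconf) : Prop :=
  [/\ state_rep c.1.1 z.1.1,
      c.1.2 = ((size z.1.2)%:Z - 1)%R,
      forall j : nat, c.2 (c.1.2 + j%:Z)%R = nth Blank z.2 j
    & forall j : nat, c.2 (c.1.2 - 1 - j%:Z)%R = nth Blank z.1.2 j].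

Lemma step_rep c m l r z : conf_rep c (Some m, l, r) -> zstep K code m l r = Some z ->
  conf_rep (step c) z.
Proof.
case: c => [[q hd] tp] [[okm qm eq_m] /= ehd rR rL].
have h0 : tp hd = head Blank r by have := rR 0; rewrite addr0 nth0.
rewrite /step (negbTE qm) /zstep /=.
have md := mdelta_ok (head Blank r) okc K0 okm.
rewrite eq_m h0; case: (mdelta _ _ _ _) md => [[o s] d] /= md.
have st : state_rep (if o is Some m0 then tm_state m0 else ord_max) o.
  by case: o md => [m'|] //= md; split; rewrite ?tm_stateK ?tm_state_max.
case: d; rewrite /dir_int.
- case: l ehd rL => [//|x l] ehd rL [<-]; split => //=.
  + by rewrite ehd /=; lia.
  + move=> [|[|j]] /=.
    * rewrite addr0 ifF; last by apply/eqP; lia.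
      by have := rL 0; rewrite subr0 /= => <-.
    * by rewrite ifT //; apply/eqP; lia.
    * rewrite ifF; last by apply/eqP; lia.
      have := rR j.+1; rewrite nth_behead => <-; congr tp; lia.
  + move=> j; rewrite ifF; last by apply/eqP; lia.
    have := rL j.+1 => /= <-; congr tp; lia.
- move=> [<-]; split => //=.
  + by rewrite ehd /=; lia.
  + move=> j; rewrite ifF; last by apply/eqP; lia.
    have -> : nth Blank (nonil (behead r)) j = nth Blank (behead r) j.
      by case: (behead r) => //=; case: j => //= j; rewrite nth_nil.
    by rewrite nth_behead -rR; congr tp; lia.
  + move=> [|j] /=.
    * by rewrite ifT //; apply/eqP; lia.
    * rewrite ifF; last by apply/eqP; lia.
      rewrite -rL; congr tp; lia.
- move=> [<-]; split => //=.
  + by rewrite addr0.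
  + move=> [|j] /=.
    * by rewrite ifT //; apply/eqP; lia.
    * rewrite ifF; last by apply/eqP; lia.
      rewrite nth_behead -rR; congr tp; lia.
  + move=> j; rewrite ifF; last by apply/eqP; lia.
    rewrite -rL; congr tp; lia.
Qed.

Lemma zreach_rep n c z z' : zreach K code n z z' -> conf_rep c z ->
  conf_rep (iter n (@step stack_tm) c) z'.
Proof.
move=> h; elim: h c => [//|{}n m l r {}z {}z' e _ IH] c hc.
by rewrite iterSr; apply: IH; apply: step_rep hc e.
Qed.

Definition flat_init (inp : seq cell) : flat_state := (0, inp :: nseq K.-1 [::]).

Lemma init_rep inp :
  conf_rep (init_config stack_tm (map sym_of_cell inp))
    (home code 0 (flat_init inp).2 0).
Proof.
rewrite /home /enter code0; split => //=.
- split => //.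
  rewrite /mstate_ok /=; move: (fetch_ok okc K0 (leq0n _)).
  by case: (fetch code 0) => //= *; lia.
- move=> j; rewrite add0n layout_cons cats0 nth_cat.
  case: ltnP => // h; rewrite nth_default //.
  rewrite layout_nil.
  case: (j - _) => //= k; rewrite nth_nseq; by case: ltnP.
- move=> j; rewrite (_ : (0 - 1 - j%:Z)%R = Negz j); last by lia.
  by case: j => //= j; rewrite nth_nil.
Qed.

Lemma iter_step_halt (M : TM) T (c : config M) : c.1.1 = ord_max -> iter T (@step M) c = c.
Proof.
by move=> e; elim: T => //= T ->; case: c e => [[q hd] tp] /= ->; rewrite eqxx.
Qed.

Lemma take_nonblank_cells s t : take_nonblank (map sym_of_cell s ++ Blank :: t) = map sym_of_cell s.
Proof. by elim: s => //= x s ->; case: x => [[]|]. Qed.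

(** A halted configuration is frozen, so any larger [T] gives the same tape. The output is stack 0
    because reading stops at its separator. *)
Lemma stack_tm_run inp n T q ss :
  (forall i, i < n -> (flat_run code i (flat_init inp)).1 < size code) ->
  flat_run code n (flat_init inp) = (q, ss) -> size code <= q ->
  n * (4 * (size inp + K + n) + 8) <= T ->
  (0 < n) ->
  halts_within stack_tm T (map sym_of_cell inp) /\
  tm_output stack_tm T (map sym_of_cell inp) = map sym_of_cell (nth [::] ss 0).
Proof.
move=> hn eq_run hq hT n0.
have eK : size (flat_init inp).2 = K by rewrite /= size_nseq prednK.
have sl : size (layout (flat_init inp).2) = size inp + K.
  by rewrite layout_cons size_cat /= size_map layout_nil size_nseq prednK.
have [e1 [e2 [j [m [b r]]]]] := @zflat_run K code n 0 (flat_init inp).2 0 eK okc K0 hn.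
rewrite -/(flat_init inp) eq_run /= in e1 e2 r; rewrite sl in b e2.
have := zreach_rep r (init_rep inp).
rewrite /home /enter ltnNge hq /=.
set c0 := init_config _ _ => H.
have hm : (iter m (@step stack_tm) c0).1.1 = ord_max by case: H.
have eT : run stack_tm T (map sym_of_cell inp) = iter m (@step stack_tm) c0.
  by rewrite /run -(subnK (leq_trans b hT)) iterD iter_step_halt.
rewrite /halts_within /tm_output eT; split => //; move: H {hm eT}.
case: (iter m _ _) => [[q1 hd] tp] [/= e3 ehd rR rL].
have eh : hd = 0%R by rewrite ehd.
have -> : [seq tp (Posz i) | i <- iota 0 (T + size (map sym_of_cell inp))] =
  [seq nth Blank (layout ss ++ nseq j Blank) i | i <- iota 0 (T + size inp)].
  rewrite size_map; apply: eq_map => i; rewrite -rR eh; congr tp; lia.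
case: ss e1 e2 {eq_run r rR} => [|s ss] e1 e2; first by rewrite /= in e1; lia.
(* The window read as output contains the first separator: the layout has at most [size inp + K + n]
   symbols, and [T] exceeds this since [n] is positive. *)
have lt : size s < T + size inp.
  move: e2; rewrite layout_cons size_cat size_map /=.
  by nia.
rewrite -(subnKC lt) iotaD map_cat layout_cons -catA cat_cons.
have -> : [seq nth Blank (map sym_of_cell s ++ Blank :: layout ss ++ nseq j Blank) i
   | i <- iota 0 (size s).+1] = map sym_of_cell s ++ [:: Blank].
  apply: (@eq_from_nth _ Blank); rewrite size_map size_iota ?size_cat ?size_map ?addn1 //.
  move=> i hi; rewrite (nth_map 0) ?size_iota // nth_iota // add0n !nth_cat size_map.
  case: ltnP => // h; have -> : i = size s by lia.
  by rewrite subnn.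
by rewrite -catA take_nonblank_cells.
Qed.

End Machine.

(** * Loop programs *)

Inductive cmd :=
  | Nop
  | Push of nat & cell
  | Case of nat & cmd & cmd & cmd & cmd
  | Seq of cmd & cmd
  | For of cmd.

(* [Case i ce c0 c1 cs] pops stack [i] and branches on empty, 0, 1, separator. *)
Fixpoint den (N : nat) (c : cmd) (ss : seq (seq cell)) : seq (seq cell) :=
  match c with
  | Nop => ss
  | Push i x => set_nth [::] ss i (x :: nth [::] ss i)
  | Case i ce c0 c1 cs =>
      let ss' := set_nth [::] ss i (behead (nth [::] ss i)) in
      match nth [::] ss i with
      | [::] => den N ce ss'
      | Some false :: _ => den N c0 ss'
      | Some true :: _ => den N c1 ss'
      | None :: _ => den N cs ss'
      end
  | Seq a b => den N b (den N a ss)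
  | For b => iter N (den N b) ss
  end.

Fixpoint cmd_ok (K : nat) (c : cmd) : bool :=
  match c with
  | Nop => true
  | Push i _ => i < K
  | Case i ce c0 c1 cs => [&& i < K, cmd_ok K ce, cmd_ok K c0, cmd_ok K c1 & cmd_ok K cs]
  | Seq a b => cmd_ok K a && cmd_ok K b
  | For b => cmd_ok K b
  end.

Fixpoint depth (c : cmd) : nat :=
  match c with
  | Nop | Push _ _ => 0
  | Case _ ce c0 c1 cs => maxn (maxn (depth ce) (depth c0)) (maxn (depth c1) (depth cs))
  | Seq a b => maxn (depth a) (depth b)
  | For b => (depth b).+1
  end.

Fixpoint cost (N : nat) (c : cmd) : nat :=
  match c with
  | Nop | Push _ _ => 1
  | Case _ ce c0 c1 cs => (cost N ce + cost N c0 + cost N c1 + cost N cs).+1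
  | Seq a b => cost N a + cost N b
  | For b => N * (cost N b + 4) + 2
  end.

Fixpoint clen (c : cmd) : nat :=
  match c with
  | Nop | Push _ _ => 1
  | Case _ ce c0 c1 cs => (clen ce + (clen c0 + (clen c1 + clen cs))).+1
  | Seq a b => clen a + clen b
  | For b => (clen b).+4
  end.

Definition one : cell := Some true.

(* The loops of nesting depth [j] count with the two stacks [K + 2j] and [K + 2j + 1]. *)
Fixpoint comp (K : nat) (c : cmd) (j pc nxt : nat) : seq instr :=
  match c with
  | Nop => [:: IGo nxt]
  | Push i x => [:: IPush i x nxt]
  | Case i ce c0 c1 cs =>
      let pe := pc.+1 in let p0 := pe + clen ce in
      let p1 := p0 + clen c0 in let ps := p1 + clen c1 in
      IPop i pe p0 p1 ps ::
      comp K ce j pe nxt ++ (comp K c0 j p0 nxt ++ (comp K c1 j p1 nxt ++ comp K cs j ps nxt))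
  | Seq a b => comp K a j pc (pc + clen a) ++ comp K b j (pc + clen a) nxt
  | For b =>
      [:: IPop (K + j.*2) pc.+2 pc.+1 pc.+1 pc.+1,
          IPush (K + j.*2.+1) one pc.+4,
          IPop (K + j.*2.+1) nxt pc.+3 pc.+3 pc.+3,
          IPush (K + j.*2) one pc.+2 & comp K b j.+1 pc.+4 pc]
  end.

Lemma size_comp K c j pc nxt : size (comp K c j pc nxt) = clen c.
Proof.
elim: c j pc nxt => //= [i ce IHe c0 IH0 c1 IH1 cs IHs|a IHa b IHb|b IHb] j pc nxt.
- by rewrite !size_cat IHe IH0 IH1 IHs.
- by rewrite size_cat IHa IHb.
- by rewrite IHb.
Qed.

Definition code_at (code : seq instr) (pc : nat) (f : seq instr) : Prop :=
  exists pre post, code = pre ++ f ++ post /\ size pre = pc.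

Lemma code_at_cat code pc f1 f2 : code_at code pc (f1 ++ f2) ->
  code_at code pc f1 /\ code_at code (pc + size f1) f2.
Proof.
move=> [pre [post [-> <-]]]; split.
  by exists pre, (f2 ++ post); rewrite !catA.
by exists (pre ++ f1), post; rewrite !catA size_cat.
Qed.

Lemma code_at_cons code pc i f : code_at code pc (i :: f) ->
  [/\ fetch code pc = i, pc < size code & code_at code pc.+1 f].
Proof.
move=> [pre [post [-> <-]]]; split.
- by rewrite /fetch nth_cat ltnn subnn.
- by rewrite size_cat /=; lia.
- by exists (rcons pre i), post; rewrite cat_rcons size_rcons.
Qed.

Section Exec.
Variable code : seq instr.

Definition fexec (B : nat) (c c' : flat_state) : Prop :=
  exists2 n, n <= B &
  flat_run code n c = c' /\ forall i, i < n -> (flat_run code i c).1 < size code.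

Lemma fexec_refl B c : fexec B c c.
Proof. by exists 0. Qed.

Lemma fexec_trans B1 B2 c1 c2 c3 :
  fexec B1 c1 c2 -> fexec B2 c2 c3 -> fexec (B1 + B2) c1 c3.
Proof.
move=> [n1 b1 [e1 h1]] [n2 b2 [e2 h2]]; exists (n1 + n2); first by rewrite leq_add.
have R i : flat_run code (i + n1) c1 = flat_run code i c2 by rewrite /flat_run iterD -e1.
split; first by rewrite addnC R.
move=> i hi; case: (ltnP i n1) => h; first exact: h1.
by rewrite -(subnK h) R; apply: h2; lia.
Qed.

Lemma fexec_weaken B1 B2 c1 c2 : B1 <= B2 -> fexec B1 c1 c2 -> fexec B2 c1 c2.
Proof. by move=> h [n b e]; exists n => //; apply: leq_trans h. Qed.

Lemma fexec_step c c' : c.1 < size code -> flat_step code c = c' -> fexec 1 c c'.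
Proof. by move=> h <-; exists 1 => //; split=> // -[|//]. Qed.

End Exec.

Section SetNth.
Variables (T : Type) (x0 : T).

Lemma set_nth_catl (s t : seq T) i y : i < size s ->
  set_nth x0 (s ++ t) i y = set_nth x0 s i y ++ t.
Proof. by elim: s i => [//|x s IH] [|i] //= h; rewrite IH. Qed.

Lemma set_nth_catr (s t : seq T) i y :
  set_nth x0 (s ++ t) (size s + i) y = s ++ set_nth x0 t i y.
Proof. by elim: s => //= x s ->. Qed.

Lemma nth_catr (s t : seq T) i : nth x0 (s ++ t) (size s + i) = nth x0 t i.
Proof. by rewrite nth_cat ltnNge leq_addr addKn. Qed.

Lemma nth_catl (s t : seq T) i : i < size s -> nth x0 (s ++ t) i = nth x0 s i.
Proof. by move=> h; rewrite nth_cat h. Qed.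

Lemma set_nth_id (s : seq T) i : i < size s -> set_nth x0 s i (nth x0 s i) = s.
Proof. by elim: s i => [//|x s IH] [|i] //= h; rewrite IH. Qed.

Lemma size_set_nth_lt (s : seq T) i y : i < size s -> size (set_nth x0 s i y) = size s.
Proof. by move=> h; rewrite size_set_nth; apply/maxn_idPr. Qed.

Lemma set_nthK (s : seq T) v a b : set_nth x0 (set_nth x0 s v a) v b = set_nth x0 s v b.
Proof. by rewrite set_set_nth eqxx. Qed.

Lemma set_nthC (s : seq T) i j a b : i != j ->
  set_nth x0 (set_nth x0 s i a) j b = set_nth x0 (set_nth x0 s j b) i a.
Proof. by move=> /negbTE h; rewrite set_set_nth h. Qed.

Lemma nth_set_nthE (s : seq T) v a : nth x0 (set_nth x0 s v a) v = a.
Proof. by rewrite nth_set_nth /= eqxx. Qed.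

Lemma nth_set_nthN (s : seq T) i j a : i != j -> nth x0 (set_nth x0 s j a) i = nth x0 s i.
Proof. by move=> /negbTE h; rewrite nth_set_nth /= h. Qed.

End SetNth.

Lemma size_den N K c ss : cmd_ok K c -> size ss = K -> size (den N c ss) = K.
Proof.
elim: c ss => //= [i x|i ce IHe c0 IH0 c1 IH1 cs IHs|a IHa b IHb|b IHb] ss ok e.
- by rewrite size_set_nth_lt // e.
- case/and5P: ok => ok oke ok0 ok1 oks.
  have e' : size (set_nth [::] ss i (behead (nth [::] ss i))) = K.
    by rewrite size_set_nth_lt // e.
  by case: (nth _ _ _) e' => [|[[]|] s] e'; [apply: IHe|apply: IH1|apply: IH0|apply: IHs].
- by case/andP: ok => oka okb; apply: IHb => //; apply: IHa.
- by elim: {1}N => //= n IHn; apply: IHb.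
Qed.

Lemma comp_ok K D P c j pc nxt : cmd_ok K c -> j + depth c <= D ->
  pc + clen c <= P -> nxt <= P -> all (instr_ok (K + D.*2) P) (comp K c j pc nxt).
Proof.
elim: c j pc nxt => /= [|i x|i ce IHe c0 IH0 c1 IH1 cs IHs|a IHa b IHb|b IHb] j pc nxt ok hd hp hn.
- by rewrite hn.
- by rewrite hn !andbT; lia.
- case/and5P: ok => ok oke ok0 ok1 oks.
  rewrite !all_cat IHe ?IH0 ?IH1 ?IHs //; lia.
- case/andP: ok => oka okb; rewrite all_cat IHa ?IHb //; lia.
- rewrite IHb //; lia.
Qed.

Definition kap (N D : nat) : seq (seq cell) := flatten (nseq D [:: nseq N one; [::]]).

Lemma size_kap N D : size (kap N D) = D.*2.
Proof. by elim: D => //= D ->. Qed.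

Lemma nth_kap N D j : j < D ->
  nth [::] (kap N D) j.*2 = nseq N one /\ nth [::] (kap N D) j.*2.+1 = [::].
Proof. by elim: D j => [//|D IH] [|j] //= h; apply: IH. Qed.

(** Only the counters of depth at least [j] are assumed fresh, since those of the enclosing loops
    are in mid-run. A loop empties its first counter into the second and then refills it, so the
    next loop of the same depth finds it fresh again. *)
Lemma fexec_comp N K D code c j pc nxt ss kk :
  cmd_ok K c -> size ss = K -> j + depth c <= D -> size kk = D.*2 ->
  (forall i, j <= i < D -> nth [::] kk i.*2 = nseq N one /\ nth [::] kk i.*2.+1 = [::]) ->
  code_at code pc (comp K c j pc nxt) ->
  fexec code (cost N c) (pc, ss ++ kk) (nxt, den N c ss ++ kk).
Proof.
elim: c j pc nxt ss kk => /= [|i x|i ce IHe c0 IH0 c1 IH1 cs IHs|a IHa b IHb|b IHb]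
  j pc nxt ss kk ok es hd ek hk.
- by case/code_at_cons=> fe lt _; apply: fexec_step => //; rewrite /flat_step fe.
- case/code_at_cons=> fe lt _; apply: fexec_step => //; rewrite /flat_step fe.
  by rewrite set_nth_catl ?es // nth_catl ?es.
- case/code_at_cons=> fe lt.
  case/and5P: ok => ok oke ok0 ok1 oks.
  case/code_at_cat => ae; rewrite size_comp.
  case/code_at_cat => a0; rewrite size_comp.
  case/code_at_cat => a1; rewrite size_comp => as_.
  rewrite -addn1 addnC; set ss' := set_nth _ _ _ _.
  have X : fexec code 1 (pc, ss ++ kk)
     (pop_target pc.+1 (pc.+1 + clen ce) (pc.+1 + clen ce + clen c0)
       (pc.+1 + clen ce + clen c0 + clen c1) (top_sym (nth [::] ss i)), ss' ++ kk).
    apply: fexec_step; first exact: lt.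
    by rewrite /flat_step fe nth_catl ?es // set_nth_catl ?es.
  apply: fexec_trans X _.
  have es' : size ss' = K by rewrite /ss' size_set_nth_lt ?es.
  case: (nth [::] ss i) => [|[[]|] s].
  + by apply: fexec_weaken _ (IHe _ _ _ _ _ oke es' _ ek hk ae); lia.
  + by apply: fexec_weaken _ (IH1 _ _ _ _ _ ok1 es' _ ek hk a1); lia.
  + by apply: fexec_weaken _ (IH0 _ _ _ _ _ ok0 es' _ ek hk a0); lia.
  + by apply: fexec_weaken _ (IHs _ _ _ _ _ oks es' _ ek hk as_); lia.
- case/code_at_cat => aa; rewrite size_comp => ab.
  case/andP: ok => oka okb.
  apply: fexec_trans (IHa _ _ _ _ _ oka es _ ek hk aa) _; first by lia.
  by apply: IHb ab => //; [rewrite (size_den _ oka)|lia].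
- case/code_at_cons=> f0 l0; case/code_at_cons=> f1 l1.
  case/code_at_cons=> f2 l2; case/code_at_cons=> f3 l3 ab.
  have jD : j < D by lia.
  have [hk0 hk1] : nth [::] kk j.*2 = nseq N one /\ nth [::] kk j.*2.+1 = [::] by apply: hk; lia.
  pose k2 a b := set_nth [::] (set_nth [::] kk j.*2 (nseq a one)) j.*2.+1 (nseq b one).
  have ek2 a d : size (k2 a d) = D.*2 by rewrite /k2 !size_set_nth_lt ?size_set_nth_lt ?ek //; lia.
  have nL a d : nth [::] (k2 a d) j.*2 = nseq a one.
    by rewrite /k2 nth_set_nthN ?nth_set_nthE //; lia.
  have nR a d : nth [::] (k2 a d) j.*2.+1 = nseq d one by rewrite /k2 nth_set_nthE.
  have sL a d a' : set_nth [::] (k2 a d) j.*2 (nseq a' one) = k2 a' d.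
    by rewrite /k2 set_nthC ?set_nthK //; lia.
  have sR a d d' : set_nth [::] (k2 a d) j.*2.+1 (nseq d' one) = k2 a d'.
    by rewrite /k2 set_nthK.
  have k2N : k2 N 0 = kk.
    have A : set_nth [::] kk j.*2 (nseq N one) = kk by rewrite -hk0 set_nth_id ?ek //; lia.
    transitivity (set_nth [::] kk j.*2.+1 (nth [::] kk j.*2.+1)).
      by rewrite hk1 /k2 A.
    by rewrite set_nth_id ?ek //; lia.
  have E1 s' a d : size s' = K -> fexec code 1 (pc, s' ++ k2 a.+1 d) (pc.+1, s' ++ k2 a d).
    move=> es'; apply: fexec_step => //; rewrite /flat_step f0 -es' nth_catr set_nth_catr nL.
    by rewrite /= sL.
  have E2 s' a d : size s' = K -> fexec code 1 (pc.+1, s' ++ k2 a d) (pc.+4, s' ++ k2 a d.+1).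
    move=> es'; apply: fexec_step => //; rewrite /flat_step f1 -es' nth_catr set_nth_catr nR.
    by rewrite -[one :: nseq d one]/(nseq d.+1 one) sR.
  have E3 s' a d : size s' = K -> fexec code 1 (pc.+2, s' ++ k2 a d.+1) (pc.+3, s' ++ k2 a d).
    move=> es'; apply: fexec_step => //; rewrite /flat_step f2 -es' nth_catr set_nth_catr nR.
    by rewrite /= sR.
  have E4 s' a d : size s' = K -> fexec code 1 (pc.+3, s' ++ k2 a d) (pc.+2, s' ++ k2 a.+1 d).
    move=> es'; apply: fexec_step => //; rewrite /flat_step f3 -es' nth_catr set_nth_catr nL.
    by rewrite -[one :: nseq a one]/(nseq a.+1 one) sL.
  have E5 s' d : size s' = K -> fexec code 1 (pc, s' ++ k2 0 d) (pc.+2, s' ++ k2 0 d).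
    move=> es'; apply: fexec_step => //; rewrite /flat_step f0 -es' nth_catr set_nth_catr nL.
    by rewrite /= -[[::]]/(nseq 0 one) sL.
  have E6 s' a : size s' = K -> fexec code 1 (pc.+2, s' ++ k2 a 0) (nxt, s' ++ k2 a 0).
    move=> es'; apply: fexec_step => //; rewrite /flat_step f2 -es' nth_catr set_nth_catr nR.
    by rewrite /= -[[::]]/(nseq 0 one) sR.
  (* Forward pass: [a] units are left in the first counter and [d] have arrived in the second; [L2]
     is the refill. *)
  have L1 a d s' : size s' = K ->
      fexec code (a * (cost N b + 2)) (pc, s' ++ k2 a d) (pc, iter a (den N b) s' ++ k2 0 (a + d)).
    elim: a d s' => [|a IH] d s' es'; first exact: fexec_refl.
    rewrite mulSn (_ : cost N b + 2 = 1 + 1 + cost N b); last by lia.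
    apply: fexec_trans; first apply: fexec_trans; first apply: fexec_trans.
    - exact: E1.
    - exact: E2.
    - apply: IHb ok es' _ (ek2 a d.+1) _ ab; first by lia.
      move=> i hi; rewrite /k2 !nth_set_nthN; [|lia..].
      by apply: hk; lia.
    rewrite (_ : 1 + 1 + cost N b = cost N b + 2); last by lia.
    rewrite iterSr addSnnS; apply: IH; exact: size_den.
  have L2 a d s' : size s' = K ->
      fexec code (d * 2 + 1) (pc.+2, s' ++ k2 a d) (nxt, s' ++ k2 (a + d) 0).
    elim: d a => [|d IH] a es'; first by rewrite addn0; apply: E6.
    rewrite mulSn -addnA (_ : 2 = 1 + 1) //; apply: fexec_trans; first apply: fexec_trans.
    - exact: E3.
    - exact: E4.
    by rewrite -(addSnnS a d); apply: IH.
  have eI : size (iter N (den N b) ss) = K.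
    by elim: {1}N => //= n IHn; apply: size_den.
  have := L1 N 0 ss es; rewrite k2N => X1.
  have := fexec_trans (fexec_trans X1 (E5 _ _ eI)) (L2 _ _ _ eI).
  by rewrite add0n addn0 k2N; apply: fexec_weaken; lia.
Qed.

Lemma cost_poly c : exists C d, forall N, cost N c <= C * N.+1 ^ d.
Proof.
elim: c => [|i x|i ce [C1 [d1 h1]] c0 [C2 [d2 h2]] c1 [C3 [d3 h3]] cs [C4 [d4 h4]]|
  a [C1 [d1 h1]] b [C2 [d2 h2]]|b [C [d h]]].
- by exists 1, 0.
- by exists 1, 0.
- exists (C1 + C2 + C3 + C4).+1, (d1 + d2 + d3 + d4) => N /=.
  have M C e : e <= d1 + d2 + d3 + d4 -> C * N.+1 ^ e <= C * N.+1 ^ (d1 + d2 + d3 + d4).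
    by move=> he; rewrite leq_mul2l leq_pexp2l ?orbT.
  have p : 0 < N.+1 ^ (d1 + d2 + d3 + d4) by rewrite expn_gt0.
  have m1 := M C1 d1 ltac:(lia); have m2 := M C2 d2 ltac:(lia).
  have m3 := M C3 d3 ltac:(lia); have m4 := M C4 d4 ltac:(lia).
  move: (h1 N) (h2 N) (h3 N) (h4 N); rewrite mulSn !mulnDl; lia.
- exists (C1 + C2), (d1 + d2) => N /=.
  rewrite mulnDl; apply: leq_add.
    by apply: leq_trans (h1 N) _; rewrite leq_mul2l leq_pexp2l ?orbT ?leq_addr.
  by apply: leq_trans (h2 N) _; rewrite leq_mul2l leq_pexp2l ?orbT ?leq_addl.
- exists (C + 4), d.+1 => N /=; move: (h N); rewrite expnS.
  have p : 0 < N.+1 ^ d by rewrite expn_gt0.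
  move: (N.+1 ^ d) p => X p hX; nia.
Qed.

(** Moves the input from stack 0 to stack 1 and adds one unit to each first counter per symbol, so
    that every loop runs as often as the input is long. *)
Definition init_code (K D : nat) : seq instr :=
  [:: IPop 0 (D + 5) 1 2 3; IPush 1 (Some false) 4; IPush 1 (Some true) 4; IPush 1 None 4] ++
  [seq IPush (K + j.*2) one j.+1.+4 | j <- iota 0 D] ++ [:: IGo 0].

Lemma size_init_code K D : size (init_code K D) = D + 5.
Proof. by rewrite /= size_cat /= size_map size_iota; lia. Qed.

Definition prog_code (K : nat) (c : cmd) : seq instr :=
  let D := depth c in
  init_code K D ++ comp K c 0 (D + 5) (D + 5 + clen c).

Lemma size_prog_code K c : size (prog_code K c) = depth c + 5 + clen c.
Proof. by rewrite size_cat size_init_code size_comp. Qed.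

Lemma prog_code_ok K c : 1 < K -> cmd_ok K c ->
  code_ok (K + (depth c).*2) (prog_code K c).
Proof.
move=> K1 ok; rewrite /code_ok all_cat size_prog_code.
apply/andP; split; last by apply: comp_ok => //; lia.
rewrite /init_code all_cat /= all_cat /= andbT.
have -> /= : all (instr_ok (K + (depth c).*2) (depth c + 5 + clen c))
  [seq IPush (K + j.*2) one j.+1.+4 | j <- iota 0 (depth c)].
  rewrite all_map; apply/allP => j; rewrite mem_iota add0n => /andP[_ h] /=; lia.
lia.
Qed.

Definition init_user (K : nat) (u v : seq cell) : seq (seq cell) := [:: u, v & nseq (K - 2) [::]].

Lemma fexec_init K c inp v k : 1 < K ->
  fexec (prog_code K c) (size inp * (depth c + 3) + 1)
    (0, init_user K inp v ++ kap k (depth c))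
    (depth c + 5, init_user K [::] (rev inp ++ v) ++ kap (size inp + k) (depth c)).
Proof.
move=> K1; set D := depth c; set code := prog_code K c.
have cs : size code = D + 5 + clen c := size_prog_code K c.
have su u w : size (init_user K u w) = K by rewrite /= size_nseq; lia.
have F0 : fetch code 0 = IPop 0 (D + 5) 1 2 3 by [].
have F1 : fetch code 1 = IPush 1 (Some false) 4 by [].
have F2 : fetch code 2 = IPush 1 (Some true) 4 by [].
have F3 : fetch code 3 = IPush 1 None 4 by [].
have F4 j : j < D -> fetch code j.+4 = IPush (K + j.*2) one j.+1.+4.
  move=> h; rewrite /fetch /code /prog_code /init_code /= -catA nth_cat size_map size_iota h.
  by rewrite (nth_map 0) ?size_iota // nth_iota.
have F5 : fetch code D.+4 = IGo 0.
  by rewrite /fetch /code /prog_code /init_code /= -catA nth_cat size_map size_iota ltnn subnn.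
(* The counters while one symbol is being processed: the first [j] depths already have the new
   unit. *)
pose kk k j := kap k.+1 j ++ kap k (D - j).
have P1 u w k' : fexec code D (4, init_user K u w ++ kk k' 0) (D.+4, init_user K u w ++ kk k' D).
  have X j : j <= D -> fexec code j (4, init_user K u w ++ kk k' 0) (j.+4, init_user K u w ++ kk k' j).
    elim: j => [|j IH] h; first exact: fexec_refl.
    rewrite -[X in fexec _ X]addn1; apply: fexec_trans (IH (ltnW h)) _.
    apply: fexec_step; first by rewrite cs [X in X < _]/=; lia.
    rewrite /flat_step F4 //; congr (_, _).
    have -> : K + j.*2 = size (init_user K u w) + j.*2 by rewrite su.
    rewrite nth_catr set_nth_catr; congr (_ ++ _).
    have -> : j.*2 = size (kap k'.+1 j) + 0 by rewrite addn0 size_kap.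
    rewrite /kk nth_catr set_nth_catr.
    have -> : D - j = (D - j.+1).+1 by lia.
    have -> : kap k'.+1 j.+1 = kap k'.+1 j ++ kap k'.+1 1.
      by rewrite -[in LHS](addn1 j) /kap nseqD flatten_cat.
    by rewrite -catA.
  exact: X.
elim: inp v k => [|x inp IH] v k.
  by apply: fexec_step => //=; rewrite cs; lia.
have G1 : fexec code 1 (0, init_user K (x :: inp) v ++ kap k D)
    (pop_target (D + 5) 1 2 3 (sym_of_cell x), init_user K inp v ++ kap k D).
  by apply: fexec_step; [rewrite cs [X in X < _]/=; lia|rewrite /flat_step F0].
have G2 : fexec code 1 (pop_target (D + 5) 1 2 3 (sym_of_cell x), init_user K inp v ++ kap k D)
    (4, init_user K inp (x :: v) ++ kk k 0).
  rewrite /kk subn0; apply: fexec_step.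
    by rewrite cs [X in X < _]/=; case: x {G1} => [[]|] /=; lia.
  by case: x {G1} => [[]|] /=; rewrite /flat_step ?F1 ?F2 ?F3.
have G4 : fexec code 1 (D.+4, init_user K inp (x :: v) ++ kk k D)
    (0, init_user K inp (x :: v) ++ kap k.+1 D).
  apply: fexec_step; first by rewrite cs [X in X < _]/=; lia.
  by rewrite /flat_step F5 /kk subnn cats0.
have := fexec_trans (fexec_trans (fexec_trans (fexec_trans G1 G2) (P1 _ _ _)) G4) (IH (x :: v) k.+1).
rewrite rev_cons cat_rcons -[size (x :: inp)]/(size inp).+1 (addSnnS (size inp) k).
by apply: fexec_weaken; lia.
Qed.

Definition prog_tm (K : nat) (c : cmd) : TM := stack_tm (K + (depth c).*2) (prog_code K c).

Lemma prog_tm_run K c : 1 < K -> cmd_ok K c ->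
  exists C d, forall inp T, C * (size inp).+1 ^ d <= T ->
    halts_within (prog_tm K c) T (map sym_of_cell inp) /\
    tm_output (prog_tm K c) T (map sym_of_cell inp) =
    map sym_of_cell (nth [::] (den (size inp) c (init_user K [::] (rev inp))) 0).
Proof.
move=> K1 ok; have [C [d hC]] := cost_poly c.
set D := depth c; pose A := D + 4 + C.
(* [A (size inp + 1)^(d+1)] bounds the number of stack instructions, start-up included; simulating
   [n] of them on the tape costs about [n^2], which doubles the exponent. *)
exists (A * (4 * (K + D.*2 + A + 1) + 8)), (d.+1 + d.+1) => inp T hT.
have i1 := @fexec_init K c inp [::] 0 K1; rewrite addn0 cats0 in i1.
have sz : size (init_user K [::] (rev inp)) = K by rewrite /= size_nseq; lia.
have i2 : fexec (prog_code K c) (cost (size inp) c)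
   (D + 5, init_user K [::] (rev inp) ++ kap (size inp) D)
   (D + 5 + clen c, den (size inp) c (init_user K [::] (rev inp)) ++ kap (size inp) D).
  apply: (@fexec_comp _ _ D _ _ 0 _ _ _ _ ok sz (leqnn _) (size_kap _ _)).
    by move=> i hi; apply: nth_kap; lia.
  by exists (init_code K D), [::]; rewrite cats0 size_init_code.
have [n nB [er hn]] := fexec_trans i1 i2.
have ei : (0, init_user K inp [::] ++ kap 0 D) = flat_init (K + D.*2) inp.
  rewrite /flat_init /init_user /=; congr (_, _ :: _).
  have -> : kap 0 D = nseq D.*2 [::] by rewrite /kap; elim: (D) => //= m ->.
  rewrite -nseqD -[[::] :: _]/(nseq (K - 2 + D.*2).+1 [::]); congr nseq; lia.
rewrite ei in er hn.
have sp := size_prog_code K c.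
have n0 : 0 < n.
  by case: (n) er => // -[]; lia.
have okc := prog_code_ok K1 ok.
have := @stack_tm_run (K + D.*2) (prog_code K c) okc ltac:(lia) ltac:(rewrite sp; lia) inp n T _ _ hn er.
rewrite nth_catl ?(size_den _ ok) //; last by lia.
apply => //; first by rewrite sp.
apply: leq_trans hT.
have nA : n <= A * (size inp).+1 ^ d.+1.
  apply: leq_trans nB _; rewrite /A mulnDl; apply: leq_add.
    apply: (@leq_trans ((D + 4) * (size inp).+1)); first by lia.
    by rewrite leq_mul2l expnS -{1}[(size inp).+1]muln1 leq_mul2l expn_gt0 !orbT.
  apply: leq_trans (hC _) _; rewrite leq_mul2l leq_pexp2l ?orbT //.
have X1 : size inp < (size inp).+1 ^ d.+1.
  by rewrite expnS -{1}[(size inp).+1]muln1 leq_mul2l expn_gt0 orbT.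
rewrite expnD; move: ((size inp).+1 ^ d.+1) nA X1 => X nA X1.
rewrite -mulnA [X in _ <= _ * X]mulnCA [X in _ <= X]mulnA; apply: leq_mul => //.
have : n <= A * X by [].
by nia.
Qed.

(** * Programs on lists of natural numbers *)

Inductive prog :=
  | PNop
  | New of nat
  | Dbl of nat & bool
  | Drop of nat
  | Pop of nat & prog & prog
  | Test of nat & prog & prog & prog
  | PSeq of prog & prog
  | PFor of prog.

Definition memory := seq (seq nat).

(* [New v] pushes the number 0 on list [v]; [Dbl v b] and [Pop v] append and remove the least
   significant bit of the head; [Drop v] removes the head when it is 0; [Test v] branches on
   an empty list, a zero head, a positive head. *)
Fixpoint sem (N : nat) (p : prog) (s : memory) : memory :=
  match p with
  | PNop => s
  | New v => set_nth [::] s v (0 :: nth [::] s v)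
  | Dbl v b => if nth [::] s v is x :: l then set_nth [::] s v (b + x.*2 :: l) else s
  | Drop v => if nth [::] s v is 0 :: l then set_nth [::] s v l else s
  | Pop v p0 p1 =>
      if nth [::] s v is x :: l then
        let s' := set_nth [::] s v (x./2 :: l) in
        if odd x then sem N p1 s' else sem N p0 s'
      else s
  | Test v pe pz pn =>
      match nth [::] s v with
      | [::] => sem N pe s
      | 0 :: _ => sem N pz s
      | _ :: _ => sem N pn s
      end
  | PSeq a b => sem N b (sem N a s)
  | PFor b => iter N (sem N b) s
  end.

Fixpoint prog_ok (K : nat) (p : prog) : bool :=
  match p with
  | PNop => true
  | New v | Dbl v _ | Drop v => v < K
  | Pop v p0 p1 => [&& v < K, prog_ok K p0 & prog_ok K p1]
  | Test v pe pz pn => [&& v < K, prog_ok K pe, prog_ok K pz & prog_ok K pn]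
  | PSeq a b => prog_ok K a && prog_ok K b
  | PFor b => prog_ok K b
  end.

(** The popped cell tells whether the head number is 0, in which case a bit 0 must not be written:
    it would become a leading zero. *)
Definition lower_dbl (v : nat) (b : bool) : cmd :=
  Case v Nop (Seq (Push v (Some false)) (Push v (Some b)))
             (Seq (Push v (Some true)) (Push v (Some b)))
             (if b then Seq (Push v None) (Push v (Some true)) else Push v None).

Fixpoint lower (p : prog) : cmd :=
  match p with
  | PNop => Nop
  | New v => Push v None
  | Dbl v b => lower_dbl v b
  | Drop v => Case v Nop (Push v (Some false)) (Push v (Some true)) Nop
  | Pop v p0 p1 => Case v Nop (lower p0) (lower p1) (Seq (Push v None) (lower p0))
  | Test v pe pz pn =>
      Case v (lower pe) (Seq (Push v (Some false)) (lower pn))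
        (Seq (Push v (Some true)) (lower pn)) (Seq (Push v None) (lower pz))
  | PSeq a b => Seq (lower a) (lower b)
  | PFor b => For (lower b)
  end.

Fixpoint bits_fuel (f n : nat) : seq bool :=
  if f is f'.+1 then if n == 0 then [::] else odd n :: bits_fuel f' n./2 else [::].
Definition bits (n : nat) : seq bool := bits_fuel n n.

Lemma bits_fuelE f g n : n <= f -> n <= g -> bits_fuel f n = bits_fuel g n.
Proof.
elim: f g n => [|f IH] [|g] [|n] //= hf hg.
by congr (_ :: _); apply: IH; lia.
Qed.

Lemma bitsS n : 0 < n -> bits n = odd n :: bits n./2.
Proof.
by case: n => // n _; rewrite /bits /=; congr (_ :: _); apply: bits_fuelE; lia.
Qed.

(** Least significant bit on top and no leading zeros, so a single cell decides both parity and
    being zero. *)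
Definition num_cells (n : nat) : seq cell := rcons (map Some (bits n)) None.
Definition list_cells (l : seq nat) : seq cell := flatten (map num_cells l).

Lemma num_cells0 : num_cells 0 = [:: None].
Proof. by []. Qed.

Lemma num_cellsS n : 0 < n -> num_cells n = Some (odd n) :: num_cells n./2.
Proof. by move=> h; rewrite /num_cells bitsS. Qed.

Lemma num_cells_dbl (b : bool) n : 0 < b + n.*2 ->
  num_cells (b + n.*2) = Some b :: num_cells n.
Proof.
move=> h; rewrite num_cellsS //.
by rewrite oddD odd_double addbF oddb halfD odd_double andbF doubleK; case: (b).
Qed.

Lemma size_sem N K p s : prog_ok K p -> size s = K -> size (sem N p s) = K.
Proof.
elim: p s => //= [v|v b|v|v p0 IH0 p1 IH1|v pe IHe pz IHz pn IHn|a IHa b IHb|b IHb] s ok e.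
- by rewrite size_set_nth_lt // e.
- by case: nth => // x l; rewrite size_set_nth_lt // e.
- by case: nth => // -[|x] l //; rewrite size_set_nth_lt // e.
- case/and3P: ok => ok ok0 ok1; case: nth => // x l; case: odd.
    by apply: IH1 => //; rewrite size_set_nth_lt // e.
  by apply: IH0 => //; rewrite size_set_nth_lt // e.
- case/and4P: ok => ok oke okz okn; case: nth => [|[|x] l]; [exact: IHe|exact: IHz|exact: IHn].
- by case/andP: ok => oka okb; apply: IHb => //; apply: IHa.
- by elim: {1}N => //= n IHn; apply: IHb.
Qed.

Lemma map_set_nth (T1 T2 : Type) (f : T1 -> T2) x1 x2 s i y : i < size s ->
  map f (set_nth x1 s i y) = set_nth x2 (map f s) i (f y).
Proof. by elim: s i => [//|x s IH] [|i] //= h; rewrite IH. Qed.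

Lemma nth_map_cells (s : memory) v : nth [::] (map list_cells s) v = list_cells (nth [::] s v).
Proof.
case: (ltnP v (size s)) => h; first by rewrite (nth_map [::]).
by rewrite !nth_default // size_map.
Qed.

Lemma list_cells0 l : list_cells (0 :: l) = None :: list_cells l.
Proof. by []. Qed.

Lemma list_cellsS x l : 0 < x -> list_cells (x :: l) = Some (odd x) :: list_cells (x./2 :: l).
Proof. by move=> h; rewrite /list_cells /= num_cellsS. Qed.

Lemma set_nth_cells (s : memory) v l : v < size s ->
  set_nth [::] (map list_cells s) v (list_cells l) = map list_cells (set_nth [::] s v l).
Proof. by move=> h; rewrite (map_set_nth _ _ [::]). Qed.

Lemma set_nth_nil (s : memory) v : v < size s -> nth [::] s v = [::] ->
  set_nth [::] (map list_cells s) v [::] = map list_cells s.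
Proof.
by move=> vs E; rewrite (set_nth_cells [::] vs) -[X in set_nth _ _ _ X]E set_nth_id.
Qed.

Lemma den_dbl N K v b s : v < K -> size s = K ->
  den N (lower_dbl v b) (map list_cells s) = map list_cells (sem N (Dbl v b) s).
Proof.
move=> vK e; have vs : v < size s by rewrite e.
rewrite /= nth_map_cells; case E: (nth [::] s v) => [|x l] /=.
  by rewrite set_nth_nil.
have R : Some b :: list_cells (x :: l) = list_cells (b + x.*2 :: l) \/ b + x.*2 = 0.
  have [|h] := posnP (b + x.*2); [by right|left].
  by rewrite /list_cells /= num_cells_dbl.
have [x0|x0] := posnP x.
  rewrite x0 list_cells0 /= in R *; case: b R => -[] // R.
  - by rewrite /= nth_set_nthE set_nthK nth_set_nthE set_nthK R set_nth_cells.
  - by rewrite /= nth_set_nthE set_nthK -list_cells0 set_nth_cells.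
rewrite list_cellsS //= in R *.
case: R => [R|]; last by lia.
by case: (odd x) R => R; rewrite /= nth_set_nthE set_nthK nth_set_nthE set_nthK R set_nth_cells.
Qed.

Lemma den_lower N K p s : prog_ok K p -> size s = K ->
  den N (lower p) (map list_cells s) = map list_cells (sem N p s).
Proof.
elim: p s => [|v|v b|v|v p0 IH0 p1 IH1|v pe IHe pz IHz pn IHn|a IHa b IHb|b IHb] s //= ok e.
- by rewrite nth_map_cells -list_cells0 set_nth_cells ?e.
- exact: den_dbl ok e.
- have vs : v < size s by rewrite e.
  rewrite nth_map_cells; case E: (nth [::] s v) => [|x l] /=.
    by rewrite set_nth_nil.
  case: x E => [|x] E; first by rewrite set_nth_cells.
  have X : Some (odd x.+1) :: list_cells (x.+1./2 :: l) = list_cells (nth [::] s v).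
    by rewrite E -list_cellsS.
  by rewrite list_cellsS //; case: (odd x.+1) X => X; rewrite /= nth_set_nthE set_nthK X;
    rewrite set_nth_cells // set_nth_id.
- case/and3P: ok => ok ok0 ok1; have vs : v < size s by rewrite e.
  have es l : size (set_nth [::] s v l) = K by rewrite size_set_nth_lt ?e.
  rewrite nth_map_cells; case E: (nth [::] s v) => [|x l] /=.
    by rewrite set_nth_nil.
  case: x E => [|x] E.
    by rewrite list_cells0 /= nth_set_nthE set_nthK -list_cells0 set_nth_cells // IH0.
  by rewrite list_cellsS //; case: (odd x.+1); rewrite /= set_nth_cells // (IH0, IH1).
- case/and4P: ok => ok oke okz okn; have vs : v < size s by rewrite e.
  rewrite nth_map_cells; case E: (nth [::] s v) => [|x l] /=.
    by rewrite set_nth_nil // IHe.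
  case: x E => [|x] E.
    by rewrite list_cells0 /= nth_set_nthE set_nthK -list_cells0 -E set_nth_cells // set_nth_id // IHz.
  have X : Some (odd x.+1) :: list_cells (x.+1./2 :: l) = list_cells (nth [::] s v).
    by rewrite E -list_cellsS.
  rewrite list_cellsS //; case Eo: (odd x.+1) X => X; rewrite /= nth_set_nthE set_nthK X;
    by rewrite set_nth_cells // set_nth_id // IHn.
- case/andP: ok => oka okb; rewrite IHa // IHb // (size_sem _ oka) //.
- have X n : size (iter n (sem N b) s) = K /\
    iter n (den N (lower b)) (map list_cells s) = map list_cells (iter n (sem N b) s).
    elim: n => //= n [e1 e2]; split; first exact: size_sem.
    by rewrite e2 IHb.
  by case: (X N).
Qed.

Lemma lower_ok K p : prog_ok K p -> cmd_ok K (lower p).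
Proof.
elim: p => //= [v b|v|v p0 IH0 p1 IH1|v pe IHe pz IHz pn IHn|a IHa b IHb].
- by case: b => /= ->.
- by move=> ->.
- by case/and3P => -> /IH0 -> /IH1 ->.
- by case/and4P => -> /IHe -> /IHz -> /IHn ->.
- by case/andP => /IHa -> /IHb ->.
Qed.

(* Reading the cells from the last one to the first, leading zeros disappear. *)
Fixpoint parse_cells (s : seq cell) : seq nat :=
  match s with
  | [::] => [::]
  | None :: s' => 0 :: parse_cells s'
  | Some b :: s' => if parse_cells s' is x :: l then b + x.*2 :: l else [::]
  end.

(** The start-up code leaves the input reversed on stack 1. Pushing it back through [lower_dbl]
    restores the order and makes every number canonical, including the random string, which may have
    leading zeros. *)
Definition full_cmd (p : prog) : cmd :=
  Seq (For (Case 1 Nop (lower_dbl 0 false) (lower_dbl 0 true) (Push 0 None))) (lower p).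

Lemma den_parse K N inp : 1 < K -> size inp <= N ->
  iter N (den N (Case 1 Nop (lower_dbl 0 false) (lower_dbl 0 true) (Push 0 None)))
    (init_user K [::] (rev inp)) = map list_cells (parse_cells inp :: nseq K.-1 [::]).
Proof.
move=> K1 hN.
set body := den N _.
pose st u (v : seq nat) := list_cells v :: u :: nseq (K - 2) [::].
have X u w : iter (size w) body (st (rev (u ++ w)) [::]) = st (rev u) (parse_cells w).
  elim: w u => [|x w IH] u; first by rewrite cats0.
  rewrite [size _]/= iterS -cat_rcons IH rev_rcons.
  case: x => [b|]; last by [].
  have Z c rest : den N (lower_dbl 0 b) (c :: rest) = head [::] (den N (lower_dbl 0 b) [:: c]) :: rest.
    by case: c => [|[[]|] c]; case: b.
  have Y := @den_dbl N 1 0 b [:: parse_cells w] isT erefl.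
  have -> : body (st (Some b :: rev u) (parse_cells w)) = den N (lower_dbl 0 b) (st (rev u) (parse_cells w)).
    by case: b {Z Y}.
  by rewrite Z [in LHS]Y /=; case: (parse_cells w).
rewrite -(subnK hN) iterD.
have -> : init_user K [::] (rev inp) = st (rev ([::] ++ inp)) [::] by [].
rewrite X.
have -> : map list_cells (parse_cells inp :: nseq K.-1 [::]) = st (rev [::]) (parse_cells inp).
  rewrite /st /= map_nseq; congr (_ :: _).
  by rewrite (_ : K.-1 = (K - 2).+1) //; lia.
by elim: (N - _) => //= n ->.
Qed.

Lemma parse_num n s : parse_cells (num_cells n ++ s) = n :: parse_cells s.
Proof.
elim/ltn_ind: n => n IH; have [->|n0] := posnP n; first by [].
by rewrite num_cellsS //= IH ?odd_double_half //; lia.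
Qed.

Lemma size_parse s : size (parse_cells s) <= size s.
Proof. by elim: s => //= -[b|] s IH /=; [case: (parse_cells s) IH => //= *; lia|]. Qed.

Lemma parse_bound s x : x \in parse_cells s -> x < 2 ^ size s.
Proof.
elim: s x => //= -[b|] s IH x; last first.
  rewrite inE => /orP[/eqP ->|/IH h]; first by rewrite expn_gt0.
  by apply: ltn_trans h _; rewrite ltn_exp2l.
case: (parse_cells s) IH => // y l IH; rewrite inE => /orP[/eqP ->|h].
  by have := IH y (mem_head _ _); rewrite expnS; case: b; lia.
by apply: ltn_trans (IH x _) _; rewrite ?ltn_exp2l // inE h orbT.
Qed.

Lemma dec_nats_num n s acc pw :
  dec_nats (map sym_of_cell (num_cells n ++ s)) acc pw =
  acc + pw * n :: dec_nats (map sym_of_cell s) 0 1.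
Proof.
elim/ltn_ind: n acc pw => n IH acc pw; have [->|n0] := posnP n; first by rewrite /= muln0 addn0.
rewrite num_cellsS //; have e := odd_double_half n.
have lt : n./2 < n by lia.
by case: (odd n) e => /= e; rewrite IH //; congr (_ :: _); nia.
Qed.

Lemma dec_nats_list l : dec_nats (map sym_of_cell (list_cells l)) 0 1 = l.
Proof.
elim: l => //= x l IH.
by rewrite /list_cells /= dec_nats_num IH add0n mul1n.
Qed.

Theorem prog_machine K p : 1 < K -> prog_ok K p ->
  exists C d, forall inp T, C * (size inp).+1 ^ d <= T ->
    halts_within (prog_tm K (full_cmd p)) T (map sym_of_cell inp) /\
    dec_nats (tm_output (prog_tm K (full_cmd p)) T (map sym_of_cell inp)) 0 1 =
    nth [::] (sem (size inp) p (parse_cells inp :: nseq K.-1 [::])) 0.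
Proof.
move=> K1 ok.
have okf : cmd_ok K (full_cmd p) by rewrite /= lower_ok //; lia.
have [C [d h]] := prog_tm_run K1 okf; exists C, d => inp T hT.
have [h1 h2] := h inp T hT; split => //.
rewrite h2 /full_cmd [den _ _ _]/= den_parse // (den_lower _ ok); last by rewrite /= size_nseq; lia.
by rewrite nth_map_cells dec_nats_list.
Qed.

(** * Arithmetic and list macros *)

Notation get s v := (nth [::] s v) (only parsing).
Notation put s v l := (set_nth [::] s v l) (only parsing).

Arguments sem : simpl never.

Lemma sem_nop N s : sem N PNop s = s.
Proof. by []. Qed.
Lemma sem_seq N a b s : sem N (PSeq a b) s = sem N b (sem N a s).
Proof. by []. Qed.
Lemma sem_new N v s : sem N (New v) s = put s v (0 :: get s v).
Proof. by []. Qed.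
Lemma sem_dbl N v b s :
  sem N (Dbl v b) s = if get s v is x :: l then put s v (b + x.*2 :: l) else s.
Proof. by []. Qed.
Lemma sem_drop N v s : sem N (Drop v) s = if get s v is 0 :: l then put s v l else s.
Proof. by []. Qed.
Lemma sem_pop N v p0 p1 s : sem N (Pop v p0 p1) s =
  if get s v is x :: l then
    if odd x then sem N p1 (put s v (x./2 :: l)) else sem N p0 (put s v (x./2 :: l))
  else s.
Proof. by []. Qed.
Lemma sem_test N v pe pz pn s : sem N (Test v pe pz pn) s =
  match get s v with
  | [::] => sem N pe s
  | 0 :: _ => sem N pz s
  | _ :: _ => sem N pn s
  end.
Proof. by []. Qed.
Lemma sem_for N p s : sem N (PFor p) s = iter N (sem N p) s.
Proof. by []. Qed.

Definition semE := (sem_nop, sem_seq, sem_new, sem_dbl, sem_drop, sem_pop, sem_test).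

Lemma memory_ext (s t : memory) : size s = size t ->
  (forall i, get s i = get t i) -> s = t.
Proof. by move=> e h; apply: (@eq_from_nth _ [::]) => // i _. Qed.

Ltac mem_ext :=
  apply: memory_ext; [by rewrite !size_set_nth; lia|];
  let i := fresh "i" in move=> i;
  repeat (rewrite nth_set_nth /=; try case: eqP => ? //);
  first [done | exfalso; lia | by subst | by congruence].

(* Transfers one bit from the first number to the second; swapping the two numbers inverts it. *)
Definition shift_bit (p : nat * nat) : nat * nat := (p.1./2, odd p.1 + p.2.*2).

Lemma shift_bitK k p : let p' := iter k shift_bit p in
  iter k shift_bit (p'.2, p'.1) = (p.2, p.1).
Proof.
elim: k p => [|k IH] [x y] //=; have := IH (x, y).
case: (iter k shift_bit (x, y)) => a b /= e.
rewrite -iterS iterSr -e; congr (iter _ _ (_, _)) => /=; case: (odd a) (odd_double_half a) => /=; lia.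
Qed.

Lemma shift_bit1 k p : (iter k shift_bit p).1 = p.1 %/ 2 ^ k.
Proof.
elim: k => [|k IH]; first by rewrite divn1.
by rewrite iterS /= IH -divn2 -divnMA mulnC expnS.
Qed.

Lemma iter_half k x : iter k half x = x %/ 2 ^ k.
Proof.
by elim: k => [|k IH]; [rewrite divn1|rewrite iterS IH -divn2 -divnMA mulnC expnS].
Qed.

(** Reversal of [N]-bit words. Undoing it takes a second transfer of the same length [N], which is
    why numbers must stay below [2 ^ N]. *)
Definition rev_bits (N x : nat) : nat := (iter N shift_bit (x, 0)).2.

Lemma rev_bitsE N x : x < 2 ^ N -> iter N shift_bit (x, 0) = (0, rev_bits N x).
Proof.
move=> h; rewrite /rev_bits; have := shift_bit1 N (x, 0); rewrite divn_small //.
by case: (iter _ _ _) => a b /= ->.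
Qed.

Lemma rev_bitsK N x : x < 2 ^ N -> iter N shift_bit (rev_bits N x, 0) = (0, x).
Proof. by move=> h; have := shift_bitK N (x, 0); rewrite /= rev_bitsE. Qed.

Fixpoint progs (l : seq prog) : prog :=
  match l with [::] => PNop | [:: p] => p | p :: l' => PSeq p (progs l') end.

Definition Xfer (v w : nat) : prog := PFor (Pop v (Dbl w false) (Dbl w true)).

Lemma sem_Xfer N v w s x l y m : v != w -> v < size s -> w < size s ->
  get s v = x :: l -> get s w = y :: m ->
  sem N (Xfer v w) s = put (put s v ((iter N shift_bit (x, y)).1 :: l)) w
    ((iter N shift_bit (x, y)).2 :: m).
Proof.
move=> vw vs ws ev ew; have wv : w != v by rewrite eq_sym.
have X k : iter k (sem N (Pop v (Dbl w false) (Dbl w true))) s =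
  put (put s v ((iter k shift_bit (x, y)).1 :: l)) w ((iter k shift_bit (x, y)).2 :: m).
  elim: k => [|k IH]; first by rewrite -ev set_nth_id // -ew set_nth_id.
  rewrite !iterS IH; case: (iter k shift_bit (x, y)) => a b /=.
  rewrite sem_pop nth_set_nthN // nth_set_nthE.
  by case: (odd a) => /=; rewrite sem_dbl (nth_set_nthN _ _ _ wv) nth_set_nthE; mem_ext.
exact: X.
Qed.

(** A transfer reverses the bits, so a move needs two of them, through list 2; the exhausted source
    is then 0 and [Drop] applies. *)
Definition Mv (v w : nat) : prog :=
  progs [:: New 2; Xfer v 2; Drop v; New w; Xfer 2 w; Drop 2].

Lemma sem_Mv N v w s x l : v != w -> v != 2 -> w != 2 -> 2 < size s ->
  v < size s -> w < size s -> get s v = x :: l -> x < 2 ^ N ->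
  sem N (Mv v w) s = put (put s v l) w (x :: get s w).
Proof.
move=> vw v2 w2 s2 vs ws ev hx.
have wv : w != v by rewrite eq_sym.
have [s2v s2w] : 2 != v /\ 2 != w by rewrite ![2 == _]eq_sym.
rewrite /Mv /= 5!sem_seq !sem_new.
rewrite (@sem_Xfer N v 2 _ x l 0 (get s 2)) ?size_set_nth ?nth_set_nthE ?nth_set_nthN //; try lia.
rewrite rev_bitsE // (sem_drop N v) ?(nth_set_nthE, nth_set_nthN) //.
rewrite (@sem_Xfer N 2 w _ (rev_bits N x) (get s 2) 0 (get s w)) ?size_set_nth; try lia; last 2 first.
- by rewrite ?(nth_set_nthE, nth_set_nthN).
- by rewrite ?(nth_set_nthE, nth_set_nthN).
rewrite rev_bitsK // sem_drop ?(nth_set_nthE, nth_set_nthN) //.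
mem_ext.
Qed.

Definition Cp (v w : nat) : prog :=
  progs [:: New 2; Xfer v 2; New w;
    PFor (Pop 2 (PSeq (Dbl v false) (Dbl w false)) (PSeq (Dbl v true) (Dbl w true))); Drop 2].

Lemma sem_Cp N v w s x l : v != w -> v != 2 -> w != 2 -> 2 < size s ->
  v < size s -> w < size s -> get s v = x :: l -> x < 2 ^ N ->
  sem N (Cp v w) s = put s w (x :: get s w).
Proof.
move=> vw v2 w2 s2 vs ws ev hx.
have wv : w != v by rewrite eq_sym.
have [s2v s2w] : 2 != v /\ 2 != w by rewrite ![2 == _]eq_sym.
rewrite /Cp /= 4!sem_seq !sem_new.
rewrite (@sem_Xfer N v 2 _ x l 0 (get s 2)) ?size_set_nth ?nth_set_nthE ?nth_set_nthN //; try lia.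
rewrite rev_bitsE // ?(nth_set_nthE, nth_set_nthN) //.
have X k (p := iter k shift_bit (rev_bits N x, 0)) : iter k (sem N
    (Pop 2 (PSeq (Dbl v false) (Dbl w false)) (PSeq (Dbl v true) (Dbl w true))))
   (put (put (put (put s 2 (0 :: get s 2)) v (0 :: l)) 2 (rev_bits N x :: get s 2)) w (0 :: get s w)) =
   put (put (put s 2 (p.1 :: get s 2)) v (p.2 :: l)) w (p.2 :: get s w).
  rewrite /p {p}; elim: k => [|k IH].
    mem_ext.
  rewrite !iterS IH; case: (iter k shift_bit _) => a b /=.
  rewrite sem_pop ?(nth_set_nthE, nth_set_nthN) //.
  by case: (odd a) => /=; rewrite sem_seq !sem_dbl ?(nth_set_nthE, nth_set_nthN) //; mem_ext.
rewrite sem_for X rev_bitsK // sem_drop ?(nth_set_nthE, nth_set_nthN) //=.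
mem_ext.
Qed.

Definition Clr (v : nat) : prog := PSeq (PFor (Pop v PNop PNop)) (Drop v).

Lemma sem_halve_all N v s x l : v < size s -> get s v = x :: l ->
  sem N (PFor (Pop v PNop PNop)) s = put s v (x %/ 2 ^ N :: l).
Proof.
move=> vs ev; rewrite -iter_half.
have X k : iter k (sem N (Pop v PNop PNop)) s = put s v (iter k half x :: l).
  elim: k => [|k IH]; first by rewrite -ev set_nth_id.
  by rewrite !iterS IH sem_pop nth_set_nthE set_nthK; case: odd.
exact: X.
Qed.

Lemma sem_Clr N v s x l : v < size s -> get s v = x :: l -> x < 2 ^ N ->
  sem N (Clr v) s = put s v l.
Proof.
move=> vs ev hx; rewrite /Clr sem_seq (sem_halve_all N vs ev) sem_drop.
by rewrite divn_small // nth_set_nthE set_nthK.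
Qed.

(** Here [k] is the number of ones among two bits and the carry. The carry is a number 0 or 1 on
    list 6, and reading it by [Pop] resets it to 0. *)
Definition add_emit (k : nat) : prog :=
  PSeq (Dbl 2 (odd k)) (if 1 < k then Dbl 6 true else PNop).
Definition add_leaf (k : nat) : prog := Pop 6 (add_emit k) (add_emit k.+1).
Definition add_body : prog :=
  Pop 4 (Pop 1 (add_leaf 0) (add_leaf 1)) (Pop 1 (add_leaf 1) (add_leaf 2)).

(* The running state is [shift_bit] applied to the virtual number x + y + carry. *)
Definition Add : prog :=
  progs [:: Mv 1 4; New 6; New 2; PFor add_body; Drop 6; Drop 4; Xfer 2 1; Drop 2].

Lemma sem_Add N s x y t : 6 < size s -> get s 1 = y :: x :: t ->
  x < 2 ^ N -> y < 2 ^ N -> x + y < 2 ^ N ->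
  sem N Add s = put s 1 (x + y :: t).
Proof.
move=> hs e1 hx hy hxy; rewrite /Add /= 7!sem_seq.
rewrite (@sem_Mv N 1 4 s y (x :: t)) //; try lia.
case: s hs e1 => [|o [|t1 [|a2 [|a3 [|a4 [|a5 [|a6 u]]]]]]] //= _ _; rewrite !sem_new sem_for /=.
pose St a b c d := [:: o, b :: t, d :: a2, a3, a :: a4, a5, c :: a6 & u].
have X k (p := iter k shift_bit (x + y, 0)) : exists2 c, (c <= 1) &&
    (iter k half y + iter k half x + c == p.1) &
    iter k (sem N add_body) (St y x 0 0) = St (iter k half y) (iter k half x) c p.2.
  rewrite /p {p}; elim: k => [|k [c /andP[hc /eqP e] IH]]; first by exists 0; rewrite //= addn0 addnC.
  rewrite !iterS IH /= -e; move: (iter k half y) (iter k half x) => a b.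
  exists ((odd a + odd b + c)./2).
    by move: hc {e IH}; case: c => [|[|]] //= _; have := odd_double_half a; have := odd_double_half b;
      case: (odd a); case: (odd b) => /=; lia.
  rewrite !oddD /St /add_body /add_leaf /add_emit; set z := (iter k _ _).2.
  by move: hc {e IH}; case: c => [|[|]] // _ /=; rewrite sem_pop /=; case: (odd a);
    rewrite sem_pop /=; case: (odd b); rewrite /= !semE.
have [c /andP[hc /eqP e] ->] := X N.
have hz a : a < 2 ^ N -> iter N half a = 0 by move=> ?; rewrite iter_half divn_small.
rewrite !hz // rev_bitsE //= in e *; rewrite !add0n in e; rewrite e.
rewrite /St !sem_drop /= (@sem_Xfer N 2 1 _ (rev_bits N (x + y)) a2 0 t) //.
by rewrite rev_bitsK // sem_drop.
Qed.

Definition sub_emit (a b c : bool) : prog :=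
  PSeq (Dbl 2 (a (+) b (+) c)) (if a < b + c then Dbl 6 true else PNop).
Definition sub_leaf (a b : bool) : prog := Pop 6 (sub_emit a b false) (sub_emit a b true).
Definition sub_body : prog :=
  Pop 1 (Pop 4 (sub_leaf false false) (sub_leaf false true))
        (Pop 4 (sub_leaf true false) (sub_leaf true true)).

(* A borrow left at the end means x < y, and the result is then discarded. *)
Definition Sub : prog :=
  progs [:: Mv 1 4; New 6; New 2; PFor sub_body;
    Pop 6 (PSeq (Drop 6) (Xfer 2 1)) (PSeq (Drop 6) (PFor (Pop 2 PNop PNop)));
    Drop 2; Drop 4].

Lemma sem_Sub N s x y t : 6 < size s -> get s 1 = y :: x :: t ->
  x < 2 ^ N -> y < 2 ^ N ->
  sem N Sub s = put s 1 (x - y :: t).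
Proof.
move=> hs e1 hx hy; rewrite /Sub /= 6!sem_seq.
rewrite (@sem_Mv N 1 4 s y (x :: t)) //; try lia.
case: s hs e1 => [|o [|t1 [|a2 [|a3 [|a4 [|a5 [|a6 u]]]]]]] //= _ _; rewrite !sem_new sem_for /=.
pose St a b c d := [:: o, b :: t, d :: a2, a3, a :: a4, a5, c :: a6 & u].
(* For [x < y] only the strict inequality with the borrow is tracked. The digits are then
   irrelevant, but [d < 2 ^ k] is kept so that they can be erased. *)
have X k : exists c d, [/\ c <= 1, d < 2 ^ k,
    (if y <= x then iter k half y + c <= iter k half x /\
       iter k shift_bit (x - y, 0) = (iter k half x - (iter k half y + c), d)
     else iter k half x < iter k half y + c) &
    iter k (sem N sub_body) (St y x 0 0) = St (iter k half y) (iter k half x) c d].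
  elim: k => [|k [c [d [hc hd e IH]]]].
    by exists 0, 0; split => //=; rewrite !addn0; case: (leqP y x).
  exists (odd (iter k half x) < odd (iter k half y) + c),
    ((odd (iter k half x) (+) odd (iter k half y) (+) odd c) + d.*2).
  rewrite !iterS IH; move: (iter k half y) (iter k half x) e {IH} => a b e; split.
  - by case: (_ < _).
  - by rewrite expnS; case: (_ (+) _); lia.
  - move: hc e (odd_double_half a) (odd_double_half b).
    case: (leqP y x) => _ hc e.
      case: e => e1 e2; rewrite e2 /shift_bit /=.
      move=> ea eb; split.
        by move: hc e1 ea eb {e2}; case: c => [|[|]] // _; case: (odd a); case: (odd b) => /=; lia.
      rewrite oddB // oddD; congr (_, _).
        by move: hc e1 ea eb; case: c {e2} => [|[|]] // _; case: (odd a); case: (odd b) => /=; lia.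
      by rewrite addbA.
    by move: hc e; case: c => [|[|]] // _; case: (odd a); case: (odd b) => /=; lia.
  - rewrite /St /sub_body /sub_leaf /sub_emit.
    by move: hc {e}; case: c => [|[|]] // _ /=; rewrite sem_pop /=; case: (odd b);
      rewrite sem_pop /=; case: (odd a); rewrite /= !semE.
have [c [d [hc hd e ->]]] := X N.
have hz a : a < 2 ^ N -> iter N half a = 0 by move=> ?; rewrite iter_half divn_small.
rewrite !hz // in e *; move: e; case: (leqP y x) => h e.
  have {e} [c0 e] : c = 0 /\ d = rev_bits N (x - y).
    by case: e => e1 e2; split; [lia|rewrite /rev_bits e2].
  rewrite c0 /St (sem_pop N 6) /= sem_seq (sem_drop N 6) /= (@sem_Xfer N 2 1 _ d a2 0 t) //= e rev_bitsK ?sem_drop //; lia.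
have {e} -> : c = 1 by lia.
rewrite /St (sem_pop N 6) /= sem_seq (sem_drop N 6) /= (@sem_halve_all N 2 _ d a2) //.
by rewrite divn_small //= !sem_drop /= (_ : x - y = 0) //; lia.
Qed.

(** Horner's scheme: the transfer of [y] to list 3 reverses its bits, so they are consumed most
    significant first. *)
Definition Mul : prog :=
  progs [:: New 3; Xfer 1 3; Drop 1; Mv 1 5; New 1;
    PFor (Pop 3 (Dbl 1 false) (progs [:: Dbl 1 false; Cp 5 1; Add])); Drop 3; Clr 5].

(** The prefixes of the multiplier increase to the multiplier, hence every partial product is at
    most the final one and stays below [2 ^ N]. *)
Lemma shift_bit2_mono k m p : k <= m -> (iter k shift_bit p).2 <= (iter m shift_bit p).2.
Proof.
move=> /subnK <-; elim: (m - k) => // j IH; apply: leq_trans IH _.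
by rewrite addSn iterS /=; lia.
Qed.

Lemma sem_Mul N s x y t : 6 < size s -> get s 1 = y :: x :: t ->
  x < 2 ^ N -> y < 2 ^ N -> x * y < 2 ^ N ->
  sem N Mul s = put s 1 (x * y :: t).
Proof.
move=> hs e1 hx hy hxy; rewrite /Mul /= 7!sem_seq.
case: s hs e1 => [|o [|t1 [|a2 [|a3 [|a4 [|a5 [|a6 u]]]]]]] //= _ -> {t1}; rewrite (sem_new N 3) /=.
rewrite (@sem_Xfer N 1 3 _ y (x :: t) 0 a3) // rev_bitsE //= (sem_drop N 1) /=.
rewrite (@sem_Mv N 1 5 _ x t) //= (sem_new N 1) sem_for /=.
pose St a b := [:: o, b :: t, a2, a :: a3, a4, x :: a5, a6 & u].
have X k (p := iter k shift_bit (rev_bits N y, 0)) : k <= N ->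
    iter k (sem N (Pop 3 (Dbl 1 false) (progs [:: Dbl 1 false; Cp 5 1; Add])))
      (St (rev_bits N y) 0) = St p.1 (p.2 * x).
  rewrite /p {p}; elim: k => [//|k IH] hk; rewrite iterS IH ?(ltnW hk) // iterS.
  have := @shift_bit2_mono k.+1 N (rev_bits N y, 0) hk; rewrite rev_bitsK // iterS /=.
  case: (iter k shift_bit _) => a b /=; rewrite sem_pop /=; case: (odd a) => hb.
    rewrite 2!sem_seq sem_dbl /= (@sem_Cp N 5 1 _ x a5) // (@sem_Add N _ (b * x).*2 x t) //=; try nia.
    by rewrite /St mulnDl mul1n doubleMl addnC.
  by rewrite sem_dbl /= add0n doubleMl.
rewrite (X N (leqnn _)) rev_bitsK // sem_drop /= (@sem_Clr N 5 _ x a5) //=.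
by rewrite mulnC.
Qed.

(** * Postfix evaluation of expressions on list 1 *)

Inductive expr := Hd of nat | One | EAdd of expr & expr | EMul of expr & expr | ESub of expr & expr.

Fixpoint ev (e : expr) : prog :=
  match e with
  | Hd v => Cp v 1
  | One => PSeq (New 1) (Dbl 1 true)
  | EAdd a b => PSeq (ev a) (PSeq (ev b) Add)
  | EMul a b => PSeq (ev a) (PSeq (ev b) Mul)
  | ESub a b => PSeq (ev a) (PSeq (ev b) Sub)
  end.

Fixpoint eval (s : memory) (e : expr) : nat :=
  match e with
  | Hd v => head 0 (get s v)
  | One => 1
  | EAdd a b => eval s a + eval s b
  | EMul a b => eval s a * eval s b
  | ESub a b => eval s a - eval s b
  end.

Fixpoint esize (e : expr) : nat :=
  match e with
  | Hd _ | One => 1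
  | EAdd a b | EMul a b | ESub a b => esize a + esize b
  end.

(** Operands must lie beyond list 6 because the arithmetic macros work on lists 1 to 6. *)
Fixpoint expr_ok (be : nat) (s : memory) (e : expr) : bool :=
  match e with
  | Hd v => [&& 6 < v, v < size s, 0 < size (get s v) & head 0 (get s v) < 2 ^ be]
  | One => true
  | EAdd a b | EMul a b | ESub a b => expr_ok be s a && expr_ok be s b
  end.

Lemma esize_gt0 e : 0 < esize e.
Proof. by elim: e => //= *; lia. Qed.

(** Both bounds are at least 2, and then a sum, like a product, is below the product of the bounds;
    so bit lengths add up over the leaves. *)
Lemma eval_small be s e : 0 < be -> expr_ok be s e -> eval s e < 2 ^ (be * esize e).
Proof.
move=> b0; elim: e => [v|||a IHa b IHb|a IHa b IHb] /=.
- by case/and4P => _ _ _; rewrite muln1.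
- by rewrite muln1 -{1}(expn0 2) ltn_exp2l.
- move=> a IHa b IHb /andP[/IHa ha /IHb hb]; rewrite mulnDr expnD.
  have ga : 2 <= 2 ^ (be * esize a) by rewrite -{1}(expn1 2) leq_exp2l // muln_gt0 b0 esize_gt0.
  have gb : 2 <= 2 ^ (be * esize b) by rewrite -{1}(expn1 2) leq_exp2l // muln_gt0 b0 esize_gt0.
  by move: (2 ^ _) (2 ^ _) ha hb ga gb => X Y; nia.
- case/andP=> [/IHa ha /IHb hb]; rewrite mulnDr expnD.
  by move: (2 ^ _) (2 ^ _) ha hb => X Y; nia.
- case/andP=> [/IHa ha /IHb hb]; rewrite mulnDr expnD.
  have gb : 0 < 2 ^ (be * esize b) by rewrite expn_gt0.
  by move: (2 ^ _) (2 ^ _) ha hb gb => X Y; nia.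
Qed.

Lemma expr_put be s e l : 6 < size s -> expr_ok be (put s 1 l) e = expr_ok be s e.
Proof.
move=> hs; elim: e => //= [v|a -> b ->|a -> b ->|a -> b ->] //.
case: (ltnP 6 v) => //= hv; rewrite nth_set_nthN ?size_set_nth_lt //; lia.
Qed.

Lemma eval_put be s e l : 6 < size s -> expr_ok be s e -> eval (put s 1 l) e = eval s e.
Proof.
move=> hs; elim: e => //= [v|a IHa b IHb|a IHa b IHb|a IHa b IHb].
- by case/and4P => hv _ _ _; rewrite nth_set_nthN //; lia.
all: by case/andP => /IHa -> /IHb ->.
Qed.

Lemma sem_ev N be s e : 0 < be -> 6 < size s -> expr_ok be s e -> be * esize e <= N ->
  sem N (ev e) s = put s 1 (eval s e :: get s 1).
Proof.
move=> b0; elim: e s => [v||a IHa b IHb|a IHa b IHb|a IHa b IHb] s hs /= ok hN.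
- case/and4P: ok => h1 h2 h3 h4; case E: (get s v) h3 h4 => [//|x l] _ /= hx.
  apply: sem_Cp E _ => //; try lia.
  by apply: leq_trans hx _; rewrite leq_exp2l //; lia.
- by rewrite sem_seq sem_new sem_dbl nth_set_nthE set_nthK.
all: case/andP: ok => oka okb.
all: have ga := eval_small b0 oka; have gb := eval_small b0 okb.
all: have pa : eval s a < 2 ^ N by apply: leq_trans ga _; rewrite leq_exp2l //; nia.
all: have pb : eval s b < 2 ^ N by apply: leq_trans gb _; rewrite leq_exp2l //; nia.
all: rewrite 2!sem_seq IHa //; last by nia.
all: rewrite IHb ?expr_put ?size_set_nth_lt //; try nia.
all: rewrite (eval_put _ _ okb) ?nth_set_nthE ?set_nthK //.
- rewrite (@sem_Add N _ (eval s a) (eval s b) (get s 1)) ?nth_set_nthE ?set_nthK ?size_set_nth_lt //; try lia.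
  have := @eval_small be s (EAdd a b) b0; rewrite /= oka okb => /(_ isT) h.
  by apply: leq_trans h _; rewrite leq_exp2l.
- rewrite (@sem_Mul N _ (eval s a) (eval s b) (get s 1)) ?nth_set_nthE ?set_nthK ?size_set_nth_lt //; try lia.
  have := @eval_small be s (EMul a b) b0; rewrite /= oka okb => /(_ isT) h.
  by apply: leq_trans h _; rewrite leq_exp2l.
- by rewrite (@sem_Sub N _ (eval s a) (eval s b) (get s 1)) ?nth_set_nthE ?set_nthK ?size_set_nth_lt //; try lia.
Qed.

(** * Loops over lists *)

Definition Foreach (v : nat) (p : prog) : prog := PFor (Test v PNop p p).

(** The loop makes [N] passes in any case. Indexing the invariant by the pass forces the list to be
    empty after exactly [k] of them, and the remaining passes are idle. *)
Lemma foreach_inv N v p (P : nat -> memory -> Prop) k s : k <= N -> P 0 s ->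
  (forall i s, i < k -> P i s -> get s v <> [::] /\ P i.+1 (sem N p s)) ->
  (forall s, P k s -> get s v = [::]) ->
  P k (sem N (Foreach v p) s).
Proof.
move=> kN P0 PS Pk.
have X i : i <= k -> P i (iter i (sem N (Test v PNop p p)) s).
  elim: i => [//|i IH] hi; have [ne h] := PS i _ hi (IH (ltnW hi)).
  by rewrite iterS sem_test; move: ne h; case: (get _ v) => // -[|x] l.
rewrite sem_for -[X in iter X](subnK kN) iterD.
have := X k (leqnn _); move: (iter k _ s) => s' Ps'.
have e := Pk _ Ps'.
suff -> : iter (N - k) (sem N (Test v PNop p p)) s' = s' by [].
by elim: (N - k) => //= n ->; rewrite sem_test e.
Qed.

(** The list gets reversed; applied to entries that were collected one by one, this restores their
    original order. *)
Definition MvAll (v w : nat) : prog := Foreach v (Mv v w).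

Lemma sem_MvAll N v w s : v != w -> v != 2 -> w != 2 -> 2 < size s ->
  v < size s -> w < size s -> size (get s v) <= N -> all (fun x => x < 2 ^ N) (get s v) ->
  sem N (MvAll v w) s = put (put s v [::]) w (catrev (get s v) (get s w)).
Proof.
move=> vw v2 w2 s2 vs ws hsz ha.
have wv : w != v by rewrite eq_sym.
suff : sem N (MvAll v w) s = put (put s v (drop (size (get s v)) (get s v))) w
    (catrev (take (size (get s v)) (get s v)) (get s w)) by rewrite drop_size take_size.
apply: (@foreach_inv N v (Mv v w) (fun i s' =>
  s' = put (put s v (drop i (get s v))) w (catrev (take i (get s v)) (get s w)))
  (size (get s v))) => //.
- by rewrite drop0 take0 /= !set_nth_id.
- move=> i s' hi ->; rewrite nth_set_nthN // nth_set_nthE (drop_nth 0 hi); split => //.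
  rewrite (@sem_Mv N v w _ (nth 0 (get s v) i) (drop i.+1 (get s v))) ?size_set_nth //; try lia.
  + by rewrite nth_set_nthE (take_nth 0 hi) -cats1 catrev_catl /=; mem_ext.
  + by rewrite nth_set_nthN // nth_set_nthE.
  + by apply: (all_nthP 0 ha).
- by move=> s' ->; rewrite nth_set_nthN // nth_set_nthE drop_size.
Qed.

(* List 7 is a scratch list and the head of list 8 is the factor. *)
Definition Scale (v : nat) : prog :=
  PSeq (Foreach v (progs [:: Mv v 1; Cp 8 1; Mul; Mv 1 7])) (MvAll 7 v).

Lemma sem_Scale N v s f l : 8 < v < size s -> get s 7 = [::] -> get s 8 = f :: l ->
  size (get s v) <= N -> f < 2 ^ N -> all (fun x => (x < 2 ^ N) && (x * f < 2 ^ N)) (get s v) ->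
  sem N (Scale v) s = put s v (map (fun x => x * f) (get s v)).
Proof.
move=> /andP[v8 vs] e7 e8 hsz hf ha; rewrite /Scale sem_seq.
have K1 : sem N (Foreach v (progs [:: Mv v 1; Cp 8 1; Mul; Mv 1 7])) s =
   put (put s v [::]) 7 (rev (map (fun x => x * f) (get s v))).
  suff : sem N (Foreach v (progs [:: Mv v 1; Cp 8 1; Mul; Mv 1 7])) s =
    put (put s v (drop (size (get s v)) (get s v))) 7
      (rev (map (fun x => x * f) (take (size (get s v)) (get s v)))) by rewrite drop_size take_size.
  apply: (@foreach_inv N v _ (fun i s' => s' = put (put s v (drop i (get s v))) 7
    (rev (map (fun x => x * f) (take i (get s v))))) (size (get s v))) => //.
  - rewrite drop0 take0 set_nth_id // [X in set_nth _ _ _ X](_ : _ = get s 7) ?e7 //.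
    by rewrite -{2}e7 set_nth_id //; lia.
  - move=> i s' hi ->.
    have /andP[hx hxf] := all_nthP 0 ha i hi.
    rewrite nth_set_nthN ?nth_set_nthE ?(drop_nth 0 hi); last by lia.
    split => //; rewrite 3!sem_seq; set x := nth 0 (get s v) i; set r := rev _.
    rewrite (@sem_Mv N v 1 _ x (drop i.+1 (get s v))) ?size_set_nth //; try lia; last first.
      by rewrite nth_set_nthN ?nth_set_nthE //; lia.
    rewrite (@sem_Cp N 8 1 _ f l) ?size_set_nth //; try lia; last first.
      by rewrite !nth_set_nthN //; lia.
    rewrite (@sem_Mul N _ x f (get s 1)) ?size_set_nth //; try lia; last first.
      by rewrite !nth_set_nthE !nth_set_nthN //; lia.
    rewrite (@sem_Mv N 1 7 _ (x * f) (get s 1)) ?size_set_nth //; try lia; last first.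
      by rewrite !nth_set_nthE.
    rewrite (take_nth 0 hi) map_rcons rev_rcons -/r -/x; mem_ext.
  - by move=> s' ->; rewrite nth_set_nthN ?nth_set_nthE ?drop_size //; lia.
rewrite K1.
rewrite sem_MvAll ?size_set_nth ?nth_set_nthE ?size_rev ?size_map //; try lia; last first.
  rewrite all_rev all_map; apply: sub_all ha => x /= /andP[] //.
rewrite catrevE revK nth_set_nthN ?nth_set_nthE ?cats0; last by lia.
mem_ext.
Qed.

(** Provides trip counts: a list of [x] zeros, one dropped per pass, lets [Foreach] run a body [x]
    times. *)
Definition Unary (v : nat) : prog :=
  PSeq (PFor (Test 1 PNop PNop (progs [:: ev One; Sub; New v]))) (Drop 1).

Lemma sem_Unary N v s x t : 6 < size s -> 6 < v < size s -> get s 1 = x :: t -> x <= N ->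
  sem N (Unary v) s = put (put s 1 t) v (nseq x 0 ++ get s v).
Proof.
move=> hs /andP[v6 vs] e1 hx.
have v1 : v != 1 by lia.
have v1' : 1 != v by lia.
have X k : iter k (sem N (Test 1 PNop PNop (progs [:: ev One; Sub; New v]))) s =
   put (put s 1 (x - k :: t)) v (nseq (minn k x) 0 ++ get s v).
  elim: k => [|k IH]; first by rewrite subn0 min0n -e1 /= !set_nth_id //; lia.
  rewrite iterS IH sem_test nth_set_nthN // nth_set_nthE.
  case E: (x - k) => [|z].
    have -> : x - k.+1 = 0 by lia.
    by have -> : minn k.+1 x = minn k x by lia.
  have hz : z.+1 < 2 ^ N by apply: leq_ltn_trans (ltn_expl N (isT : 1 < 2)); lia.
  rewrite /progs /ev /= 3!sem_seq sem_new sem_dbl nth_set_nthE sem_new (@sem_Sub N _ z.+1 1 t) ?size_set_nth //; try lia; last first.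
    by rewrite !nth_set_nthE nth_set_nthN // nth_set_nthE.
  have -> : x - k.+1 = z by lia.
  have -> : minn k.+1 x = (minn k x).+1 by lia.
  have -> : z.+1 - 1 = z by lia.
  mem_ext.
rewrite /Unary sem_seq sem_for X sem_drop nth_set_nthN // nth_set_nthE (_ : x - N = 0); last by lia.
rewrite set_nthC // set_nthK (minn_idPr hx) set_nthC //.
Qed.

(** * The matching program *)

Arguments progs : simpl never.
Arguments Mv : simpl never.
Arguments Cp : simpl never.
Arguments Clr : simpl never.
Arguments Scale : simpl never.
Arguments MvAll : simpl never.
Arguments Unary : simpl never.
Arguments Foreach : simpl never.
Arguments ev : simpl never.

Lemma sem_progs N p q l s : sem N (progs [:: p, q & l]) s = sem N (progs (q :: l)) (sem N p s).
Proof. by []. Qed.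
Lemma sem_progs1 N p s : sem N (progs [:: p]) s = sem N p s.
Proof. by []. Qed.

(* Lists: 8 factor f, 9 gain g, 10 denominator e, 11 number of rounds, 12 item index, 13 rounds left,
   15 prices nu, 17 buyer prices Gamma, 19-25 numerators and denominators of p and w, 27 timeouts,
   29 type counts, 31 marks of the current type; the list after each of 15, ..., 31 collects the
   already treated entries. *)
Definition factor_expr : expr := EMul (Hd 21) (EMul (Hd 25) (EMul (Hd 27) (Hd 11))).
Definition gain_expr : expr :=
  ESub (EMul (Hd 19) (EMul (Hd 27) (EMul (Hd 23) (Hd 10))))
    (EAdd (EMul (Hd 19) (EMul (Hd 27) (EMul (Hd 25) (Hd 15))))
          (EMul (Hd 17) (EMul (Hd 25) (EAdd (EMul (Hd 19) (Hd 27)) (Hd 21))))).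

(** With [e] the common denominator, the gain is [g / (e * pd * wd * t)], and the factor [f] has the
    additional divisor [n]. Over the new denominator [e * f], therefore, [Gamma] grows by [n * g]
    and the item price by [cnt * g], both integral. *)
Definition edge_prog : prog := progs
  [:: ev factor_expr; Mv 1 8; ev gain_expr; Mv 1 9;
      Scale 15; Scale 16; Scale 17; Scale 18; Scale 10; Clr 8;
      ev (EAdd (Hd 17) (EMul (Hd 11) (Hd 9))); Clr 17; Mv 1 17;
      ev (EAdd (Hd 16) (EMul (Hd 29) (Hd 9))); Clr 16; Mv 1 16;
      Test 31 PNop PNop (Test 9 PNop PNop (Cp 12 0)); Clr 9;
      Mv 19 20; Mv 21 22; Mv 23 24; Mv 25 26; Mv 27 28; Mv 29 30; Mv 31 32; Mv 17 18].

(** Edges are stored item by item, so the edge lists are simply consumed in order, while the lists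
    indexed by types are rewound after every item. *)
Definition row_prog : prog := progs
  [:: Cp 15 16; Foreach 27 edge_prog; MvAll 28 27; MvAll 30 29; MvAll 32 31; MvAll 18 17;
      Clr 15; ev (EAdd (Hd 12) One); Clr 12; Mv 1 12].

Definition round_prog : prog := progs
  [:: Drop 13; Foreach 0 (Clr 0); New 8; Scale 17; Drop 8; New 12; Foreach 19 row_prog; Clr 12;
      MvAll 20 19; MvAll 22 21; MvAll 24 23; MvAll 26 25; MvAll 16 15].

(* Multiplying by the zero pushed on list 8 resets the buyer prices. *)
Definition main_prog : prog := progs
  [:: Mv 0 12; Mv 0 9; Mv 0 11;
      ev (EMul (Hd 12) (Hd 9)); Unary 14;
      Foreach 14 (progs [:: Drop 14; Mv 0 20; Mv 0 22; Mv 0 24; Mv 0 26]);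
      MvAll 20 19; MvAll 22 21; MvAll 24 23; MvAll 26 25;
      Mv 9 1; Unary 14;
      Foreach 14 (progs [:: Drop 14; Mv 0 28; Mv 0 30; New 17; New 31]);
      MvAll 28 27; MvAll 30 29;
      Mv 12 1; Unary 15;
      Mv 0 12; ev (ESub (Hd 11) (Hd 12)); Clr 12; Unary 13;
      MvAll 0 7; Clr 7; Mv 7 1; Unary 14; Foreach 7 (Clr 7);
      Foreach 14 (progs [:: Drop 14; Mv 31 32]); Dbl 31 true; MvAll 32 31;
      New 10; Dbl 10 true;
      Foreach 13 round_prog].

Lemma main_prog_ok : prog_ok 33 main_prog.
Proof. by vm_compute. Qed.

(** * Correctness of the matching program *)

Definition up (T : Type) (f : nat -> T) (m L : nat) : seq T := [seq f k | k <- iota m (L - m)].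
Definition dn (T : Type) (f : nat -> T) (m : nat) : seq T := [seq f k | k <- rev (iota 0 m)].

Section UpDn.
Variables (T : Type) (f : nat -> T).

Lemma upS m L : m < L -> up f m L = f m :: up f m.+1 L.
Proof. by move=> h; rewrite /up (_ : L - m = (L - m.+1).+1) //; lia. Qed.

Lemma up_nil m L : L <= m -> up f m L = [::].
Proof. by move=> h; rewrite /up (_ : L - m = 0) //; lia. Qed.

Lemma dnS m : dn f m.+1 = f m :: dn f m.
Proof. by rewrite /dn -addn1 iotaD rev_cat. Qed.

Lemma catrev_dn m : catrev (dn f m) [::] = up f 0 m.
Proof. by rewrite catrevE cats0 /dn /up subn0 -map_rev revK. Qed.

Lemma size_up m L : size (up f m L) = L - m.
Proof. by rewrite size_map size_iota. Qed.

Lemma size_dn m : size (dn f m) = m.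
Proof. by rewrite size_map size_rev size_iota. Qed.

Lemma up_split m k L : m <= k <= L -> up f m L = up f m k ++ up f k L.
Proof.
move=> h; rewrite /up -map_cat (_ : L - m = (k - m) + (L - k)); last by lia.
by rewrite iotaD (_ : m + (k - m) = k) //; lia.
Qed.

End UpDn.

Lemma eq_up (T : Type) (f g : nat -> T) m L :
  (forall k, m <= k < L -> f k = g k) -> up f m L = up g m L.
Proof.
by move=> h; apply/eq_in_map => k; rewrite mem_iota => hk; apply: h; lia.
Qed.

Lemma all_up (f : nat -> nat) (P : pred nat) m L :
  (forall k, m <= k < L -> P (f k)) -> all P (up f m L).
Proof.
by move=> h; apply/allP => x /mapP[k]; rewrite mem_iota => hk ->; apply: h; lia.
Qed.

Lemma all_dn (f : nat -> nat) (P : pred nat) m :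
  (forall k, k < m -> P (f k)) -> all P (dn f m).
Proof.
by move=> h; apply/allP => x /mapP[k]; rewrite mem_rev mem_iota => hk ->; apply: h; lia.
Qed.

Definition mem_of (o g e n ix rr : seq nat) (x x2 y y2 pn pn2 pd pd2 wn wn2 wd wd2
    tt tt2 cc cc2 mk mk2 : seq nat) : memory :=
  [:: o; [::]; [::]; [::]; [::]; [::]; [::]; [::]; [::]; g; e; n; ix; rr; [::];
      x; x2; y; y2; pn; pn2; pd; pd2; wn; wn2; wd; wd2; tt; tt2; cc; cc2; mk; mk2].

(** The constant 39 is 3 times 13: [gain_expr] has 13 leaves, and the two price updates have 3
    leaves, evaluated with the common leaf bound of [13 * be] bits. *)
Lemma sem_edge N be o e n ix rr x xs z zs y ys ys2 a pn pn2 b pd pd2 c wn wn2 d wd wd2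
    t tt tt2 q cc cc2 m mk mk2 :
  let f := b * (d * (t * n)) in
  let g := a * (t * (c * e)) - (a * (t * (d * x)) + y * (d * (a * t + b))) in
  0 < be -> 39 * be <= N ->
  all (fun v => v < 2 ^ be) [:: e; n; ix; x; z; y; a; b; c; d; t; q; m] ->
  all (fun v => v < 2 ^ be) xs -> all (fun v => v < 2 ^ be) zs ->
  all (fun v => v < 2 ^ be) ys -> all (fun v => v < 2 ^ be) ys2 ->
  size xs < N -> size zs < N -> size ys < N -> size ys2 < N ->
  sem N edge_prog (mem_of o [::] [:: e] [:: n] [:: ix] rr (x :: xs) (z :: zs) (y :: ys) ys2
    (a :: pn) pn2 (b :: pd) pd2 (c :: wn) wn2 (d :: wd) wd2 (t :: tt) tt2 (q :: cc) cc2
    (m :: mk) mk2) =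
  mem_of (if (0 < m) && (0 < g) then ix :: o else o) [::] [:: e * f] [:: n] [:: ix] rr
    (map (fun v => v * f) (x :: xs)) (z * f + q * g :: map (fun v => v * f) zs)
    (map (fun v => v * f) ys) (y * f + n * g :: map (fun v => v * f) ys2)
    pn (a :: pn2) pd (b :: pd2) wn (c :: wn2) wd (d :: wd2) tt (t :: tt2) cc (q :: cc2)
    mk (m :: mk2).
Proof.
move=> f g be0 hN.
rewrite /= andbT => /and5P[he hn hix hx /and5P[hz hy ha hb /and5P[hc hd ht hq hm]]].
move=> hxs hzs hys hys2 sxs szs sys sys2.
have pw k l : k <= l -> 2 ^ (k * be) <= 2 ^ (l * be) by move=> h; rewrite leq_exp2l //; nia.
have toN k v : k <= 39 -> v < 2 ^ (k * be) -> v < 2 ^ N.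
  by move=> hk h; apply: leq_trans h _; rewrite leq_exp2l //; nia.
have sm k l u v : u < 2 ^ (k * be) -> v < 2 ^ (l * be) -> u * v < 2 ^ ((k + l) * be).
  by rewrite mulnDl expnD; move: (2 ^ _) (2 ^ _) => A B; nia.
have s1 v : v < 2 ^ be -> v < 2 ^ (1 * be) by rewrite mul1n.
have hf : f < 2 ^ (4 * be).
  exact: (sm 1 3 _ _ (s1 _ hb) (sm 1 2 _ _ (s1 _ hd) (sm 1 1 _ _ (s1 _ ht) (s1 _ hn)))).
have hg : g < 2 ^ (4 * be).
  apply: (@leq_ltn_trans (a * (t * (c * e)))); first by rewrite leq_subr.
  exact: (sm 1 3 _ _ (s1 _ ha) (sm 1 2 _ _ (s1 _ ht) (sm 1 1 _ _ (s1 _ hc) (s1 _ he)))).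
have hvf v : v < 2 ^ be -> v * f < 2 ^ (5 * be).
  by move=> h; apply: (sm 1 4) => //; apply: s1.
have N1 v : v < 2 ^ be -> v < 2 ^ N by move=> /s1 /toN; apply.
have hfN : f < 2 ^ N by apply: toN hf.
have hgN : g < 2 ^ N by apply: toN hg.
have sc l : all (fun v => v < 2 ^ be) l -> all (fun v => (v < 2 ^ N) && (v * f < 2 ^ N)) l.
  move=> h; apply: sub_all h => v hv; rewrite N1 //=; apply: toN (hvf _ hv) => //.
have up5 v : v < 2 ^ (5 * be) -> v < 2 ^ (13 * be) by move=> h; apply: leq_trans h _; apply: pw.
have up4 v : v < 2 ^ (4 * be) -> v < 2 ^ (13 * be) by move=> h; apply: leq_trans h _; apply: pw.
have up1 v : v < 2 ^ be -> v < 2 ^ (13 * be) by move=> /s1 h; apply: leq_trans h _; apply: pw.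
have f13 : 0 < 13 * be by lia.
rewrite /edge_prog /mem_of.
rewrite sem_progs (@sem_ev N be) //=; [|by rewrite hb hd ht hn|by lia].
rewrite -/f sem_progs (@sem_Mv N 1 8 _ f [::]) //=.
rewrite sem_progs (@sem_ev N be) //=; [|by rewrite ha ht hc he hd hx hy hb|by lia].
rewrite -/g sem_progs (@sem_Mv N 1 9 _ g [::]) //=.
rewrite sem_progs (@sem_Scale N 15 _ f [::]) //=; last by rewrite -/(all _ (x :: xs)); apply: sc; rewrite /= hx.
rewrite sem_progs (@sem_Scale N 16 _ f [::]) //=; last by apply: (sc (z :: zs)); rewrite /= hz.
rewrite sem_progs (@sem_Scale N 17 _ f [::]) //=; last by apply: (sc (y :: ys)); rewrite /= hy.
rewrite sem_progs (@sem_Scale N 18 _ f [::]) //=; [|by lia|exact: sc].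
rewrite sem_progs (@sem_Scale N 10 _ f [::]) //=; [|by lia|by apply: (sc [:: e]); rewrite /= he].
rewrite sem_progs (@sem_Clr N 8 _ f [::]) //=.
have hyf := hvf _ hy; have hzf := hvf _ hz.
rewrite sem_progs (@sem_ev N (13 * be)) //=; [|by rewrite (up5 _ hyf) (up1 _ hn) (up4 _ hg)|by lia].
rewrite sem_progs (@sem_Clr N 17 _ (y * f) (map (fun v => v * f) ys)) //=; last exact: toN hyf.
have hbig u v w : u < 2 ^ (5 * be) -> v < 2 ^ be -> w < 2 ^ (4 * be) -> u + v * w < 2 ^ N.
  move=> hu hv hw; apply: (@toN 6) => //.
  have := sm _ _ _ _ (s1 _ hv) hw; rewrite (_ : 1 + 4 = 5) // => h5.
  rewrite (_ : 6 * be = be + 5 * be); last by lia.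
  have : 2 ^ 1 <= 2 ^ be by rewrite leq_exp2l.
  by rewrite expnD; nia.
have hyb := hbig _ _ _ hyf hn hg; have hzb := hbig _ _ _ hzf hq hg.
rewrite sem_progs (@sem_Mv N 1 17 _ (y * f + n * g) [::]) //=.
rewrite sem_progs (@sem_ev N (13 * be)) //=; [|by rewrite (up5 _ hzf) (up1 _ hq) (up4 _ hg)|by lia].
rewrite sem_progs (@sem_Clr N 16 _ (z * f) (map (fun v => v * f) zs)) //=; last exact: toN hzf.
rewrite sem_progs (@sem_Mv N 1 16 _ (z * f + q * g) [::]) //=.
rewrite sem_progs.
set o' := if _ then _ else o.
set S0 := (X in sem N (Test _ _ _ _) X).
have -> : sem N (Test 31 PNop PNop (Test 9 PNop PNop (Cp 12 0))) S0 = o' :: behead S0.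
  rewrite /S0 sem_test /= /o'; case: (m) => [|m'] //=; rewrite sem_test /=.
  case: (g) => [|g'] //=; rewrite (@sem_Cp N 12 0 _ ix [::]) //=; exact: N1.
rewrite /S0 {S0} [behead _]/=.
rewrite sem_progs (@sem_Clr N 9 _ g [::]) //=.
rewrite sem_progs (@sem_Mv N 19 20 _ a pn) ?N1 //=.
rewrite sem_progs (@sem_Mv N 21 22 _ b pd) ?N1 //=.
rewrite sem_progs (@sem_Mv N 23 24 _ c wn) ?N1 //=.
rewrite sem_progs (@sem_Mv N 25 26 _ d wd) ?N1 //=.
rewrite sem_progs (@sem_Mv N 27 28 _ t tt) ?N1 //=.
rewrite sem_progs (@sem_Mv N 29 30 _ q cc) ?N1 //=.
rewrite sem_progs (@sem_Mv N 31 32 _ m mk) ?N1 //=.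
by rewrite sem_progs1 (@sem_Mv N 17 18 _ (y * f + n * g) (map (fun v => v * f) ys)).
Qed.

(** Lists of numerators over the common denominator [e]. The invariants fix only the quotients, and
    leave [e] and the numerators existential. *)
Definition scl (e : nat) (l : seq nat) (q : seq rat) : Prop :=
  [seq (x%:R / e%:R)%R | x <- l] = q.

Lemma sem_ClrAll N v s : v < size s -> size (get s v) <= N ->
  all (fun x => x < 2 ^ N) (get s v) -> sem N (Foreach v (Clr v)) s = put s v [::].
Proof.
move=> vs hsz ha.
suff : sem N (Foreach v (Clr v)) s = put s v (drop (size (get s v)) (get s v)) by rewrite drop_size.
apply: (@foreach_inv N v (Clr v) (fun i s' => s' = put s v (drop i (get s v))) (size (get s v))) => //.
- by rewrite drop0 set_nth_id.
- move=> i s' hi ->; rewrite nth_set_nthE (drop_nth 0 hi); split => //.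
  rewrite (@sem_Clr N v _ (nth 0 (get s v) i) (drop i.+1 (get s v))) ?size_set_nth ?nth_set_nthE ?set_nthK //.
  + by lia.
  + by apply: (all_nthP 0 ha).
- by move=> s' ->; rewrite nth_set_nthE drop_size.
Qed.

Section Scl.
Implicit Types (e x : nat) (l : seq nat) (q : seq rat).

Lemma scl_inv e l v q : scl e l (v :: q) ->
  exists x l', [/\ l = x :: l', (x%:R / e%:R)%R = v & scl e l' q].
Proof. by case: l => [//|x l] [<- <-]; exists x, l. Qed.

Lemma scl_cons e l q x v : (x%:R / e%:R)%R = v -> scl e l q -> scl e (x :: l) (v :: q).
Proof. by rewrite /scl /= => -> ->. Qed.

Lemma scl_nil e l : scl e l [::] -> l = [::].
Proof. by case: l. Qed.

Lemma scl_size e l q : scl e l q -> size l = size q.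
Proof. by move=> <-; rewrite size_map. Qed.

Lemma scale_div e f x : 0 < f -> ((x * f)%:R / (e * f)%:R = x%:R / e%:R :> rat)%R.
Proof. by move=> f0; rewrite !natrM -mulf_div divff ?mulr1 // pnatr_eq0 -lt0n. Qed.

Lemma scl_scale e l q f : 0 < f -> scl e l q -> scl (e * f) (map (fun v => v * f) l) q.
Proof.
by move=> f0 <-; rewrite /scl -map_comp; apply: eq_map => x /=; rewrite scale_div.
Qed.

Lemma scl_catrev e l l' q q' : scl e l q -> scl e l' q' -> scl e (catrev l l') (catrev q q').
Proof. by move=> <- <-; rewrite /scl !catrevE map_cat map_rev. Qed.

(** How all numerators are kept small: a bound on the rational value times a bound on the
    denominator. *)
Lemma scl_bound e l q bit_cap E price_cap : 0 < e -> e <= E -> E * price_cap < 2 ^ bit_cap -> scl e l q ->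
  all (fun v => v <= price_cap%:R)%R q -> all (fun v => v < 2 ^ bit_cap) l.
Proof.
move=> e0 eE EQ <-; rewrite all_map; apply: sub_all => x /=.
rewrite ler_pdivrMr ?ltr0n // -natrM ler_nat => h.
by apply: leq_ltn_trans EQ; apply: leq_trans h _; rewrite mulnC leq_mul2r eE orbT.
Qed.

End Scl.

(** * Prices as rationals and their computation by the program *)

Section Algo.
Variables (nA nB n bb : nat) (pn pd wn wd tt cc : nat -> nat).

Definition edge_p (k : nat) : rat := ((pn k)%:R / (pd k)%:R)%R.
Definition edge_w (k : nat) : rat := ((wn k)%:R / (wd k)%:R)%R.

(** At price [G], a probe pays [G * p] for the chance of using up the buyer and [G / t] for one unit
    of the timeout. *)
Definition gainq (k j : nat) (v G : rat) : rat :=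
  Num.max 0%R (edge_p k * (edge_w k - v) - G * (edge_p k + (tt j)%:R^-1))%R.

Fixpoint Gam (nu : nat -> rat) (i j : nat) : rat :=
  if i is i'.+1 then
    (Gam nu i' j + gainq (i' * nB + j) j (nu i') (Gam nu i' j))%R
  else 0%R.

Definition edge_gain (nu : nat -> rat) (i j : nat) : rat :=
  gainq (i * nB + j) j (nu i) (Gam nu i j).

Definition nu_part (nu : nat -> rat) (i m : nat) : rat :=
  (nu i + \sum_(j < m) (cc j)%:R / n%:R * edge_gain nu i j)%R.

Fixpoint nuq (r : nat) : nat -> rat :=
  if r is r'.+1 then fun i => nu_part (nuq r') i nB else fun _ => 0%R.

Fixpoint sel (nu : nat -> rat) (i : nat) : seq nat :=
  if i is i'.+1 then
    if (0 < edge_gain nu i' bb)%R then i' :: sel nu i' else sel nu i'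
  else [::].

Variable delta : nat.
Hypotheses (hbb : bb < nB) (hn : 0 < n)
  (hpd : forall k, k < nA * nB -> 0 < pd k) (hwd : forall k, k < nA * nB -> 0 < wd k)
  (htt : forall j, j < nB -> 0 < tt j)
  (hp1 : forall k, k < nA * nB -> pn k <= pd k)
  (hcc : \sum_(j < nB) cc j = n)
  (bpn : forall k, k < nA * nB -> pn k < 2 ^ delta)
  (bpd : forall k, k < nA * nB -> pd k < 2 ^ delta)
  (bwn : forall k, k < nA * nB -> wn k < 2 ^ delta)
  (bwd : forall k, k < nA * nB -> wd k < 2 ^ delta)
  (btt : forall j, j < nB -> tt j < 2 ^ delta)
  (bcc : forall j, j < nB -> cc j < 2 ^ delta)
  (bn : n < 2 ^ delta) (bA : nA < 2 ^ delta).

Let idx i j : i < nA -> j < nB -> i * nB + j < nA * nB.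
Proof. by move=> hi hj; nia. Qed.

Lemma gainq_ge0 k j v G : (0 <= gainq k j v G)%R.
Proof. by rewrite /gainq le_max lexx. Qed.

Lemma edge_p_ge0 k : (0 <= edge_p k)%R.
Proof. by rewrite divr_ge0 ?ler0n. Qed.

Lemma edge_p_le1 k : k < nA * nB -> (edge_p k <= 1)%R.
Proof. by move=> h; rewrite ler_pdivrMr ?mul1r ?ler_nat ?hp1 // ltr0n hpd. Qed.

Lemma edge_w_le k : k < nA * nB -> (0 <= edge_w k <= (2 ^ delta)%:R)%R.
Proof.
move=> h; rewrite divr_ge0 ?ler0n //= ler_pdivrMr ?ltr0n ?hwd // -natrM ler_nat.
by apply: leq_trans (ltnW (bwn h)) _; rewrite leq_pmulr // hwd.
Qed.

Lemma gainq_le k j v G : k < nA * nB -> (0 <= v)%R -> (0 <= G)%R ->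
  (gainq k j v G <= (2 ^ delta)%:R)%R.
Proof.
move=> h v0 G0; rewrite /gainq ge_max ler0n /=.
have p0 := edge_p_ge0 k; have p1 := edge_p_le1 h; have /andP[w0 w1] := edge_w_le h.
have t0 : (0 <= (tt j)%:R^-1 :> rat)%R by rewrite invr_ge0 ler0n.
have : (0 <= G * (edge_p k + (tt j)%:R^-1))%R by rewrite mulr_ge0 // addr_ge0.
by move: (G * _)%R => X X0; nra.
Qed.

Lemma Gam_ge0 nu i j : (0 <= Gam nu i j)%R.
Proof. by elim: i => //= i IH; rewrite addr_ge0 ?gainq_ge0. Qed.

Lemma Gam_le nu i j : j < nB -> i <= nA -> (forall k, k < nA -> (0 <= nu k)%R) ->
  (Gam nu i j <= (i * 2 ^ delta)%:R)%R.
Proof.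
move=> hj hi nu0; elim: i hi => [//|i IH] hi /=.
rewrite mulSn natrD addrC lerD ?IH // ?(ltnW hi) //.
by apply: gainq_le; [exact: idx|exact: nu0|exact: Gam_ge0].
Qed.

Lemma nu_part_mono nu i m m' : m <= m' -> (nu_part nu i m <= nu_part nu i m')%R.
Proof.
move=> h; rewrite /nu_part lerD2l -(subnKC h) big_split_ord /= lerDl.
by apply: sumr_ge0 => j _; rewrite mulr_ge0 ?gainq_ge0 // divr_ge0 ?ler0n.
Qed.

(** A round raises a price by an average of gains, as the counts sum to [n], and a gain is at most
    the largest profit, hence at most [2 ^ delta]. *)
Lemma nuq_bound r i : i < nA -> (0 <= nuq r i <= (r * 2 ^ delta)%:R)%R.
Proof.
elim: r i => [|r IH] i hi; first by rewrite /= mul0n lexx.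
have /andP[h1 h2] := IH i hi.
have := @nu_part_mono (nuq r) i 0 nB (leq0n _); rewrite {1}/nu_part big_ord0 addr0 => h3.
rewrite (le_trans h1 h3) /= mulSn natrD addrC /nu_part lerD //.
apply: (@le_trans _ _ (\sum_(j < nB) ((cc j)%:R / n%:R * (2 ^ delta)%:R))%R).
  apply: ler_sum => j _; apply: ler_wpM2l; first by rewrite divr_ge0 ?ler0n.
  by apply: gainq_le; [exact: idx|exact: h1|exact: Gam_ge0].
rewrite -mulr_suml -mulr_suml -natr_sum hcc divff ?mul1r //.
by rewrite pnatr_eq0 -lt0n.
Qed.

(** After clearing denominators, truncated subtraction of naturals is exactly the maximum with 0 in
    the gain. *)
Lemma gain_scaled e x y k j v G (a := pn k) (b := pd k) (c := wn k) (d := wd k) (t := tt j)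
    (g := a * (t * (c * e)) - (a * (t * (d * x)) + y * (d * (a * t + b)))) :
  k < nA * nB -> j < nB -> 0 < e ->
  (x%:R / e%:R)%R = v -> (y%:R / e%:R)%R = G ->
  (g%:R = gainq k j v G * (e * (b * (d * t)))%:R :> rat)%R.
Proof.
move=> hk hj e0 <- <-.
have E0 : (e%:R != 0 :> rat)%R by rewrite pnatr_eq0 -lt0n.
have b0 : (b%:R != 0 :> rat)%R by rewrite pnatr_eq0 -lt0n hpd.
have d0 : (d%:R != 0 :> rat)%R by rewrite pnatr_eq0 -lt0n hwd.
have t0 : (t%:R != 0 :> rat)%R by rewrite pnatr_eq0 -lt0n htt.
have pos : (0 < (e * (b * (d * t)))%:R :> rat)%R by rewrite ltr0n !muln_gt0 e0 hpd // hwd // htt.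
rewrite /gainq maxr_pMl ?(ltW pos) // mul0r /edge_p /edge_w -/a -/b -/c -/d -/t.
set R := (X in Num.max 0%R X).
have -> : R = ((a * (t * (c * e)))%:R - (a * (t * (d * x)) + y * (d * (a * t + b)))%:R)%R.
  rewrite /R !(natrM, natrD).
  by field; rewrite E0 b0 d0 t0.
rewrite /g; move: (a * _) (_ + _) => A B; case: (leqP B A) => h.
  by rewrite natrB //; apply/esym/max_idPr; rewrite subr_ge0 ler_nat.
rewrite (_ : A - B = 0); last by lia.
by apply/esym/max_idPl; rewrite subr_le0 ler_nat ltnW.
Qed.

Definition edge_steps : nat := n * (nA * nB).
(** The factor of an edge is a product of four numbers below [2 ^ delta], so the denominator grows
    by at most [4 * delta] bits per treated edge; [2 * delta] bits allow for the prices, and one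
    more makes the bound strict. *)
Definition bit_cap : nat := 4 * delta * edge_steps + 2 * delta + 1.
Variables (N Rn : nat).
Hypotheses (hN : 39 * bit_cap <= N) (hNL : nA * nB < N) (hNn : n < N) (hRn : Rn <= n).

Definition mark (j : nat) : nat := j == bb.

Let be0 : 0 < bit_cap. Proof. by rewrite /bit_cap; lia. Qed.
Let dbe : delta <= bit_cap. Proof. by rewrite /bit_cap; lia. Qed.
Let beN : bit_cap <= N. Proof. by lia. Qed.
Let Dbe v : v < 2 ^ delta -> v < 2 ^ bit_cap.
Proof. by move=> h; apply: leq_trans h _; rewrite leq_exp2l. Qed.
Let beNv v : v < 2 ^ bit_cap -> v < 2 ^ N.
Proof. by move=> h; apply: leq_trans h _; rewrite leq_exp2l. Qed.

(** One factor [2 ^ delta] bounds a single gain, the other the number of rounds (for item prices) or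
    of items (for [Gamma]). *)
Definition price_cap : nat := 2 ^ (2 * delta).

Lemma EQ_small m : m <= edge_steps -> 2 ^ (4 * delta * m) * price_cap < 2 ^ bit_cap.
Proof. by move=> h; rewrite /price_cap -expnD ltn_exp2l // /bit_cap; nia. Qed.

Lemma count_le r i m : r < n -> i < nA -> m <= nB -> (r * nA + i) * nB + m <= edge_steps.
Proof.
move=> hr hi hm; apply: (@leq_trans ((r * nA + i).+1 * nB)); first by rewrite mulSn addnC leq_add2r.
rewrite /edge_steps mulnA leq_mul2r; apply/orP; right.
by apply: (@leq_trans (r.+1 * nA)); [rewrite mulSn addnC ltn_add2r|rewrite leq_mul2r hr orbT].
Qed.

Lemma le_Q (i : nat) (x : rat) : i < 2 ^ delta -> (x <= (i * 2 ^ delta)%:R)%R -> (x <= price_cap%:R)%R.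
Proof.
move=> hi h; apply: le_trans h _; rewrite ler_nat /price_cap mul2n -addnn expnD.
by rewrite leq_mul2r ltnW ?orbT.
Qed.

Lemma all_up_rat (f : nat -> rat) (P : pred rat) m L :
  (forall k, m <= k < L -> P (f k)) -> all P (up f m L).
Proof.
by move=> h; apply/allP => x /mapP[k]; rewrite mem_iota => hk ->; apply: h; lia.
Qed.

Lemma all_dn_rat (f : nat -> rat) (P : pred rat) m :
  (forall k, k < m -> P (f k)) -> all P (dn f m).
Proof.
by move=> h; apply/allP => x /mapP[k]; rewrite mem_rev mem_iota => hk ->; apply: h; lia.
Qed.

Section Round.
Variables (r : nat) (rr : seq nat).
Hypothesis hr : r < Rn.
Let nu := nuq r.

Let nu0 k : k < nA -> (0 <= nu k)%R.
Proof. by move=> h; case/andP: (nuq_bound r h). Qed.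

Let nuQ k r' : k < nA -> r' <= Rn -> (nuq r' k <= price_cap%:R)%R.
Proof.
move=> h h'; have /andP[_ b] := nuq_bound r' h; apply: le_Q b.
by apply: leq_ltn_trans bn; apply: leq_trans h' hRn.
Qed.

Let GamQ i j : i <= nA -> j < nB -> (Gam nu i j <= price_cap%:R)%R.
Proof. by move=> hi hj; apply: le_Q (Gam_le hj hi nu0); apply: leq_ltn_trans hi bA. Qed.

Let partQ i j : i < nA -> j <= nB -> (nu_part nu i j <= price_cap%:R)%R.
Proof. by move=> hi hj; apply: le_trans (nu_part_mono _ _ hj) (nuQ hi hr). Qed.

(** Old prices stay on list 15, since all gains of a round refer to them; list 16 has the partially
    raised price of item [i] above the finished new ones. The exponent counts the edges treated
    since the start. The decision on outputting [i] falls when type [bb] is passed. *)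
Definition edge_inv (i j : nat) (s : memory) : Prop :=
  exists e X X2 Y Y2,
  [/\ 0 < e <= 2 ^ (4 * delta * ((r * nA + i) * nB + j)),
      scl e X (up nu i nA) /\ scl e X2 (nu_part nu i j :: dn (nuq r.+1) i),
      scl e Y (up (Gam nu i) j nB) & scl e Y2 (dn (Gam nu i.+1) j)] /\
  s = mem_of (if j <= bb then sel nu i else sel nu i.+1) [::] [:: e] [:: n] [:: i] rr X X2 Y Y2
    (up pn (i * nB + j) (nA * nB)) (dn pn (i * nB + j))
    (up pd (i * nB + j) (nA * nB)) (dn pd (i * nB + j))
    (up wn (i * nB + j) (nA * nB)) (dn wn (i * nB + j))
    (up wd (i * nB + j) (nA * nB)) (dn wd (i * nB + j))
    (up tt j nB) (dn tt j) (up cc j nB) (dn cc j) (up mark j nB) (dn mark j).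

Lemma edge_step i j s : i < nA -> j < nB -> edge_inv i j s ->
  get s 27 <> [::] /\ edge_inv i j.+1 (sem N edge_prog s).
Proof.
move=> hi hj [e [X [X2 [Y [Y2 [[/andP[e0 eB] [sX sX2] sY sY2] ->]]]]]].
set k := i * nB + j; have hk : k < nA * nB by apply: idx.
have ctot : (r * nA + i) * nB + j < edge_steps.
  by rewrite -addnS; apply: count_le => //; apply: leq_trans hr hRn.
rewrite (upS _ hi) in sX; rewrite (upS _ hj) in sY.
have EQ := EQ_small (ltnW ctot).
have bX := scl_bound e0 eB EQ sX; have bX2 := scl_bound e0 eB EQ sX2.
have bY := scl_bound e0 eB EQ sY; have bY2 := scl_bound e0 eB EQ sY2.
have {}bX : all (fun v => v < 2 ^ bit_cap) X.
  apply: bX; rewrite /= (nuQ hi (ltnW hr)) /=; apply: all_up_rat => m hm; apply: nuQ (ltnW hr); lia.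
have {}bX2 : all (fun v => v < 2 ^ bit_cap) X2.
  apply: bX2; rewrite /= (partQ hi (ltnW hj)) /=; apply: all_dn_rat => m hm; apply: (nuQ _ hr); lia.
have {}bY : all (fun v => v < 2 ^ bit_cap) Y.
  apply: bY; rewrite /= (GamQ (ltnW hi) hj) /=; apply: all_up_rat => m hm; apply: GamQ; lia.
have {}bY2 : all (fun v => v < 2 ^ bit_cap) Y2.
  by apply: bY2; apply: all_dn_rat => m hm; apply: GamQ; lia.
have zX := scl_size sX; have zX2 := scl_size sX2; have zY := scl_size sY; have zY2 := scl_size sY2.
rewrite /= size_up in zX; rewrite /= size_dn in zX2; rewrite /= size_up in zY; rewrite size_dn in zY2.
have [x [xs [eX vx sxs]]] := scl_inv sX; have [z [zs [eX2 vz szs]]] := scl_inv sX2.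
have [y [ys [eY vy sys]]] := scl_inv sY.
subst X X2 Y; rewrite /= in zX zX2 zY.
have nAL : nA <= nA * nB by nia.
have nBL : nB <= nA * nB by nia.
rewrite !(upS _ hk) !(upS _ hj).
split => //.
case/andP: bX => bx bxs; case/andP: bX2 => bz bzs; case/andP: bY => by_ bys.
have be_e : e < 2 ^ bit_cap.
  apply: leq_ltn_trans eB _; apply: leq_ltn_trans EQ; rewrite leq_pmulr // /price_cap expn_gt0 //.
rewrite (@sem_edge N bit_cap) //; try lia; last first.
  rewrite /= be_e (Dbe bn) bx bz by_ (Dbe (bpn hk)) (Dbe (bpd hk)) (Dbe (bwn hk)) (Dbe (bwd hk)).
  rewrite (Dbe (btt hj)) (Dbe (bcc hj)) (Dbe (leq_ltn_trans (ltnW hi) bA)) /= andbT.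
  by apply: Dbe; rewrite /mark; case: (j == bb); [|lia]; apply: leq_ltn_trans bn; lia.
set f := pd k * _; set g := _ - _.
have f0 : 0 < f by rewrite !muln_gt0 hpd // hwd // htt.
have gE := gain_scaled hk hj e0 vx vy; rewrite -/g in gE.
have gpos : (0 < g) = (0 < edge_gain nu i j)%R.
  have pos : (0 < (e * (pd k * (wd k * tt j)))%:R :> rat)%R.
    by rewrite ltr0n !muln_gt0 e0 hpd // hwd // htt.
  by rewrite -(ltr0n rat) gE pmulr_lgt0.
have Eo : (if (0 < mark j) && (0 < g) then i :: (if j <= bb then sel nu i else sel nu i.+1)
    else (if j <= bb then sel nu i else sel nu i.+1)) = if j < bb then sel nu i else sel nu i.+1.
  by rewrite gpos /mark; case: (ltngtP j bb) => [h|h|h]; rewrite // h.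
have n0 : (n%:R != 0 :> rat)%R by rewrite pnatr_eq0 -lt0n.
have [E0 P0 W0 T0] : [/\ e%:R != 0 :> rat, (pd k)%:R != 0 :> rat, (wd k)%:R != 0 :> rat
    & (tt j)%:R != 0 :> rat]%R.
  by split; rewrite pnatr_eq0 -lt0n ?hpd ?hwd ?htt.
exists (e * f), (map (fun v => v * f) (x :: xs)), (z * f + cc j * g :: map (fun v => v * f) zs).
exists (map (fun v => v * f) ys), (y * f + n * g :: map (fun v => v * f) Y2).
split; last first.
  by rewrite Eo !addnS !dnS.
split.
- rewrite muln_gt0 e0 f0 /= addnS mulnS addnC expnD leq_mul //.
  have bf u v : u < 2 ^ delta -> v <= 2 ^ delta -> u * v <= 2 ^ delta * 2 ^ delta.
    by move=> h1 h2; apply: leq_mul => //; apply: ltnW.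
  rewrite (_ : 4 * delta = delta + (delta + (delta + delta))); last by lia.
  rewrite !expnD /f; apply: leq_mul; first exact: ltnW (bpd hk).
  apply: leq_mul; first exact: ltnW (bwd hk).
  by apply: leq_mul; apply: ltnW; [exact: btt|exact: bn].
- split; first by rewrite upS //; apply: scl_scale.
  apply: scl_cons; last exact: scl_scale.
  rewrite /nu_part big_ord_recr /= addrA -/(nu_part nu i j) -vz natrD mulrDl scale_div //.
  congr (_ + _)%R; rewrite /edge_gain -/k /f !natrM gE !natrM.
  by field; rewrite E0 P0 W0 T0 n0.
- exact: scl_scale.
- rewrite dnS; apply: scl_cons; last exact: scl_scale.
  rewrite /= -/k -vy natrD mulrDl scale_div //.
  congr (_ + _)%R; rewrite vy /f !natrM gE !natrM.
  by field; rewrite E0 P0 W0 T0 n0.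
Qed.

Definition row_inv (i : nat) (s : memory) : Prop :=
  exists e X X2 Y,
  [/\ 0 < e <= 2 ^ (4 * delta * ((r * nA + i) * nB)),
      scl e X (up nu i nA), scl e X2 (dn (nuq r.+1) i) & scl e Y (up (Gam nu i) 0 nB)] /\
  s = mem_of (sel nu i) [::] [:: e] [:: n] [:: i] rr X X2 Y [::]
    (up pn (i * nB) (nA * nB)) (dn pn (i * nB))
    (up pd (i * nB) (nA * nB)) (dn pd (i * nB))
    (up wn (i * nB) (nA * nB)) (dn wn (i * nB))
    (up wd (i * nB) (nA * nB)) (dn wd (i * nB))
    (up tt 0 nB) [::] (up cc 0 nB) [::] (up mark 0 nB) [::].

Let nBN : nA > 0 -> nB < N. Proof. by move=> h; nia. Qed.

Lemma row_step i s : i < nA -> row_inv i s ->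
  get s 19 <> [::] /\ row_inv i.+1 (sem N row_prog s).
Proof.
move=> hi [e [X [X2 [Y [[/andP[e0 eB] sX sX2 sY] ->]]]]].
have hk : i * nB < nA * nB by have := idx hi hbb; lia.
split; first by rewrite /= (upS _ hk).
have nB' : nB < N by apply: nBN; lia.
have [x [xs [eX vx sxs]]] : exists x xs, [/\ X = x :: xs, (x%:R / e%:R)%R = nu i & scl e xs (up nu i.+1 nA)].
  by apply: scl_inv; rewrite -upS.
have ctot m : m <= nB -> (r * nA + i) * nB + m <= edge_steps.
  by move=> hm; apply: count_le => //; apply: leq_trans hr hRn.
have xN : x < 2 ^ N.
  apply: beNv; have EQ := EQ_small (ctot 0 isT); rewrite addn0 in EQ.
  have /= := scl_bound e0 eB EQ (scl_cons vx (erefl : scl e [::] [::])); rewrite !andbT; apply.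
  by rewrite (nuQ hi (ltnW hr)).
rewrite /row_prog sem_progs eX (@sem_Cp N 15 16 _ x xs) //=.
rewrite sem_progs.
have : edge_inv i nB (sem N (Foreach 27 edge_prog) (mem_of (sel nu i) [::] [:: e] [:: n] [:: i] rr (x :: xs) (x :: X2) Y [::]
    (up pn (i * nB) (nA * nB)) (dn pn (i * nB))
    (up pd (i * nB) (nA * nB)) (dn pd (i * nB))
    (up wn (i * nB) (nA * nB)) (dn wn (i * nB))
    (up wd (i * nB) (nA * nB)) (dn wd (i * nB))
    (up tt 0 nB) [::] (up cc 0 nB) [::] (up mark 0 nB) [::])).
  apply: (@foreach_inv N 27 edge_prog (edge_inv i)); first by lia.
  - exists e, (x :: xs), (x :: X2), Y, [::]; split; last by rewrite addn0.
    rewrite addn0 e0 eB; split => //; split; first by rewrite -eX.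
    by apply: scl_cons => //; rewrite vx /nu_part big_ord0 addr0.
  - by move=> j s' hj; apply: edge_step.
  - by move=> s' [? [? [? [? [? [_ ->]]]]]]; rewrite /= up_nil.
rewrite {1}/mem_of; move: (sem N (Foreach 27 edge_prog) _) => s1 H1.
have [e' [X' [X2' [Y' [Y2' [[/andP[e0' eB'] [sX' sX2'] sY' sY2'] ->]]]]]] := H1.
have EQ' := EQ_small (ctot nB (leqnn _)).
have {}sY' : Y' = [::] by apply: scl_nil (e') _ _; rewrite -(up_nil (Gam nu i) (leqnn nB)).
have bY2 : all (fun v => v < 2 ^ N) Y2'.
  apply: sub_all (scl_bound e0' eB' EQ' sY2' _); first by move=> v /beNv.
  by apply: all_dn_rat => m hm; apply: GamQ.
have zY2 := scl_size sY2'; rewrite size_dn in zY2.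
rewrite sY' leqNgt hbb /= !(up_nil _ (leqnn nB)) /mem_of.
have A27 : all (fun v => v < 2 ^ N) (dn tt nB) by apply: all_dn => j hj; apply/beNv/Dbe/btt.
have A29 : all (fun v => v < 2 ^ N) (dn cc nB) by apply: all_dn => j hj; apply/beNv/Dbe/bcc.
have A31 : all (fun v => v < 2 ^ N) (dn mark nB).
  by apply: all_dn => j hj; apply: leq_ltn_trans (_ : 1 < _); rewrite ?leq_b1 // -{1}(expn0 2) ltn_exp2l; lia.
rewrite sem_progs sem_MvAll ?size_dn //=; last by lia.
rewrite sem_progs sem_MvAll ?size_dn //=; last by lia.
rewrite sem_progs sem_MvAll ?size_dn //=; last by lia.
rewrite sem_progs sem_MvAll ?zY2 //=; last by lia.
rewrite !catrev_dn.
have [x' [xs' [eX' vx' sxs']]] : exists x xs, [/\ X' = x :: xs, (x%:R / e'%:R)%R = nu i & scl e' xs (up nu i.+1 nA)].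
  by apply: scl_inv; rewrite -upS.
have xN' : x' < 2 ^ N.
  apply: beNv; have /= := scl_bound e0' eB' EQ' (scl_cons vx' (erefl : scl e' [::] [::])); rewrite !andbT; apply.
  by rewrite (nuQ hi (ltnW hr)).
rewrite eX' sem_progs (@sem_Clr N 15 _ x' xs') //=.
have iD : i < 2 ^ delta by apply: leq_ltn_trans (ltnW hi) bA.
rewrite sem_progs (@sem_ev N bit_cap) //=; [|by rewrite (Dbe iD)|by lia].
rewrite sem_progs (@sem_Clr N 12 _ i [::]) //=; last by apply/beNv/Dbe.
rewrite sem_progs1 (@sem_Mv N 1 12 _ (i + 1) [::]) //=; last first.
  by apply/beNv/Dbe; apply: leq_ltn_trans bA; lia.
exists e', xs', X2', (catrev Y2' [::]); split; last first.
  by rewrite addn1 /= mulSn (addnC nB) .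
split.
- by rewrite e0' (leq_trans eB') // leq_exp2l //; nia.
- by [].
- by rewrite dnS.
- by rewrite -catrev_dn; apply: scl_catrev.
Qed.

End Round.

(** The output holds the probe list of the latest round, made from the prices before its update. Of
    the leftover [Gamma] values only number and size matter, because the next round multiplies them
    by 0. *)
Definition round_inv (r : nat) (s : memory) : Prop :=
  exists e X Y,
  [/\ 0 < e <= 2 ^ (4 * delta * (r * nA * nB)),
      scl e X (up (nuq r) 0 nA), size Y = nB & all (fun v => v < 2 ^ N) Y] /\
  s = mem_of (if r is r'.+1 then sel (nuq r') nA else [::]) [::] [:: e] [:: n] [::]
    (nseq (Rn - r) 0) X [::] Y [::]
    (up pn 0 (nA * nB)) [::] (up pd 0 (nA * nB)) [::]
    (up wn 0 (nA * nB)) [::] (up wd 0 (nA * nB)) [::]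
    (up tt 0 nB) [::] (up cc 0 nB) [::] (up mark 0 nB) [::].

Lemma sel_bound nu i : all (fun v => v < i) (sel nu i) /\ size (sel nu i) <= i.
Proof.
elim: i => [//|i [IH1 IH2]] /=; have M : all (fun v => v < i.+1) (sel nu i).
  by apply: sub_all IH1 => v /ltnW.
by case: ifP => _ /=; rewrite ?ltnSn M; split => //; apply: leqW.
Qed.

Hypothesis (hNB : nB < N).

Let nAN : nA < N.
Proof. by apply: leq_ltn_trans hNL; rewrite leq_pmulr //; lia. Qed.

Let oneN : 1 < 2 ^ N. Proof. by rewrite -{1}(expn0 2) ltn_exp2l //; lia. Qed.

Lemma round_step r s : r < Rn -> round_inv r s ->
  get s 13 <> [::] /\ round_inv r.+1 (sem N round_prog s).
Proof.
move=> hr [e [X [Y [[/andP[e0 eB] sX zY aY] ->]]]].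
rewrite (_ : Rn - r = (Rn - r.+1).+1); last by lia.
split => //.
rewrite /round_prog sem_progs sem_drop /=.
set o := (if r is r'.+1 then _ else _).
have [ao so] : all (fun v => v < 2 ^ N) o /\ size o <= N.
  rewrite /o; case: (r) => [//|r']; have [h1 h2] := sel_bound (nuq r') nA; split; last by lia.
  by apply: sub_all h1 => v hv; apply/beNv/Dbe; apply: ltn_trans hv bA.
rewrite sem_progs sem_ClrAll //= {ao so}.
rewrite sem_progs sem_new /=.
rewrite sem_progs (@sem_Scale N 17 _ 0 [::]) //=; last 3 first.
- by rewrite zY; lia.
- by rewrite expn_gt0.
- by apply: sub_all aY => v ->; rewrite muln0 expn_gt0.
rewrite sem_progs sem_drop /=.
rewrite sem_progs sem_new /=.
rewrite sem_progs.
set rr := nseq _ 0; set s1 := (X in sem N (Foreach 19 _) X).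
have I0 : row_inv r rr 0 s1.
  exists e, X, [::], (map (fun x => x * 0) Y); rewrite mul0n addn0; split => //; split => //.
  - by rewrite e0.
  - rewrite /scl -map_comp; apply: (@eq_from_nth _ 0%R); first by rewrite size_map zY size_up subn0.
    move=> i; rewrite size_map zY => hi; rewrite (nth_map 0) ?zY // (nth_map 0) ?size_iota ?subn0 //= muln0 mul0r //.
have : row_inv r rr nA (sem N (Foreach 19 row_prog) s1).
  apply: (@foreach_inv N 19 row_prog (row_inv r rr)) => //; first by lia.
  - by move=> i s' hi; apply: row_step.
  - by move=> s' [? [? [? [? [_ ->]]]]]; rewrite /= up_nil.
move: (sem N (Foreach 19 row_prog) s1) => s2 [e' [X' [X2' [Y' [[/andP[e0' eB'] sX' sX2' sY'] ->]]]]].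
have {}sX' : X' = [::] by apply: scl_nil (e') _ _; rewrite -(up_nil (nuq r) (leqnn nA)).
have ctot : (r * nA + nA) * nB <= edge_steps.
  by rewrite /edge_steps mulnA leq_mul2r addnC -mulSn leq_mul2r; apply/orP; right; apply/orP; right; lia.
have EQ' := EQ_small ctot.
have bY : all (fun v => v < 2 ^ N) Y'.
  apply: sub_all (scl_bound e0' eB' EQ' sY' _); first by move=> v /beNv.
  apply: all_up_rat => m hm; apply: le_Q bA _; apply: Gam_le => //.
  by move=> k hk; case/andP: (nuq_bound r hk).
have bX2 : all (fun v => v < 2 ^ N) X2'.
  apply: sub_all (scl_bound e0' eB' EQ' sX2' _); first by move=> v /beNv.
  apply: all_dn_rat => m hm; have /andP[_ b] := nuq_bound r.+1 hm; apply: le_Q b.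
  by apply: leq_ltn_trans bn; lia.
have zX2 := scl_size sX2'; rewrite size_dn in zX2.
have zY' := scl_size sY'; rewrite size_up subn0 in zY'.
rewrite sX' !(up_nil _ (leqnn (nA * nB))) /mem_of.
rewrite sem_progs (@sem_Clr N 12 _ nA [::]) //=; last by apply/beNv/Dbe.
have AL (g : nat -> nat) : (forall k, k < nA * nB -> g k < 2 ^ delta) ->
    all (fun v => v < 2 ^ N) (dn g (nA * nB)).
  by move=> h; apply: all_dn => k hk; apply/beNv/Dbe/h.
rewrite sem_progs sem_MvAll ?size_dn ?AL //=; last by lia.
rewrite sem_progs sem_MvAll ?size_dn ?AL //=; last by lia.
rewrite sem_progs sem_MvAll ?size_dn ?AL //=; last by lia.
rewrite sem_progs sem_MvAll ?size_dn ?AL //=; last by lia.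
rewrite sem_progs1 sem_MvAll ?zX2 //=; last by lia.
rewrite !catrev_dn.
exists e', (catrev X2' [::]), Y'; split => //; split => //.
- by rewrite e0' (leq_trans eB') // (mulSn r) (addnC nA).
- by rewrite -(catrev_dn (nuq r.+1)); apply: scl_catrev.
Qed.

Definition quad (k : nat) : seq nat := [:: pn k; pd k; wn k; wd k].
Definition duo (j : nat) : seq nat := [:: tt j; cc j].

Lemma catrev_nseq (T : Type) (x : T) m s : catrev (nseq m x) s = nseq m x ++ s.
Proof.
elim: m s => //= m IH s; rewrite IH -cat_rcons.
suff -> : rcons (nseq m x) x = x :: nseq m x by [].
by elim: m {IH} => //= m ->.
Qed.

Lemma marks_up : nseq bb 0 ++ 1 :: nseq (nB - bb).-1 0 = up mark 0 nB.
Proof.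
rewrite (@up_split _ mark 0 bb nB); last by lia.
rewrite (upS _ hbb); congr (_ ++ _ :: _).
- apply: (@eq_from_nth _ 0); first by rewrite size_nseq size_up subn0.
  move=> i; rewrite size_nseq => hi.
  by rewrite nth_nseq hi (nth_map 0) ?size_iota ?subn0 // nth_iota ?subn0 // /mark; case: eqP => //; lia.
- by rewrite /mark eqxx.
- apply: (@eq_from_nth _ 0); first by rewrite size_nseq size_up; lia.
  move=> i; rewrite size_nseq => hi; rewrite nth_nseq hi (nth_map 0) ?size_iota; last by lia.
  by rewrite nth_iota; [rewrite /mark; case: eqP => //; lia|lia].
Qed.

Hypotheses (bB : nB < 2 ^ delta).
Variables (hl rn : nat) (junk : seq nat).
Hypotheses (hhl : hl < n) (hR : Rn = n - hl) (hrn : rn < 2 ^ N)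
  (hjunk : all (fun v => v < 2 ^ N) junk) (sjunk : size junk + 2 <= N).

(** Each pass overwrites the output of the previous one. The last of the [Rn] passes uses the prices
    for [Rn - 1] later rounds, which are those valid after the present round. *)
Lemma main_correct :
  nth [::] (sem N main_prog (([:: nA; nB; n] ++ flatten (up quad 0 (nA * nB)) ++
    flatten (up duo 0 nB) ++ hl :: junk ++ [:: bb; rn]) :: nseq 32 [::])) 0 =
  sel (nuq Rn.-1) nA.
Proof.
have DN v : v < 2 ^ delta -> v < 2 ^ N by move=> h; apply/beNv/Dbe.
set L := nA * nB; rewrite /main_prog /=.
rewrite sem_progs (@sem_Mv N 0 12 _ nA (nB :: n :: flatten (up quad 0 L) ++
  flatten (up duo 0 nB) ++ hl :: junk ++ [:: bb; rn])) ?DN //=.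
rewrite sem_progs (@sem_Mv N 0 9 _ nB (n :: flatten (up quad 0 L) ++
  flatten (up duo 0 nB) ++ hl :: junk ++ [:: bb; rn])) ?DN //=.
rewrite sem_progs (@sem_Mv N 0 11 _ n (flatten (up quad 0 L) ++
  flatten (up duo 0 nB) ++ hl :: junk ++ [:: bb; rn])) ?DN //=.
rewrite sem_progs (@sem_ev N bit_cap) //=; [|by rewrite !Dbe|by lia].
rewrite sem_progs (@sem_Unary N 14 _ L [::]) //=; last by rewrite /L; lia.
rewrite cats0 sem_progs.
pose S1 i := [:: flatten (up quad i L) ++ flatten (up duo 0 nB) ++ hl :: junk ++ [:: bb; rn];
   [::]; [::]; [::]; [::]; [::]; [::]; [::]; [::]; [:: nB]; [::]; [:: n]; [:: nA]; [::]; nseq (L - i) 0;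
   [::]; [::]; [::]; [::]; [::]; dn pn i; [::]; dn pd i; [::]; dn wn i; [::]; dn wd i;
   [::]; [::]; [::]; [::]; [::]; [::]].
set s1 := (X in sem N (Foreach 14 _) X).
have -> : sem N (Foreach 14 (progs [:: Drop 14; Mv 0 20; Mv 0 22; Mv 0 24; Mv 0 26])) s1 = S1 L.
  apply: (@foreach_inv N 14 _ (fun i s => s = S1 i) L) => //; first by rewrite /L; lia.
  - by rewrite /S1 subn0.
  - move=> i s hi ->; rewrite /S1 (_ : L - i = (L - i.+1).+1); last by lia.
    split => //; rewrite (upS _ hi) sem_progs sem_drop /=.
    set tl := flatten (up quad i.+1 L) ++ _.
    rewrite sem_progs (@sem_Mv N 0 20 _ (pn i) [:: pd i, wn i, wd i & tl]) ?DN ?bpn //=.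
    rewrite sem_progs (@sem_Mv N 0 22 _ (pd i) [:: wn i, wd i & tl]) ?DN ?bpd //=.
    rewrite sem_progs (@sem_Mv N 0 24 _ (wn i) (wd i :: tl)) ?DN ?bwn //=.
    rewrite sem_progs1 (@sem_Mv N 0 26 _ (wd i) tl) ?DN ?bwd //=.
    by rewrite !dnS.
  - by move=> s ->; rewrite /S1 subnn.
rewrite /S1 (up_nil _ (leqnn L)) subnn [flatten [::] ++ _]/=.
have AL (g : nat -> nat) : (forall k, k < L -> g k < 2 ^ delta) -> all (fun v => v < 2 ^ N) (dn g L).
  by move=> h; apply: all_dn => k hk; apply/DN/h.
have LN : L <= N by rewrite /L; lia.
rewrite sem_progs sem_MvAll ?size_dn ?AL //=.
rewrite sem_progs sem_MvAll ?size_dn ?AL //=.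
rewrite sem_progs sem_MvAll ?size_dn ?AL //=.
rewrite sem_progs sem_MvAll ?size_dn ?AL //= !catrev_dn.
rewrite sem_progs (@sem_Mv N 9 1 _ nB [::]) ?DN //=.
rewrite sem_progs (@sem_Unary N 14 _ nB [::]) //=; last by lia.
rewrite cats0 sem_progs.
pose S2 i := [:: flatten (up duo i nB) ++ hl :: junk ++ [:: bb; rn];
   [::]; [::]; [::]; [::]; [::]; [::]; [::]; [::]; [::]; [::]; [:: n]; [:: nA]; [::]; nseq (nB - i) 0;
   [::]; [::]; nseq i 0; [::]; up pn 0 L; [::]; up pd 0 L; [::]; up wn 0 L; [::]; up wd 0 L; [::];
   [::]; dn tt i; [::]; dn cc i; nseq i 0; [::]].
set s2 := (X in sem N (Foreach 14 _) X).
have -> : sem N (Foreach 14 (progs [:: Drop 14; Mv 0 28; Mv 0 30; New 17; New 31])) s2 = S2 nB.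
  apply: (@foreach_inv N 14 _ (fun i s => s = S2 i) nB) => //; first by lia.
  - by rewrite /S2 subn0.
  - move=> i s hi ->; rewrite /S2 (_ : nB - i = (nB - i.+1).+1); last by lia.
    split => //; rewrite (upS _ hi) sem_progs sem_drop /=.
    set tl := flatten (up duo i.+1 nB) ++ _.
    rewrite sem_progs (@sem_Mv N 0 28 _ (tt i) (cc i :: tl)) ?DN ?btt //=.
    rewrite sem_progs (@sem_Mv N 0 30 _ (cc i) tl) ?DN ?bcc //=.
    rewrite sem_progs sem_new sem_progs1 sem_new /=.
    by rewrite !dnS.
  - by move=> s ->; rewrite /S2 subnn.
rewrite /S2 (up_nil _ (leqnn nB)) subnn [flatten [::] ++ _]/=.
have AB (g : nat -> nat) : (forall k, k < nB -> g k < 2 ^ delta) -> all (fun v => v < 2 ^ N) (dn g nB).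
  by move=> h; apply: all_dn => k hk; apply/DN/h.
rewrite sem_progs sem_MvAll ?size_dn ?AB //=; last by lia.
rewrite sem_progs sem_MvAll ?size_dn ?AB //=; last by lia.
rewrite !catrev_dn.
rewrite sem_progs (@sem_Mv N 12 1 _ nA [::]) ?DN //=.
rewrite sem_progs (@sem_Unary N 15 _ nA [::]) //=; last by lia.
have hld : hl < 2 ^ delta by apply: ltn_trans hhl bn.
rewrite cats0 sem_progs (@sem_Mv N 0 12 _ hl (junk ++ [:: bb; rn])) ?DN //=.
rewrite sem_progs (@sem_ev N bit_cap) //=; [|by rewrite !Dbe|by lia].
rewrite sem_progs (@sem_Clr N 12 _ hl [::]) ?DN //=.
rewrite sem_progs (@sem_Unary N 13 _ (n - hl) [::]) //=; last by lia.
have bbN : bb < 2 ^ N by apply: DN; apply: ltn_trans hbb bB.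
rewrite cats0 sem_progs sem_MvAll //=; last 2 first.
- by rewrite size_cat /=; lia.
- by rewrite all_cat hjunk /= bbN hrn.
(* After the reversal the random number and the buyer type come first, so the rounds of the history
   are discarded without being parsed. *)
rewrite catrevE rev_cat cats0 /=.
rewrite sem_progs (@sem_Clr N 7 _ rn (bb :: rev junk)) //=.
rewrite sem_progs (@sem_Mv N 7 1 _ bb (rev junk)) //=.
rewrite sem_progs (@sem_Unary N 14 _ bb [::]) //=; last by lia.
rewrite sem_progs sem_ClrAll ?size_rev ?all_rev //=; last by lia.
rewrite cats0 sem_progs.
pose S3 i := [:: [::]; [::]; [::]; [::]; [::]; [::]; [::]; [::]; [::]; [::]; [::]; [:: n]; [::];
   nseq (n - hl) 0; nseq (bb - i) 0; nseq nA 0; [::]; nseq nB 0; [::];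
   up pn 0 L; [::]; up pd 0 L; [::]; up wn 0 L; [::]; up wd 0 L; [::];
   up tt 0 nB; [::]; up cc 0 nB; [::]; nseq (nB - i) 0; nseq i 0].
set s3 := (X in sem N (Foreach 14 _) X).
have -> : sem N (Foreach 14 (progs [:: Drop 14; Mv 31 32])) s3 = S3 bb.
  apply: (@foreach_inv N 14 _ (fun i s => s = S3 i) bb) => //; first by lia.
  - by rewrite /S3 !subn0.
  - move=> i s hi ->; rewrite /S3 (_ : bb - i = (bb - i.+1).+1); last by lia.
    rewrite (_ : nB - i = (nB - i.+1).+1); last by lia.
    split => //; rewrite sem_progs sem_drop /=.
    by rewrite sem_progs1 (@sem_Mv N 31 32 _ 0 (nseq (nB - i.+1) 0)) ?expn_gt0 //=.
  - by move=> s ->; rewrite /S3 subnn.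
rewrite /S3 subnn (_ : nB - bb = (nB - bb).-1.+1); last by lia.
rewrite sem_progs sem_dbl /=.
rewrite sem_progs sem_MvAll //=; last 2 first.
- by rewrite size_nseq; lia.
- by rewrite all_nseq expn_gt0 orbT.
rewrite catrev_nseq marks_up.
rewrite sem_progs sem_new sem_progs sem_dbl /= sem_progs1.
set s4 := (X in sem N _ X).
have I0 : round_inv 0 s4.
  exists 1, (nseq nA 0), (nseq nB 0); split; last by rewrite subn0 hR.
  split; [by rewrite expn_gt0| |by rewrite size_nseq|by rewrite all_nseq expn_gt0 orbT].
  rewrite /scl map_nseq mul0r; apply: (@eq_from_nth _ 0%R); first by rewrite size_nseq size_up subn0.
  by move=> i; rewrite size_nseq => hi; rewrite nth_nseq hi (nth_map 0) // size_iota subn0.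
have : round_inv Rn (sem N (Foreach 13 round_prog) s4).
  apply: (@foreach_inv N 13 round_prog round_inv) => //; first by lia.
  - by move=> r s; apply: round_step.
  - by move=> s [? [? [? [_ ->]]]]; rewrite /= subnn.
case=> [? [? [? [_ ->]]]] /=.
by case: Rn hR => [|//]; lia.
Qed.

End Algo.

(** * Competitive analysis *)

Section Analysis.
Variable I : instance.
Hypothesis vI : valid_instance I.
Variables pn pd wn wd tt cc : nat -> nat.
Local Notation n := (nr I).
Local Notation item := 'I_(nA I).
Local Notation buyer := 'I_(nB I).
Local Notation flat a b := ((a : nat) * nB I + (b : nat)).
Hypotheses (hp : forall (a : item) (b : buyer), edge_p pn pd (flat a b) = prob a b)
  (hw : forall (a : item) (b : buyer), edge_w wn wd (flat a b) = wt a b)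
  (ht : forall b : buyer, tt b = tout b) (hc : forall b : buyer, cc b = cnt b).

Local Open Scope ring_scope.
Local Notation nu k := (nuq (nB I) n pn pd wn wd tt cc k).
Local Notation gn f a b := (edge_gain (nB I) pn pd wn wd tt f a b).
Local Notation Gm f k b := (Gam (nB I) pn pd wn wd tt f k b).
Local Notation sl b f k := (sel (nB I) b pn pd wn wd tt f k).

Definition items (l : seq nat) : seq item := pmap (@insub nat (fun x => (x < nA I)%N) item) l.

(** A match also destroys the price of the item, which is part of the value of continuing. *)
Definition net (f : nat -> rat) (b : buyer) (o : option item) : rat :=
  if o is Some a then wt a b - f a else 0.

Lemma prob_itv (a : item) (b : buyer) : 0 <= prob a b <= 1.
Proof. by case: vI => h _ _ _ _; have /andP[/ltW -> ->] := h a b. Qed.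

Lemma wt_ge0 (a : item) (b : buyer) : 0 <= wt a b.
Proof. by case: vI. Qed.

Lemma tout_gt0 (b : buyer) : (0 < tout b)%N.
Proof. by case: vI. Qed.

Lemma nr_gt0 : (0 < n)%N.
Proof. by case: vI. Qed.

Lemma sum_cnt : \sum_(b < nB I) ((cnt b)%:R / n%:R) = 1 :> rat.
Proof.
case: vI => _ _ _ n0 <-; rewrite -mulr_suml -natr_sum divff //.
by rewrite pnatr_eq0 -lt0n; case: vI => _ _ _ ? ->.
Qed.

Lemma gnE f (a : item) (b : buyer) : gn f a b =
  Num.max 0 (prob a b * (wt a b - f a) - Gm f a b * (prob a b + (tout b)%:R^-1)).
Proof. by rewrite /edge_gain /gainq hp hw ht. Qed.

Lemma gn_ge0 f i j : 0 <= gn f i j.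
Proof. exact: gainq_ge0. Qed.

Lemma GmE f (b : nat) : Gm f (nA I) b = \sum_(a < nA I) gn f a b.
Proof.
have X k : Gm f k b = \sum_(0 <= a < k) gn f a b.
  by elim: k => [|k IH]; rewrite ?big_nil // big_nat_recr //= -IH.
by rewrite X big_mkord.
Qed.

Lemma Gm_mono f k m b : (k <= m)%N -> Gm f k b <= Gm f m b.
Proof.
move=> /subnK <-; elim: (m - k)%N => // d IH; apply: le_trans IH _.
by rewrite addSn /= lerDl gainq_ge0.
Qed.

Lemma nuS k i : nu k.+1 i = nu k i + \sum_(b < nB I) ((cnt b)%:R / n%:R) * gn (nu k) i b.
Proof. by rewrite /= /nu_part; congr (_ + _); apply: eq_bigr => b _; rewrite hc. Qed.

Lemma cnt_ge0 (b : buyer) : 0 <= (cnt b)%:R / n%:R :> rat.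
Proof. by rewrite divr_ge0 ?ler0n. Qed.

Lemma nu_ge0 k i : 0 <= nu k i.
Proof.
elim: k => [//|k IH]; rewrite nuS addr_ge0 // sumr_ge0 // => b _.
by rewrite mulr_ge0 ?cnt_ge0 ?gn_ge0.
Qed.

Lemma nu_mono k i : nu k i <= nu k.+1 i.
Proof.
by rewrite nuS lerDl sumr_ge0 // => b _; rewrite mulr_ge0 ?cnt_ge0 ?gn_ge0.
Qed.

Lemma probe_val_mono (b : buyer) s (F F' : option item -> rat) :
  (forall a, a \in s -> F (Some a) <= F' (Some a)) -> F None <= F' None ->
  probe_val b s F <= probe_val b s F'.
Proof.
move=> hF hN; elim: s hF => [//|a s IH] hF /=.
have /andP[p0 p1] := prob_itv a b.
apply: lerD; first by rewrite ler_wpM2l // hF // mem_head.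
rewrite ler_wpM2l ?subr_ge0 //; apply: IH => a' h; apply: hF; rewrite inE h orbT //.
Qed.

Lemma probe_val_shift (b : buyer) s (F : option item -> rat) C :
  probe_val b s (fun o => F o + C) = probe_val b s F + C.
Proof. by elim: s => [//|a s IH] /=; rewrite IH; ring. Qed.

(* For a single item, [p (w - nu) <= g + Gamma (p + 1/t)]; a probe list has total success
   probability and total timeout use at most 1. *)
Lemma probe_upper f (b : buyer) (s : seq item) :
  probe_val b s (net f b) <=
  \sum_(a <- s) gn f a b + Gm f (nA I) b + (size s)%:R * (Gm f (nA I) b / (tout b)%:R).
Proof.
set G := Gm f (nA I) b; have G0 : 0 <= G by apply: Gam_ge0.
set T := G / (tout b)%:R; have T0 : 0 <= T by rewrite divr_ge0 ?ler0n.
elim: s => [|a s IH] /=; first by rewrite big_nil mul0r add0r addr0.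
rewrite big_cons (_ : (size s).+1%:R * T = (size s)%:R * T + T); last by rewrite -addn1 natrD mulrDl mul1r.
have /andP[p0 p1] := prob_itv a b.
have X : prob a b * (wt a b - f a) <= gn f a b + G * prob a b + T.
  have Y : prob a b * (wt a b - f a) - Gm f a b * (prob a b + (tout b)%:R^-1) <= gn f a b.
    by rewrite gnE le_max lexx orbT.
  have Z : Gm f a b * (prob a b + (tout b)%:R^-1) <= G * (prob a b + (tout b)%:R^-1).
    by rewrite ler_wpM2r ?addr_ge0 ?invr_ge0 ?ler0n // Gm_mono // ltnW.
  by rewrite [X in _ <= X]mulrDr -/T in Z; lra.
have S0 : 0 <= \sum_(a0 <- s) gn f a0 b by apply: sumr_ge0 => a0 _; apply: gn_ge0.
have U0 : 0 <= (size s)%:R * T by rewrite mulr_ge0 ?ler0n.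
move: (probe_val _ _ _) IH => V IH.
have W : (1 - prob a b) * V <= (1 - prob a b) * (\sum_(a0 <- s) gn f a0 b + G + (size s)%:R * T).
  by rewrite ler_wpM2l ?subr_ge0.
move: (\sum_(a0 <- s) _) ((size s)%:R * T) S0 U0 W => A B S0 U0 W.
(* The gains and probe charges of the tail enter with weight [1 - p] only, and the missing parts are
   nonnegative; the match charges combine as [p G + (1 - p) G = G]. *)
have : 0 <= prob a b * A by rewrite mulr_ge0.
have : 0 <= prob a b * B by rewrite mulr_ge0.
by move=> h1 h2; rewrite /net; lra.
Qed.

Lemma insub_item k (hk : (k < nA I)%N) : insub k = Some (Ordinal hk) :> option item.
Proof. exact: insubT. Qed.

(* The invariant of the probing loop: both the buyer's match and each of its [t] probes are
   priced at [Gamma / t] and [Gamma], which costs at most the second summand. *)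
Lemma probe_lower f (b : buyer) (unm : pred item) k c :
  (k <= nA I)%N -> (c <= tout b)%N ->
  - Gm f k b + c%:R / (tout b)%:R * Gm f k b + \sum_(a : item | unm a && (a < k)%N) gn f a b <=
  probe_val b (take c [seq a <- items (sl b f k) | unm a]) (net f b).
Proof.
have t0 : 0 < (tout b)%:R :> rat by rewrite ltr0n tout_gt0.
elim: k c => [|k IH] c hk hct.
  by rewrite /= oppr0 mulr0 !add0r big1 // => a; rewrite ltn0 andbF.
have ck m : (m <= tout b)%N -> 0 <= (m%:R / (tout b)%:R : rat) <= 1.
  by move=> hm; rewrite divr_ge0 ?ler0n //= ler_pdivrMr // mul1r ler_nat.
pose a := Ordinal hk.
have sumE : \sum_(i : item | unm i && (i < k.+1)%N) gn f i b =
    (if unm a then gn f a b else 0) + \sum_(i : item | unm i && (i < k)%N) gn f i b.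
  case: ifP => ua.
    rewrite (bigD1 a) /=; last by rewrite ua ltnSn.
    congr (_ + _); apply: eq_bigl => i; rewrite -(inj_eq val_inj) /= ltnS.
    by case: (unm i) => //=; rewrite ltn_neqAle andbC.
  rewrite add0r; apply: eq_bigl => i; case ui: (unm i) => //=; rewrite ltnS leq_eqVlt.
  by case: eqP => //= e; move: ua; rewrite (_ : a = i) ?ui //; apply: val_inj.
have sub_le : \sum_(i : item | unm i && (i < k)%N) gn f i b <= Gm f k b.
  have X m : (m <= nA I)%N -> Gm f m b = \sum_(i : item | (i < m)%N) gn f i b.
    elim: m => [|m IHm] hm; first by rewrite big_pred0.
    rewrite (bigD1 (Ordinal hm)) //= addrC -/(gn f m b); congr (_ + _).
    rewrite IHm ?(ltnW hm) //; apply: eq_bigl => i.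
    by rewrite -(inj_eq val_inj) /= ltnS andbC ltn_neqAle.
  rewrite X ?(ltnW hk) // [X in _ <= X](bigID unm) /=.
  rewrite (eq_bigl (fun i : item => (i < k)%N && unm i)); last by move=> i; rewrite andbC.
  by rewrite lerDl sumr_ge0 // => i _; apply: gn_ge0.
rewrite sumE {sumE} [Gm f k.+1 b]/= -/(gn f k b).
move: IH sub_le; set S := \sum_(i | _) _; set G := Gm f k b => IH sub_le.
have G0 : 0 <= G by apply: Gam_ge0.
have g0 : 0 <= gn f k b by apply: gn_ge0.
have S0 : 0 <= S by apply: sumr_ge0 => i _; apply: gn_ge0.
(* An item that is passed over still raises [Gamma] by its gain, but with the coefficient
   [d / t - 1], which is not positive. *)
have skip d : (d <= tout b)%N -> - (G + gn f k b) + d%:R / (tout b)%:R * (G + gn f k b) + (0 + S) <=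
    probe_val b (take d [seq i <- items (sl b f k) | unm i]) (net f b).
  move=> hd; have := IH d (ltnW hk) hd; have /andP[d0 d1] := ck d hd.
  move: (probe_val _ _ _) (d%:R / _) d0 d1 => V x d0 d1.
  have : x * gn f k b <= gn f k b by rewrite -[leRHS]mul1r ler_wpM2r.
  by rewrite mulrDr; lra.
rewrite /=; case gpos: (0 < gn f k b); last first.
  have gz : gn f k b = 0 by apply/eqP; rewrite eq_le g0 leNgt gpos.
  have -> : (if unm a then gn f a b else 0) = 0 by rewrite [gn f a b]gz if_same.
  exact: skip.
rewrite /items /= (insub_item hk) /= -/a -/(items _); case ua: (unm a); last exact: skip.
(* With no probe left, the gain of [a] cancels against its share of [Gamma], and [S <= G]
   remains. *)
case: c hct => [|c] hct /=.
  by rewrite !mul0r [gn f a b]/(gn f k b); lra.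
have /andP[p0 p1] := prob_itv a b.
have gE : gn f k b = prob a b * (wt a b - f a) - G * (prob a b + (tout b)%:R^-1).
  by move: gpos; rewrite -[gn f k b]/(gn f a b) gnE; case: (leP 0 _) => //; rewrite ltxx.
have := IH c (ltnW hk) (ltnW hct).
move: (probe_val _ _ _) => V hV; rewrite [gn f a b]/(gn f k b).
have /andP[c0 c1] := ck c.+1 hct.
have ec : c.+1%:R / (tout b)%:R = c%:R / (tout b)%:R + (tout b)%:R^-1 :> rat.
  by rewrite -addn1 natrD mulrDl mul1r.
have /andP[d0 d1] := ck c (ltnW hct).
set x := c%:R / (tout b)%:R in hV ec d0 d1; set y := c.+1%:R / (tout b)%:R in ec c0 c1 *.
have xG : x * G <= G by rewrite -[leRHS]mul1r ler_wpM2r.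
have yg : y * gn f k b <= gn f k b by rewrite -[leRHS]mul1r ler_wpM2r.
have hV' : (1 - prob a b) * (- G + x * G + S) <= (1 - prob a b) * V by rewrite ler_wpM2l ?subr_ge0.
(* The continuation forfeited by a success is worth at most [G], and [G * p] was charged for it. *)
have hK : prob a b * (- G + x * G + S) <= prob a b * G by rewrite ler_wpM2l //; lra.
have yG : y * G = x * G + G * (tout b)%:R^-1 by rewrite ec mulrDl [_^-1 * G]mulrC.
rewrite -/(gn f k b) mulrDr yG /net; rewrite -[f a]/(f k) in gE *.
move: (gn f k b) ((tout b)%:R^-1) gE yg => g ti gE yg; lra.
Qed.

Definition unmatched (h : history I) : pred item := fun a => a \notin matched h.

Lemma matched_rcons h (r : round I) :
  matched (rcons h r) = matched h ++ (if r.2 is Some a then [:: a] else [::]).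
Proof. by rewrite /matched map_rcons -cats1 flatten_cat /= cats0. Qed.

Lemma unmatched_none f h b s :
  \sum_(a | unmatched (rcons h (b, s, None)) a) f a = \sum_(a | unmatched h a) f a :> rat.
Proof. by apply: eq_bigl => a; rewrite /unmatched matched_rcons cats0. Qed.

Lemma unmatched_some (f : item -> rat) h b s a : unmatched h a ->
  \sum_(i | unmatched (rcons h (b, s, Some a)) i) f i = \sum_(i | unmatched h i) f i - f a.
Proof.
move=> ua; rewrite [in RHS](bigD1 a) //= addrAC subrr add0r; apply: eq_bigl => i.
by rewrite /unmatched matched_rcons mem_cat inE negb_or.
Qed.

Lemma unmatched_some_le (f : item -> rat) h b s a : (forall i, 0 <= f i) ->
  \sum_(i | unmatched h i) f i - f a <= \sum_(i | unmatched (rcons h (b, s, Some a)) i) f i.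
Proof.
move=> f0; case ua: (unmatched h a); first by rewrite unmatched_some.
rewrite lerBlDr [X in _ <= X + _](eq_bigl (unmatched h)) ?lerDl // => i.
rewrite /unmatched matched_rcons mem_cat inE negb_or; case: eqP => [->|_]; rewrite ?andbT //.
by move: ua; rewrite /unmatched => ->.
Qed.

(** The policy ignores past matches, and [exec_list] removes the matched items; [probe_lower] then
    yields the gains of exactly the unmatched ones. Their average over the types is the increase of
    the prices from [nu k] to [nu k.+1]. *)
Lemma value_lower (pol : rpolicy I) k h :
  (forall k h b, (k < n)%N -> (size h + k.+1)%N = n ->
     pol h b = [:: (1, items (sl b (nu k) (nA I)))]) ->
  (size h + k)%N = n ->
  \sum_(a | unmatched h a) nu k a <= value_from pol k h.
Proof.
move=> hpol; elim: k h => [|k IH] h hs.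
  by rewrite /= big1.
have kn : (k < n)%N by lia.
rewrite /=.
have step (b : buyer) : \sum_(a | unmatched h a) nu k a + \sum_(a | unmatched h a) gn (nu k) a b <=
   \sum_(d <- pol h b) d.1 * probe_val b (exec_list h b d.2) (fun o =>
      (if o is Some a then wt a b else 0) + value_from pol k (rcons h (b, exec_list h b d.2, o))).
  rewrite (hpol k) // big_seq1 /= mul1r; set s := exec_list _ _ _.
  set C := \sum_(a | unmatched h a) nu k a.
  apply: (@le_trans _ _ (probe_val b s (fun o => net (nu k) b o + C))).
    rewrite probe_val_shift addrC lerD2r.
    have := @probe_lower (nu k) b (unmatched h) (nA I) (tout b) (leqnn _) (leqnn _).
    rewrite divff ?pnatr_eq0 -?lt0n ?tout_gt0 // mul1r addNr add0r.
    have -> : \sum_(a : item | unmatched h a && (a < nA I)%N) gn (nu k) a b =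
        \sum_(a | unmatched h a) gn (nu k) a b.
      by apply: eq_bigl => a; rewrite ltn_ord andbT.
    rewrite /s /exec_list undup_id //; apply: filter_uniq.
    have [srt _] := sel_bound (nB I) b pn pd wn wd tt (nu k) (nA I).
    rewrite /items pmap_sub_uniq //.
    by elim: (nA I) => //= m IHm; case: ifP => _ //=; rewrite IHm andbT;
      apply/negP => /(allP (sel_bound (nB I) b pn pd wn wd tt (nu k) m).1); rewrite ltnn.
  have R o : (size (rcons h (b, s, o)) + k)%N = n by rewrite size_rcons addSnnS.
  apply: probe_val_mono => [a _|]; rewrite /net.
    rewrite -addrA lerD2l addrC; apply: le_trans (IH _ (R _)).
    by apply: unmatched_some_le => i; apply: nu_ge0.
  by rewrite lerD2l; apply: le_trans (IH _ (R _)); rewrite unmatched_none.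
apply: (@le_trans _ _ (\sum_(b < nB I) ((cnt b)%:R / n%:R) *
   (\sum_(a | unmatched h a) nu k a + \sum_(a | unmatched h a) gn (nu k) a b))); last first.
  by apply: ler_sum => b _; rewrite ler_wpM2l ?cnt_ge0.
have -> : \sum_(b < nB I) ((cnt b)%:R / n%:R) *
   (\sum_(a | unmatched h a) nu k a + \sum_(a | unmatched h a) gn (nu k) a b) =
   \sum_(a | unmatched h a) nu k a +
   \sum_(b < nB I) ((cnt b)%:R / n%:R) * \sum_(a | unmatched h a) gn (nu k) a b.
  under eq_bigr do rewrite mulrDr.
  by rewrite big_split /= -mulr_suml sum_cnt mul1r.
have -> : \sum_(a | unmatched h a) nu k.+1 a = \sum_(a | unmatched h a) nu k a +
   \sum_(b < nB I) ((cnt b)%:R / n%:R) * \sum_(a | unmatched h a) gn (nu k) a b.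
  under eq_bigr => a _ do rewrite nuS.
  rewrite big_split /=; congr (_ + _); rewrite exchange_big /=.
  by apply: eq_bigr => b _; rewrite mulr_sumr.
exact: lexx.
Qed.

(** [Gamma] contains the gains of all items, matched ones included, so the excess of [3 Gamma] per
    round can only be charged to the prices of all items; hence the second sum does not shrink with
    the history. *)
Lemma value_upper (pol : rpolicy I) k h : valid_rpolicy pol ->
  value_from pol k h <= \sum_(a | unmatched h a) nu k a + 3 * \sum_(a : item) nu k a.
Proof.
move=> vpol; elim: k h => [|k IH] h.
  by rewrite /= !big1 // mulr0 addr0.
set C := \sum_(a | unmatched h a) nu k a + 3 * \sum_(a : item) nu k a.
have step (b : buyer) : \sum_(d <- pol h b) d.1 * probe_val b (exec_list h b d.2) (fun o =>
      (if o is Some a then wt a b else 0) + value_from pol k (rcons h (b, exec_list h b d.2, o)))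
    <= C + 3 * Gm (nu k) (nA I) b.
  have [d0 d1] := vpol h b; rewrite -[leRHS]mul1r -[X in _ <= X * _]d1 mulr_suml.
  rewrite [leLHS]big_seq [leRHS]big_seq; apply: ler_sum => d hd.
  apply: ler_wpM2l; first exact: (allP d0).
  set s := exec_list h b d.2.
  have su a : a \in s -> unmatched h a.
    by move=> /mem_take; rewrite mem_undup mem_filter => /andP[].
  apply: (@le_trans _ _ (probe_val b s (fun o => net (nu k) b o + C))).
    apply: probe_val_mono => [a /su ua|]; rewrite /net.
      by rewrite -addrA lerD2l (le_trans (IH _)) // unmatched_some // /C; lra.
    by rewrite lerD2l (le_trans (IH _)) // unmatched_none.
  rewrite probe_val_shift addrC lerD2l; apply: le_trans (probe_upper _ _ _) _.
  set G := Gm (nu k) (nA I) b; have G0 : 0 <= G by apply: Gam_ge0.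
  have u : uniq s by apply: take_uniq; apply: undup_uniq.
  have A : \sum_(a <- s) gn (nu k) a b <= G.
    rewrite /G GmE big_uniq //= [leRHS](bigID (mem s)) /= lerDl.
    by apply: sumr_ge0 => a _; apply: gn_ge0.
  have B : (size s)%:R * (G / (tout b)%:R) <= G.
    rewrite mulrCA -[leRHS]mulr1 ler_wpM2l // ler_pdivrMr ?ltr0n ?tout_gt0 // mul1r ler_nat.
    by rewrite size_take; case: ltnP.
  apply: le_trans (lerD (lerD A (lexx G)) B) _.
  by lra.
rewrite /=; apply: (@le_trans _ _ (\sum_(b < nB I) ((cnt b)%:R / n%:R) * (C + 3 * Gm (nu k) (nA I) b))).
  by apply: ler_sum => b _; rewrite ler_wpM2l ?cnt_ge0.
have -> : \sum_(b < nB I) (cnt b)%:R / n%:R * (C + 3 * Gm (nu k) (nA I) b) =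
    C + \sum_(b < nB I) (cnt b)%:R / n%:R * (3 * Gm (nu k) (nA I) b).
  under eq_bigr do rewrite mulrDr.
  by rewrite big_split /= -mulr_suml sum_cnt mul1r.
(* Averaged over the types, the final [Gamma] is the total increase of all prices in this round. *)
have E : \sum_(b < nB I) (cnt b)%:R / n%:R * (3 * Gm (nu k) (nA I) b) =
   3 * (\sum_(a : item) nu k.+1 a - \sum_(a : item) nu k a).
  rewrite -sumrB.
  under [in RHS]eq_bigr do rewrite nuS addrAC subrr add0r.
  rewrite exchange_big /= mulr_sumr; apply: eq_bigr => b _.
  by rewrite GmE -mulr_sumr mulrCA.
rewrite E /C.
have M : \sum_(a | unmatched h a) nu k a <= \sum_(a | unmatched h a) nu k.+1 a.
  by apply: ler_sum => a _; apply: nu_mono.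
lra.
Qed.

End Analysis.

(** * Encodings and the theorem *)

Lemma enc_natE m : enc_nat m = map sym_of_cell (num_cells m).
Proof.
rewrite /enc_nat /num_cells map_rcons -cats1 /bits; congr (_ ++ _).
elim: m {2 4}m => //= f IH m; case: eqP => // _ /=; rewrite -IH.
by case: (odd m).
Qed.

Definition int_cells (z : int) : seq cell := Some (z < 0)%R :: num_cells `|z|%N.
(** No separator follows the sign symbol, so the parser takes it as an extra least significant
    bit. *)
Definition int_code (z : int) : nat := (z < 0)%R + (`|z|%N).*2.

Lemma enc_intE z : enc_int z = map sym_of_cell (int_cells z).
Proof. by rewrite /enc_int /int_cells /= -enc_natE; case: (z < 0)%R. Qed.

Lemma parse_int z s : parse_cells (int_cells z ++ s) = int_code z :: parse_cells s.
Proof. by rewrite /int_cells cat_cons /= parse_num. Qed.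

Definition rat_cells (q : rat) : seq cell := int_cells (numq q) ++ int_cells (denq q).

Lemma enc_ratE q : enc_rat q = map sym_of_cell (rat_cells q).
Proof. by rewrite /enc_rat !enc_intE -map_cat. Qed.

Lemma parse_rat q s : parse_cells (rat_cells q ++ s) = [:: int_code (numq q), int_code (denq q) & parse_cells s].
Proof. by rewrite /rat_cells -catA !parse_int. Qed.

Lemma parse_flatten (T : Type) (C : T -> seq cell) (P : T -> seq nat) l s :
  (forall x s, parse_cells (C x ++ s) = P x ++ parse_cells s) ->
  parse_cells (flatten (map C l) ++ s) = flatten (map P l) ++ parse_cells s.
Proof. by move=> h; elim: l => //= x l IH; rewrite -!catA h IH. Qed.

Lemma map_flatten_cells (T : Type) (E : T -> seq sym) (C : T -> seq cell) l :
  (forall x, E x = map sym_of_cell (C x)) ->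
  flatten (map E l) = map sym_of_cell (flatten (map C l)).
Proof. by move=> h; elim: l => //= x l ->; rewrite h map_cat. Qed.

Section Encoding.
Variable I : instance.
Local Notation item := 'I_(nA I).
Local Notation buyer := 'I_(nB I).

Definition pairs : seq (item * buyer) :=
  [seq (a, b) | a <- enum 'I_(nA I), b <- enum 'I_(nB I)].

Definition edge_cells (x : item * buyer) : seq cell :=
  rat_cells (prob x.1 x.2) ++ rat_cells (wt x.1 x.2).
Definition type_cells (b : buyer) : seq cell := num_cells (tout b) ++ num_cells (cnt b).

Definition instance_cells : seq cell :=
  num_cells (nA I) ++ num_cells (nB I) ++ num_cells (nr I) ++
  flatten (map edge_cells pairs) ++ flatten (map type_cells (enum 'I_(nB I))).

Lemma enc_instanceE : enc_instance I = map sym_of_cell instance_cells.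
Proof.
rewrite /enc_instance /instance_cells !map_cat -!enc_natE.
congr (_ ++ (_ ++ (_ ++ (_ ++ _)))).
  rewrite -(@map_flatten_cells _ (fun x => enc_rat (prob x.1 x.2) ++ enc_rat (wt x.1 x.2))).
    by rewrite map_allpairs.
  by move=> x; rewrite !enc_ratE -map_cat.
by apply: map_flatten_cells => b; rewrite !enc_natE -map_cat.
Qed.

Definition round_cells (r : round I) : seq cell :=
  let: (b, s, o) := r in
  num_cells b ++ num_cells (size s) ++ flatten (map (fun a : item => num_cells a) s) ++
  num_cells (if o is Some a then (a : nat).+1 else 0).

Definition round_nats (r : round I) : seq nat :=
  let: (b, s, o) := r in
  [:: (b : nat); size s] ++ map val s ++ [:: if o is Some a then (a : nat).+1 else 0].

Lemma enc_roundE r : enc_round r = map sym_of_cell (round_cells r).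
Proof.
case: r => [[b s] o]; rewrite /enc_round /round_cells !map_cat -!enc_natE.
by congr (_ ++ (_ ++ (_ ++ _))); apply: map_flatten_cells => a; rewrite enc_natE.
Qed.

Lemma parse_round r s : parse_cells (round_cells r ++ s) = round_nats r ++ parse_cells s.
Proof.
case: r => [[b l] o]; rewrite /round_cells /round_nats -!catA !parse_num /=.
congr [:: _, _ & _].
rewrite (@parse_flatten _ _ (fun a : item => [:: val a])); last by move=> a t; rewrite parse_num.
rewrite parse_num; congr (_ ++ _).
by elim: l => //= a l ->.
Qed.

Definition input_cells (h : history I) (b : buyer) (R : seq bool) : seq cell :=
  instance_cells ++ num_cells (size h) ++ flatten (map round_cells h) ++ num_cells b ++
  map Some R ++ [:: None].

Lemma tm_inputE h b R : tm_input h b R = map sym_of_cell (input_cells h b R).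
Proof.
rewrite /tm_input enc_instanceE /input_cells [RHS]map_cat; congr (_ ++ _).
rewrite /enc_history /enc_bits !enc_natE !map_cat -!catA.
congr (_ ++ (_ ++ (_ ++ (_ ++ _)))).
  by apply: map_flatten_cells => r; rewrite enc_roundE.
by rewrite -map_comp; apply: eq_map => -[].
Qed.

Lemma parse_bits (R : seq bool) : exists m, parse_cells (map Some R ++ [:: None]) = [:: m].
Proof. by elim: R => [|x R [m e]] /=; [exists 0|rewrite e; eexists]. Qed.

Definition edge_nats (x : item * buyer) : seq nat :=
  [:: int_code (numq (prob x.1 x.2)); int_code (denq (prob x.1 x.2));
      int_code (numq (wt x.1 x.2)); int_code (denq (wt x.1 x.2))].
Definition type_nats (b : buyer) : seq nat := [:: tout b; cnt b].

Definition instance_nats : seq nat :=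
  [:: nA I; nB I; nr I] ++ flatten (map edge_nats pairs) ++
  flatten (map type_nats (enum 'I_(nB I))).

Lemma parse_instance s : parse_cells (instance_cells ++ s) = instance_nats ++ parse_cells s.
Proof.
rewrite /instance_cells /instance_nats -!catA !parse_num /=; congr [:: _, _, _ & _].
rewrite (@parse_flatten _ _ edge_nats); last first.
  by move=> x t; rewrite /edge_cells -catA !parse_rat.
by rewrite (@parse_flatten _ _ type_nats) // => b t; rewrite /type_cells -catA !parse_num.
Qed.

Definition at2 (F : item -> buyer -> rat) (i j : nat) : rat :=
  if insub i is Some a then if insub j is Some b then F a b else 0%R else 0%R.
Definition at1 (F : buyer -> nat) (j : nat) : nat := if insub j is Some b then F b else 0.

(** The sign bit doubles numerator and denominator alike, which leaves the quotient unchanged. *)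
Definition num2 (q : rat) : nat := (`|numq q|%N).*2.
Definition den2 (q : rat) : nat := (`|denq q|%N).*2.

(** Outside the range the value is 0, whose denominator is still positive, so the bounds on the data
    hold for every index. *)
Definition at_flat (F : item -> buyer -> rat) (k : nat) : rat := at2 F (k %/ nB I) (k %% nB I).

Lemma at_flatE F (a : item) (b : buyer) : at_flat F (a * nB I + b) = F a b.
Proof.
have b0 : 0 < nB I by apply: leq_ltn_trans (ltn_ord b).
by rewrite /at_flat divnMDl // modnMDl divn_small // modn_small // addn0 /at2 !valK.
Qed.

Lemma at_flat_ind (P : rat -> Prop) F k : P 0%R -> (forall a b, P (F a b)) -> P (at_flat F k).
Proof. by move=> h0 h; rewrite /at_flat /at2; case: insub => // a; case: insub. Qed.

Lemma at1E F (b : buyer) : at1 F b = F b.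
Proof. by rewrite /at1 valK. Qed.

End Encoding.

Lemma allpairs_up (T : Type) (F : nat -> nat -> T) m q :
  [seq F i j | i <- iota 0 m, j <- iota 0 q] = up (fun k => F (k %/ q) (k %% q)) 0 (m * q).
Proof.
rewrite /up subn0; elim: m => [//|m IH].
rewrite -addn1 iotaD map_cat flatten_cat mulnDl mul1n (iotaD 0 (m * q)) [RHS]map_cat -IH; congr (_ ++ _).
rewrite /= cats0 !add0n -[in RHS](addn0 (m * q)) iotaDl -map_comp.
apply/eq_in_map => j; rewrite mem_iota add0n => /andP[_ hj] /=.
have q0 : 0 < q by lia.
by rewrite divnMDl // modnMDl divn_small // modn_small // addn0.
Qed.

Lemma pairs_up (T : Type) (I : instance) (P : 'I_(nA I) * 'I_(nB I) -> T) (F : nat -> nat -> T) :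
  (forall a b, P (a, b) = F a b) ->
  map P (pairs I) = up (fun k => F (k %/ nB I) (k %% nB I)) 0 (nA I * nB I).
Proof.
move=> h; rewrite -allpairs_up /pairs map_allpairs -!val_enum_ord allpairs_mapl allpairs_mapr.
by apply: eq_allpairs.
Qed.

Lemma enum_up (T : Type) m (P : 'I_m -> T) (F : nat -> T) :
  (forall b, P b = F b) -> map P (enum 'I_m) = up F 0 m.
Proof. by move=> h; rewrite /up subn0 -val_enum_ord -map_comp; apply: eq_map. Qed.

Lemma int_code_num q : (0 <= q)%R -> int_code (numq q) = num2 q.
Proof. by move=> h; rewrite /int_code ltNge numq_ge0 h. Qed.

Lemma int_code_den q : int_code (denq q) = den2 q.
Proof. by rewrite /int_code ltNge denq_ge0. Qed.

Lemma num2_den2 q : (0 <= q)%R -> ((num2 q)%:R / (den2 q)%:R = q)%R.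
Proof.
move=> q0; rewrite /num2 /den2 -!muln2 !natrM -mulf_div divff ?mulr1 //.
by rewrite !natr_absz !ger0_norm ?numq_ge0 ?denq_ge0 // divq_num_den.
Qed.

Lemma den2_gt0 q : 0 < den2 q.
Proof. by rewrite /den2 double_gt0 absz_gt0 denq_eq0. Qed.

Lemma num2_le q : (0 <= q <= 1)%R -> num2 q <= den2 q.
Proof.
case/andP => q0 q1; have := q1; rewrite -{1}(num2_den2 q0) ler_pdivrMr ?ltr0n ?den2_gt0 //.
by rewrite mul1r ler_nat.
Qed.

(** * The machine's policy and its value *)

Section Correctness.
Variable I : instance.
Hypothesis vI : valid_instance I.

Definition data_pn k := num2 (at_flat (@prob I) k).
Definition data_pd k := den2 (at_flat (@prob I) k).
Definition data_wn k := num2 (at_flat (@wt I) k).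
Definition data_wd k := den2 (at_flat (@wt I) k).
Definition data_tt j := at1 (@tout I) j.
Definition data_cc j := at1 (@cnt I) j.

Lemma instance_natsE : instance_nats I = [:: nA I; nB I; nr I] ++
  flatten (up (quad data_pn data_pd data_wn data_wd) 0 (nA I * nB I)) ++
  flatten (up (duo data_tt data_cc) 0 (nB I)).
Proof.
rewrite /instance_nats; congr (_ ++ (flatten _ ++ flatten _)).
  rewrite (@pairs_up _ I _ (fun i j => [:: num2 (at2 (@prob I) i j); den2 (at2 (@prob I) i j);
     num2 (at2 (@wt I) i j); den2 (at2 (@wt I) i j)])) //.
  move=> a b; rewrite /edge_nats /= !int_code_den !int_code_num ?(wt_ge0 vI) //.
    by rewrite /at2 !valK.
  by case/andP: (prob_itv vI a b).
by apply: enum_up => b; rewrite /type_nats /duo /data_tt /data_cc !at1E.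
Qed.

Definition policy_list (r : nat) (b : 'I_(nB I)) : seq nat :=
  sel (nB I) b data_pn data_pd data_wn data_wd data_tt
    (nuq (nB I) (nr I) data_pn data_pd data_wn data_wd data_tt data_cc r) (nA I).

Lemma size_flatten_quad (T : Type) (f : nat -> seq T) c m :
  (forall k, size (f k) = c) -> size (flatten (up f 0 m)) = m * c.
Proof.
move=> h; have X l : size (flatten (map f l)) = size l * c.
  by elim: l => //= x l IH; rewrite size_cat h IH mulSn.
by rewrite X size_iota subn0.
Qed.

Lemma mem_flatten_up (T : eqType) (f : nat -> seq T) m k x : k < m -> x \in f k ->
  x \in flatten (up f 0 m).
Proof.
move=> hk hx; apply/flattenP; exists (f k) => //; apply: map_f.
by rewrite mem_iota subn0 add0n.
Qed.

Lemma output_correct h b R k c : 1000 <= c -> 3 <= k -> size h < nr I -> size R = nrand c k I ->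
  nth [::] (sem (size (input_cells h b R)) main_prog
    (parse_cells (input_cells h b R) :: nseq 32 [::])) 0 = policy_list (nr I - size h).-1 b.
Proof.
move=> hc hk hh hR.
set inp := input_cells h b R; set N := size inp.
have [m em] := parse_bits R.
pose junk := flatten (map (@round_nats I) h).
set m0 := size (instance_cells I).
have e0 : size (enc_instance I) = m0 by rewrite enc_instanceE size_map.
have ep : parse_cells inp = instance_nats I ++ size h :: junk ++ [:: (b : nat); m].
  rewrite /inp /input_cells parse_instance parse_num (parse_flatten _ _ (@parse_round I)).
  by rewrite parse_num em.
have pN x : x \in parse_cells inp -> x < 2 ^ N by apply: parse_bound.
have sN : size (parse_cells inp) <= N by apply: size_parse.
have pin : parse_cells (instance_cells I) = instance_nats I.
  by have := parse_instance I [::]; rewrite !cats0.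
have p0 x : x \in instance_nats I -> x < 2 ^ m0 by rewrite -pin; apply: parse_bound.
have s0 : size (instance_nats I) <= m0 by rewrite -pin; apply: size_parse.
move: s0; rewrite instance_natsE !size_cat /= (@size_flatten_quad _ _ 4) // (@size_flatten_quad _ _ 2) // => s0.
have NM : 1000 * (m0 + nr I + 1) ^ 3 <= N.
  apply: (@leq_trans (size R)); last by rewrite /N /inp /input_cells !size_cat size_map; lia.
  rewrite hR /nrand /pbound e0; apply: leq_mul => //.
  by rewrite leq_pexp2l //; lia.
have e_in x : x \in instance_nats I -> x < 2 ^ m0 := p0 x.
have bq j x : j < nA I * nB I -> x \in quad data_pn data_pd data_wn data_wd j -> x < 2 ^ m0.
  move=> hj hx; apply: e_in; rewrite instance_natsE !mem_cat (mem_flatten_up hj hx) !orbT //.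
have bd j x : j < nB I -> x \in duo data_tt data_cc j -> x < 2 ^ m0.
  move=> hj hx; apply: e_in; rewrite instance_natsE !mem_cat (mem_flatten_up hj hx) !orbT //.
have n0 := nr_gt0 vI.
set L := nA I * nB I in s0.
(* With [M = m0 + nr I + 1], every edge takes four numbers of the encoding, so there are at most
   [m0] edges and [bit_cap <= 7 M^3]. This is the origin of the exponent 3, and 39 times 7 is well
   below 1000. *)
have beN : 39 * bit_cap (nA I) (nB I) (nr I) m0 <= N.
  apply: leq_trans NM; rewrite /bit_cap /edge_steps -/L.
  have : 4 * m0 * (nr I * L) <= 4 * (m0 * (nr I * m0)) by rewrite -mulnA !leq_mul2l; lia.
  have X1 : m0 * (nr I * m0) <= (m0 + nr I + 1) ^ 3.
    by rewrite !expnS expn0 muln1; apply: leq_mul; [lia|apply: leq_mul; lia].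
  have X2 : m0 + nr I + 1 <= (m0 + nr I + 1) ^ 3 by rewrite -{1}[m0 + nr I + 1]expn1 leq_pexp2l //; lia.
  by lia.
have NM1 : 1000 * (m0 + nr I + 1) <= N.
  by apply: leq_trans NM; rewrite leq_mul2l -{1}[m0 + nr I + 1]expn1 leq_pexp2l //; lia.
rewrite ep instance_natsE -!catA.
have in3 x : x \in [:: nA I; nB I; nr I] -> x < 2 ^ m0.
  by move=> hx; apply: e_in; rewrite instance_natsE mem_cat hx.
apply: (@main_correct _ _ _ _ _ _ _ _ _ _ m0) => //; try lia.
- by move=> j _; apply: den2_gt0.
- by move=> j _; apply: den2_gt0.
- by move=> j hj; rewrite -[j]/(nat_of_ord (Ordinal hj)) /data_tt at1E (tout_gt0 vI).
- move=> j _; apply: num2_le; apply: (at_flat_ind (P := fun q => (0 <= q <= 1)%R)) => //.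
  by move=> *; apply: prob_itv.
- by case: vI => _ _ _ _ <-; apply: eq_bigr => j _; rewrite /data_cc at1E.
- by move=> j hj; apply: (bq j) => //; rewrite !inE eqxx.
- by move=> j hj; apply: (bq j) => //; rewrite !inE eqxx ?orbT.
- by move=> j hj; apply: (bq j) => //; rewrite !inE eqxx ?orbT.
- by move=> j hj; apply: (bq j) => //; rewrite !inE eqxx ?orbT.
- by move=> j hj; apply: (bd j) => //; rewrite !inE eqxx ?orbT.
- by move=> j hj; apply: (bd j) => //; rewrite !inE eqxx ?orbT.
- by apply: in3; rewrite !inE eqxx !orbT.
- by apply: in3; rewrite !inE eqxx.
- by apply: in3; rewrite !inE eqxx orbT.
- by apply: pN; rewrite ep !mem_cat !inE !mem_cat !inE eqxx !orbT.
- by apply/allP => x hx; apply: pN; rewrite ep !(mem_cat, inE) hx !orbT.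
- by move: sN; rewrite ep !size_cat /= size_cat /=; lia.
Qed.

(** Both values are compared with the sum [S] of the initial prices: any policy earns at most [4 S],
    this one at least [S]. *)
Lemma policy_value (pol : rpolicy I) (pol' : rpolicy I) :
  (forall h b, size h < nr I -> pol' h b = [:: (1%R, items I (policy_list (nr I - size h).-1 b))]) ->
  valid_rpolicy pol -> (0 <= value pol' /\ value pol <= 4 * value pol')%R.
Proof.
move=> hpol' hpol.
have hp (a : 'I_(nA I)) (b : 'I_(nB I)) : edge_p data_pn data_pd (a * nB I + b) = prob a b.
  rewrite /edge_p /data_pn /data_pd at_flatE num2_den2 //; by case/andP: (prob_itv vI a b).
have hw (a : 'I_(nA I)) (b : 'I_(nB I)) : edge_w data_wn data_wd (a * nB I + b) = wt a b.
  by rewrite /edge_w /data_wn /data_wd at_flatE num2_den2 // (wt_ge0 vI).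
have ht (b : 'I_(nB I)) : data_tt b = tout b by rewrite /data_tt at1E.
have hc (b : 'I_(nB I)) : data_cc b = cnt b by rewrite /data_cc at1E.
have U := value_upper vI hp hw ht hc (nr I) [::] hpol.
have Lo := @value_lower I vI _ _ _ _ _ _ hp hw ht hc pol' (nr I) [::].
have {}Lo := Lo _ (add0n _).
have {}Lo := Lo ltac:(move=> k h b hk hs; rewrite hpol' /policy_list; [by congr [:: (_, items I (sel _ _ _ _ _ _ _ (nuq _ _ _ _ _ _ _ _ _) _))]; lia|lia]).
rewrite /value.
have e (f : 'I_(nA I) -> rat) : (\sum_(a | unmatched [::] a) f a = \sum_a f a)%R by apply: eq_bigl.
rewrite !e in U Lo.
set S := (\sum_a _)%R in U Lo.
have S0 : (0 <= S)%R by apply: sumr_ge0 => a _; apply: nu_ge0 hc _ _.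
move: (value_from pol _ _) (value_from pol' _ _) U Lo => v v' U Lo.
by split; lra.
Qed.

End Correctness.

Local Open Scope ring_scope.

Theorem theorem3 :
  exists (M : TM) (c k : nat),
    poly_time M c k /\
    forall I : instance, valid_instance I ->
    forall pol : rpolicy I, valid_rpolicy pol ->
      (245%:R / 1000%:R) * value pol <= tm_value M c k I.
Proof.
have [C [d hM]] := @prog_machine 33 main_prog isT main_prog_ok.
move: (prog_tm _ _) hM => M hM.
have [c [k [cC c1 kd k3]]] : exists c k, [/\ (C <= c)%N, (1000 <= c)%N, (d <= k)%N & (3 <= k)%N].
  by exists (C + 1000)%N, (d + 3)%N; rewrite !leq_addr !leq_addl.
exists M, c, k.
have big I m : (C * m.+1 ^ d <= pbound c k I m)%N.
  rewrite /pbound; apply: leq_mul => //.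
  apply: (@leq_trans ((m + nr I + 1) ^ d)); first by case: (posnP d) => [->|d0]; rewrite ?expn0 // leq_exp2r //; lia.
  by rewrite leq_pexp2l //; lia.
(* The time bound comes from the shape of the program, so it holds on all inputs, valid or not. *)
split.
  move=> I h b R; rewrite tm_inputE size_map.
  by case: (hM (input_cells h b R) _ (big I _)).
move=> I vI pol hpol.
(* The comparison holds for each single random string of the prescribed length, hence for the
   average. *)
have V R : size R = nrand c k I ->
    0 <= value (@tm_policy M c k I R) /\ value pol <= 4 * value (@tm_policy M c k I R).
  move=> hR; apply: (@policy_value I vI pol (tm_policy M c k R) _ hpol) => h b hh.
  rewrite /tm_policy tm_inputE size_map.
  have [_ ->] := hM (input_cells h b R) _ (big I _).
  by rewrite (@output_correct I vI h b R k c).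
rewrite /tm_value; set W := (X in X * value pol); set T := 2%:R ^+ _.
have T0 : 0 < T by rewrite exprn_gt0 // ltr0n.
rewrite ler_pdivlMl //.
have -> : T * (W * value pol) = \sum_(R : (nrand c k I).-tuple bool) W * value pol.
  by rewrite sumr_const card_tuple card_bool -[RHS]mulr_natl natrX.
apply: ler_sum => R _; have [] := V R (size_tuple R).
by rewrite /W; move: (value pol) (value _) => v v'; lra.
Qed.
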